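(* Let $\Delta^+$ be an $\omega$-adapted positive system of sign $\varepsilon$, let $M$ be a unitary highest weight representation of $\mathfrak g$ (with respect to $\omega$) of highest weight $\Lambda$ with respect to $\Delta^+$, and write $M|_{\mathfrak g_{\bar0}}=\bigoplus_\mu L_0(\mu)^{m_\Lambda(\mu)}$. Then, for every $\mu$ with $m_\Lambda(\mu)\ne0$, one has $$-\varepsilon\bigl(-(\Lambda+2\rho,\Lambda)+(\mu+2\rho,\mu)\bigr)\ge0 .$$ Moreover, the inequality is strict whenever $\mu\ne\Lambda$.
   Context: Lie superalgebra. $\mathfrak g=\mathfrak g_{\bar0}\oplus\mathfrak g_{\bar1}$ is one of the complex Lie superalgebras $\mathfrak{sl}(m|n)$ ($m,n\ge1$, $m\neq n$), $\mathfrak{gl}(n|n)$ ($n\ge1$), $\mathfrak{osp}(m|2n)$ ($m,n\ge1$), or the exceptional $F(4)$ ($\mathfrak g_{\bar0}=\mathfrak{so}(7)\oplus\mathfrak{sl}(2)$, $\mathfrak g_{\bar1}=$ spin $\otimes\,\mathbb C^2$). The invariant form $(X,Y)$ is $\mathrm{str}(XY)$ for $\mathfrak{sl},\mathfrak{gl}$, $\frac12\mathrm{str}(XY)$ for $\mathfrak{osp}$, $\frac16\mathrm{str}_{\mathfrak g}(\mathrm{ad}X\,\mathrm{ad}Y)$ for $F(4)$; it induces a form $(\cdot,\cdot)$ on $\mathfrak h^*$. With $\Omega_n=\begin{pmatrix}0&I_n\\-I_n&0\end{pmatrix}$, $\mathfrak{osp}(m|2n)$ consists of the block matrices $\begin{pmatrix}A&B\\C&D\end{pmatrix}\in\mathfrak{gl}(m|2n)$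 with $A=-A^T$, $D=\Omega_nD^T\Omega_n$, $C=-\Omega_nB^T$. Cartan subalgebra $\mathfrak h\subseteq\mathfrak g_{\bar0}$: diagonal matrices for $\mathfrak{sl},\mathfrak{gl}$, with coordinates $\epsilon_i$ (entry $i\leq m$), $\delta_a$ (entry $m+a$); for $\mathfrak{osp}(m|2n)$, $r=\lfloor m/2\rfloor$, the matrices $H=\mathrm{diag}(t_1K,\dots,t_rK,0_{m-2r},i\Omega_n\mathrm{diag}(D,D))$ with $K=\begin{pmatrix}0&i\\-i&0\end{pmatrix}$, $D=\mathrm{diag}(d_1,\dots,d_n)$, $\epsilon_i(H)=t_i$, $\delta_a(H)=d_a$; for $F(4)$ the complexification of a Cartan subalgebra of a maximal compact subalgebra of the even real form below, with $\epsilon_1,\epsilon_2,\epsilon_3$ for $\mathfrak{so}(7)$ and $\delta$ the root of $\mathfrak{sl}(2)$. Fixed even positive system $\Delta_{\bar0}^+$: $\{\epsilon_i-\epsilon_j,\delta_a-\delta_b:i<j,a<b\}$ for $\mathfrak{sl},\mathfrak{gl}$; $\{\delta_a\pm\delta_b\ (a<b),2\delta_a,\epsilon_i\pm\epsilon_j\ (i<j)\}$, plus $\{\epsilon_i\}$ if $m$ is odd, for $\mathfrak{osp}$; $\{\delta,\epsilon_i,\epsilon_i\pm\epsilon_j\ (i<j)\}$ for $F(4)$. A positive system $\Delta^+=\Delta_{\bar0}^+\sqcup\Delta_{\bar1}^+$ extends this; $\rho=\rho_{\bar0}-\rho_{\bar1}$, $\rho_{\bar z}=\frac12\sum_{\alpha\in\Delta_{\bar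 z}^+}\alpha$; $\mathfrak n_{\bar1}^\pm=\bigoplus_{\alpha\in\Delta_{\bar1}^+}\mathfrak g^{\pm\alpha}$. Real forms. $\omega$ is a conjugate-linear anti-involution of $\mathfrak g$ (parity preserving, $\omega^2=\mathrm{id}$, $\omega([X,Y])=[\omega(Y),\omega(X)]$) of one of these types: $\omega(X)=J^{-1}\overline X^{\,t}J$ with $J=\mathrm{diag}(I_p,-I_q,\pm I_n)$, $p+q=m$, for $\mathfrak{sl},\mathfrak{gl}$; $J=\mathrm{diag}(\pm I_m,i\Omega_n)$ for $\mathfrak{osp}(m|2n)$, or, if $m=2r$, $J=\mathrm{diag}(i\bigoplus_{i=1}^r\Omega_1,\pm I_{2n})$; for $F(4)$, an anti-involution defining a real form with even part $\mathfrak{so}(7)\oplus\mathfrak{sl}(2,\mathbb R)$ or $\mathfrak{so}(2,5)\oplus\mathfrak{su}(2)$ (the even real form is $\{X\in\mathfrak g_{\bar0}:\omega(X)=-X\}$). $\Delta^+$ is $\omega$-adapted with sign $\varepsilon\in\{\pm1\}$ if there are bases $\{\partial_i\}$ of $\mathfrak n_{\bar1}^+$ and $\{x_i\}$ of $\mathfrak n_{\bar1}^-$ with $(\partial_i,x_j)=\delta_{ij}$ and $\omega(x_i)=\varepsilon\partial_i$ for all $i,j$. A $\mathfrak g$-representation $M$ is unitary if it carries a positive definite Hermitian form with $\langle M_{\bar0},M_{\bar1}\rangle=0$ and $\langle Xv,w\rangle=\langle v,\omega(X)w\rangle$. A unitary highest weight representation is simple, and its restriction to $\mathfrak g_{\bar0}$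 is a direct sum of simple highest weight modules $L_0(\mu)$ (highest weight $\mu$ with respect to $\Delta_{\bar0}^+$). *)

(* Defs.v *)
From HB Require Import structures.
From mathcomp Require Import all_boot all_order all_algebra.
From mathcomp Require Import sesquilinear ring.

Set Implicit Arguments.
Unset Strict Implicit.
Unset Printing Implicit Defensive.

Import Order.TTheory GRing.Theory Num.Theory.
Local Open Scope ring_scope.

(* Parities are booleans, [true] being odd. *)
Record lieSuperalgebra (K : fieldType) := LieSuperalgebra {
  ls_space :> vectType K;
  ls_part : bool -> {vspace ls_space};
  ls_br : {bilinear ls_space -> ls_space -> ls_space};
  ls_sum : (ls_part false + ls_part true)%VS = fullv;
  ls_direct : (ls_part false :&: ls_part true)%VS = 0%VS;
  ls_graded : forall a b X Y, X \in ls_part a -> Y \in ls_part b ->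
    ls_br X Y \in ls_part (a (+) b);
  ls_anti : forall a b X Y, X \in ls_part a -> Y \in ls_part b ->
    ls_br X Y = - ((-1) ^+ (a && b) *: ls_br Y X);
  ls_jacobi : forall a b X Y Z, X \in ls_part a -> Y \in ls_part b ->
    ls_br X (ls_br Y Z) =
    ls_br (ls_br X Y) Z + (-1) ^+ (a && b) *: ls_br Y (ls_br X Z)
}.
Arguments ls_part {K} _ _.
Arguments ls_br {K _}.

Section SubSuperalgebra.
Variables (K : fieldType) (g : lieSuperalgebra K) (U : {vspace g}).
Hypothesis Ubr : forall X Y, X \in U -> Y \in U -> ls_br X Y \in U.
Hypothesis Ugr : (U <= U :&: ls_part g false + U :&: ls_part g true)%VS.

Definition sub_br (X Y : subvs_of U) : subvs_of U :=
  vsproj U (ls_br (vsval X) (vsval Y)).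

Lemma vsval_br X Y : vsval (sub_br X Y) = ls_br (vsval X) (vsval Y).
Proof. by rewrite vsprojK // Ubr ?subvsP. Qed.

Fact sub_br_bilinear : bilinear_for *:%R *:%R sub_br.
Proof.
split=> X c Y Z; apply: val_inj; rewrite /= !vsval_br.
  exact: (linearPl (ls_br (l := g))).
exact: (linearPr (ls_br (l := g))).
Qed.

HB.instance Definition _ :=
  bilinear_isBilinear.Build K (subvs_of U) (subvs_of U) (subvs_of U)
    *:%R *:%R sub_br sub_br_bilinear.

Definition sub_part (a : bool) : {vspace subvs_of U} :=
  (linfun (@vsval _ _ U) @^-1: ls_part g a)%VS.

Lemma sub_partE a X : (X \in sub_part a) = (vsval X \in ls_part g a).
Proof. by rewrite -memv_preim lfunE. Qed.

Fact sub_sum : (sub_part false + sub_part true)%VS = fullv.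
Proof.
apply/eqP; rewrite eqEsubv subvf; apply/subvP=> X _.
have /memv_addP[Y /memv_capP[UY Y0] [Z /memv_capP[UZ Z1] XYZ]] :=
  subvP Ugr _ (subvsP X).
have -> : X = vsproj U Y + vsproj U Z.
  by apply: val_inj; rewrite /= XYZ !vsprojK.
by apply: memv_add; rewrite sub_partE vsprojK.
Qed.

Fact sub_direct : (sub_part false :&: sub_part true)%VS = 0%VS.
Proof.
apply/eqP; rewrite -subv0; apply/subvP=> X /memv_capP[].
rewrite !sub_partE memv0 => X0 X1; apply/eqP; apply: val_inj => /=.
by apply/eqP; rewrite -memv0 -(ls_direct g) memv_cap X0.
Qed.

Fact sub_graded a b X Y : X \in sub_part a -> Y \in sub_part b ->
  sub_br X Y \in sub_part (a (+) b).
Proof. by rewrite !sub_partE vsval_br; apply: ls_graded. Qed.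

Fact sub_anti a b X Y : X \in sub_part a -> Y \in sub_part b ->
  sub_br X Y = - ((-1) ^+ (a && b) *: sub_br Y X).
Proof.
rewrite !sub_partE => Xa Yb; apply: val_inj.
by rewrite /= !vsval_br (ls_anti Xa Yb).
Qed.

Fact sub_jacobi a b X Y Z : X \in sub_part a -> Y \in sub_part b ->
  sub_br X (sub_br Y Z) =
  sub_br (sub_br X Y) Z + (-1) ^+ (a && b) *: sub_br Y (sub_br X Z).
Proof.
rewrite !sub_partE => Xa Yb; apply: val_inj.
by rewrite /= !vsval_br (ls_jacobi _ Xa Yb).
Qed.

Definition sub_lie : lieSuperalgebra K :=
  LieSuperalgebra (ls_br := sub_br)
    sub_sum sub_direct sub_graded sub_anti sub_jacobi.

End SubSuperalgebra.

Ltac mx_abel :=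
  repeat match goal with |- context [?A *m ?B] =>
    let P := fresh in set P := (A *m B); clearbody P
  end;
  apply/matrixP=> ? ?; rewrite !mxE; ring.

Section GeneralLinear.
Variables (K : fieldType) (m n : nat).
Local Notation M := 'M[K]_(m + n).

Definition mxpart (a : bool) (X : M) : M :=
  if a then block_mx 0 (ursubmx X) (dlsubmx X) 0
  else block_mx (ulsubmx X) 0 0 (drsubmx X).

Fact mxpart_linear a : linear (mxpart a).
Proof.
move=> c X Y; case: a; rewrite /mxpart scale_block_mx add_block_mx;
by rewrite /ulsubmx /ursubmx /dlsubmx /drsubmx !linearP !scaler0 !addr0.
Qed.

HB.instance Definition _ a := 
  GRing.isLinear.Build K M M *:%R (mxpart a) (mxpart_linear a).

Definition gl_br (X Y : M) : M :=
  \sum_(a : bool) \sum_(b : bool)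
    (mxpart a X *m mxpart b Y
     - (-1) ^+ (a && b) *: (mxpart b Y *m mxpart a X)).

Fact gl_br_bilinear : bilinear_for *:%R *:%R gl_br.
Proof.
split=> X c Y Z; rewrite /gl_br /= scaler_sumr -big_split; apply: eq_bigr => a _ /=;
rewrite scaler_sumr -big_split; apply: eq_bigr => b _ /=.
- rewrite linearP /= mulmxDl mulmxDr -!scalemxAl -!scalemxAr scalerDr scalerBr.
  by rewrite !scalerA ?[_ ^+ _ * c]mulrC opprD addrACA.
- rewrite linearP /= mulmxDl mulmxDr -!scalemxAl -!scalemxAr scalerDr scalerBr.
  by rewrite !scalerA ?[_ ^+ _ * c]mulrC opprD addrACA.
Qed.

HB.instance Definition _ :=
  bilinear_isBilinear.Build K M M M *:%R *:%R gl_br gl_br_bilinear.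

Fact gl_brDr X : {morph gl_br X : Y Z / Y + Z}.
Proof. exact: (linearDr gl_br). Qed.

(* The matrices whose part of the other parity vanishes. *)
Definition gl_part (a : bool) : {vspace M} := lker (linfun (mxpart (~~ a))).

Lemma gl_partE a X : (X \in gl_part a) = (mxpart (~~ a) X == 0).
Proof. by rewrite memv_ker lfunE. Qed.

Lemma mxpart_sum X : mxpart false X + mxpart true X = X.
Proof. by rewrite add_block_mx !addr0 !add0r submxK. Qed.

Lemma mxpart_in a X : mxpart a X \in gl_part a.
Proof.
rewrite gl_partE; apply/eqP; case: a; rewrite /mxpart /=;
by rewrite ?block_mxKul ?block_mxKur ?block_mxKdl ?block_mxKdr block_mx0.
Qed.

Lemma mxpart_id a X : X \in gl_part a -> mxpart a X = X.
Proof.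
rewrite gl_partE => /eqP Xa; rewrite -[RHS]mxpart_sum.
by case: a Xa => /= ->; rewrite ?add0r ?addr0.
Qed.

Lemma mxpart0 a b X : X \in gl_part a -> b != a -> mxpart b X = 0.
Proof. by rewrite gl_partE; case: a b => [] [] //= /eqP. Qed.

Lemma gl_brE a b X Y : X \in gl_part a -> Y \in gl_part b ->
  gl_br X Y = X *m Y - (-1) ^+ (a && b) *: (Y *m X).
Proof.
move=> Xa Yb; rewrite /gl_br (bigD1 a) //= (bigD1 b) //=.
rewrite !mxpart_id // !big1 ?addr0 // => c ca.
  by rewrite big1 // => d _; rewrite (mxpart0 Xa ca) mul0mx mulmx0 scaler0 subr0.
by rewrite (mxpart0 Yb ca) mul0mx mulmx0 scaler0 subr0.
Qed.

Lemma mulmx_part a b X Y : X \in gl_part a -> Y \in gl_part b ->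
  X *m Y \in gl_part (a (+) b).
Proof.
move=> /mxpart_id <- /mxpart_id <-; rewrite gl_partE; apply/eqP.
case: a b => [] [] /=; rewrite mulmx_block !(mul0mx, mulmx0, addr0, add0r);
by rewrite ?block_mxKul ?block_mxKur ?block_mxKdl ?block_mxKdr block_mx0.
Qed.

Fact gl_sum : (gl_part false + gl_part true)%VS = fullv.
Proof.
apply/eqP; rewrite eqEsubv subvf; apply/subvP=> X _.
by rewrite -(mxpart_sum X) memv_add ?mxpart_in.
Qed.

Fact gl_direct : (gl_part false :&: gl_part true)%VS = 0%VS.
Proof.
apply/eqP; rewrite -subv0; apply/subvP=> X /memv_capP[X0 X1].
by rewrite memv0 -(mxpart_id X0) (mxpart0 X1).
Qed.

Fact gl_graded a b X Y : X \in gl_part a -> Y \in gl_part b ->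
  gl_br X Y \in gl_part (a (+) b).
Proof.
move=> Xa Yb; rewrite (gl_brE Xa Yb); apply: rpredB; first exact: mulmx_part.
by apply: rpredZ; rewrite addbC; apply: mulmx_part.
Qed.

Fact gl_anti a b X Y : X \in gl_part a -> Y \in gl_part b ->
  gl_br X Y = - ((-1) ^+ (a && b) *: gl_br Y X).
Proof.
move=> Xa Yb; rewrite (gl_brE Xa Yb) (gl_brE Yb Xa) andbC scalerBr opprB.
by rewrite scalerA -expr2 sqrr_sign scale1r.
Qed.

Fact gl_jacobi a b X Y Z : X \in gl_part a -> Y \in gl_part b ->
  gl_br X (gl_br Y Z) =
  gl_br (gl_br X Y) Z + (-1) ^+ (a && b) *: gl_br Y (gl_br X Z).
Proof.
move=> Xa Yb; rewrite -(mxpart_sum Z) !gl_brDr scalerDr.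
suff E c : let W := mxpart c Z in gl_br X (gl_br Y W) =
    gl_br (gl_br X Y) W + (-1) ^+ (a && b) *: gl_br Y (gl_br X W).
  rewrite (E false) (E true); exact: addrACA.
move: (mxpart c Z) (mxpart_in c Z) => W Wc /=.
rewrite (gl_brE Xa (gl_graded Yb Wc)) (gl_brE (gl_graded Xa Yb) Wc).
rewrite (gl_brE Yb (gl_graded Xa Wc)) (gl_brE Yb Wc) (gl_brE Xa Wc) (gl_brE Xa Yb).
rewrite !(mulmxBl, mulmxBr, scalerBr) -!scalemxAl -!scalemxAr !scalerA !mulmxA.
case: a b c {Xa Yb Wc} => [] [] [] /=;
rewrite ?(mulr1, mul1r, mulrN, scaleN1r, scale1r, expr0, expr1, opprK, opprD);
mx_abel.
Qed.

Definition gl_lie : lieSuperalgebra K :=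
  LieSuperalgebra (ls_br := gl_br)
    gl_sum gl_direct gl_graded gl_anti gl_jacobi.

Lemma gl_br_block A B C D A' B' C' D' :
  gl_br (block_mx A B C D) (block_mx A' B' C' D') =
  block_mx (A *m A' - A' *m A + (B *m C' + B' *m C))
           (A *m B' + B *m D' - (A' *m B + B' *m D))
           (C *m A' + D *m C' - (C' *m A + D' *m C))
           (D *m D' - D' *m D + (C *m B' + C' *m B)).
Proof.
rewrite /gl_br !big_bool /= !(expr0, expr1, scaleN1r, scale1r, opprK).
rewrite !block_mxKul !block_mxKur !block_mxKdl !block_mxKdr.
rewrite !mulmx_block !(mul0mx, mulmx0, addr0, add0r) !opp_block_mx.
rewrite !add_block_mx !(oppr0, addr0, add0r) !opprD.
by congr block_mx; mx_abel.
Qed.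

Definition mxstr (X : M) : K := \tr (ulsubmx X) - \tr (drsubmx X).

Fact mxstr_linear : linear_for *%R mxstr.
Proof.
move=> c X Y; rewrite /mxstr /ulsubmx /drsubmx !linearP /=.
by ring.
Qed.

HB.instance Definition _ := 
  GRing.isLinear.Build K M K *%R mxstr mxstr_linear.

Definition sl_space : {vspace M} := lker (linfun (mxstr : M -> K^o)).

Lemma sl_spaceE X : (X \in sl_space) = (mxstr X == 0).
Proof. by rewrite memv_ker lfunE. Qed.

Fact sl_space_br X Y : X \in sl_space -> Y \in sl_space ->
  gl_br X Y \in sl_space.
Proof.
move=> _ _; rewrite sl_spaceE -[X]submxK -[Y]submxK gl_br_block /mxstr.
rewrite block_mxKul block_mxKdr !raddfD /= !raddfN /=.
rewrite (mxtrace_mulC (ulsubmx X)) (mxtrace_mulC (drsubmx X)).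
by rewrite (mxtrace_mulC (ursubmx X)) (mxtrace_mulC (dlsubmx X)); apply/eqP; ring.
Qed.

Fact sl_space_graded :
  (sl_space <= sl_space :&: gl_part false + sl_space :&: gl_part true)%VS.
Proof.
apply/subvP=> X; rewrite sl_spaceE => X0; rewrite -(mxpart_sum X).
apply: memv_add; rewrite memv_cap mxpart_in andbT sl_spaceE /mxstr /=.
  by rewrite block_mxKul block_mxKdr.
by rewrite block_mxKul block_mxKdr !mxtrace0 subr0.
Qed.

Definition sl_lie : lieSuperalgebra K :=
  sub_lie (g := gl_lie) sl_space_br sl_space_graded.

End GeneralLinear.

Section Orthosymplectic.
Variables (K : fieldType) (m n : nat).
Local Notation M := 'M[K]_(m + (n + n)).

Definition Omega : 'M[K]_(n + n) := block_mx 0 1%:M (- 1%:M) 0.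

Lemma Omega_sqr : Omega *m Omega = - 1%:M.
Proof.
rewrite mulmx_block !(mul0mx, mulmx0, mul1mx, mulmx1, addr0, add0r).
by rewrite scalar_mx_block opp_block_mx !oppr0.
Qed.

Lemma Omega_tr : Omega^T = - Omega.
Proof.
by rewrite tr_block_mx opp_block_mx !linearN /= !trmx0 !trmx1 !oppr0 opprK.
Qed.

(* Vanishes exactly on the matrices of osp(m|2n). *)
Definition osp_defect (X : M) : M :=
  let A := ulsubmx X in let B := ursubmx X in
  let C := dlsubmx X in let D := drsubmx X in
  block_mx (A + A^T) 0
           (C + Omega *m B^T) (D - Omega *m D^T *m Omega).

Fact osp_defect_linear : linear osp_defect.
Proof.
move=> c X Y; rewrite /osp_defect scale_block_mx add_block_mx.
rewrite /ulsubmx /ursubmx /dlsubmx /drsubmx !linearP /=.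
rewrite scaler0 addr0 !(mulmxDl, mulmxDr) -!(scalemxAl, scalemxAr).
by congr block_mx; mx_abel.
Qed.

HB.instance Definition _ :=
  GRing.isLinear.Build K M M *:%R osp_defect osp_defect_linear.

Definition osp_space : {vspace M} := lker (linfun osp_defect).

Lemma osp_spaceP A B C D : reflect
  [/\ A = - A^T, D = Omega *m D^T *m Omega & C = - (Omega *m B^T)]
  (block_mx A B C D \in osp_space).
Proof.
rewrite memv_ker lfunE /= /osp_defect !(block_mxKul, block_mxKur, block_mxKdl, block_mxKdr).
apply: (iffP eqP) => [|[HA HD HC]].
  rewrite -[0 in RHS](block_mx0 K m (n + n) m (n + n)).
  case/eq_block_mx=> /eqP HA _ /eqP HC /eqP HD; split; apply/eqP.
  - by rewrite -addr_eq0.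
  - by rewrite -subr_eq0.
  - by rewrite -addr_eq0.
by rewrite -HD subrr HC addNr {1}HA addNr block_mx0.
Qed.

Fact osp_space_br X Y : X \in osp_space -> Y \in osp_space ->
  gl_br X Y \in osp_space.
Proof.
rewrite -[X]submxK -[Y]submxK.
move: (ulsubmx X) (ursubmx X) (dlsubmx X) (drsubmx X) => A B C D.
move: (ulsubmx Y) (ursubmx Y) (dlsubmx Y) (drsubmx Y) => A' B' C' D'.
move=> /osp_spaceP[HA HD HC] /osp_spaceP[HA' HD' HC'].
have W2 k (Z : 'M_(_, k)) : Omega *m (Omega *m Z) = - Z.
  by rewrite mulmxA Omega_sqr mulNmx mul1mx.
have trD p q (V W : 'M[K]_(p, q)) : (V + W)^T = V^T + W^T by exact: raddfD.
have trN p q (V : 'M[K]_(p, q)) : (- V)^T = - V^T by exact: raddfN.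
have tA : A^T = - A by rewrite {2}HA opprK.
have tA' : A'^T = - A' by rewrite {2}HA' opprK.
have tD : D^T = Omega *m (D *m Omega).
  by rewrite {2}HD -!mulmxA Omega_sqr W2 mulmxN mulmx1 opprK.
have tD' : D'^T = Omega *m (D' *m Omega).
  by rewrite {2}HD' -!mulmxA Omega_sqr W2 mulmxN mulmx1 opprK.
have tC : C^T = B *m Omega.
  by rewrite HC linearN /= trmx_mul trmxK Omega_tr mulmxN opprK.
have tC' : C'^T = B' *m Omega.
  by rewrite HC' linearN /= trmx_mul trmxK Omega_tr mulmxN opprK.
have tB : B^T = Omega *m C by rewrite HC mulmxN W2 opprK.
have tB' : B'^T = Omega *m C' by rewrite HC' mulmxN W2 opprK.
rewrite gl_br_block; apply/osp_spaceP; split.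
- rewrite !(trD, trN) !trmx_mul tA tA' tB tB' tC tC'.
  rewrite !(mulmxN, mulNmx, opprK) -!mulmxA !W2 !mulmxN.
  by mx_abel.
- rewrite !(trD, trN) !trmx_mul tD tD' tB tB' tC tC'.
  rewrite !(mulmxDl, mulmxDr, mulmxN, mulNmx, opprK) -!mulmxA.
  rewrite !(W2, Omega_sqr, mulmxN, mulNmx, opprK, mulmx1).
  by mx_abel.
- rewrite !(trD, trN) !trmx_mul tD tD' tB tB' tA tA'.
  rewrite !(mulmxDl, mulmxDr, mulmxN, mulNmx, opprK) -!mulmxA.
  rewrite !(W2, Omega_sqr, mulmxN, mulNmx, opprK, mulmx1).
  by mx_abel.
Qed.

Fact osp_space_graded :
  (osp_space <= osp_space :&: gl_part K m (n + n) false
                + osp_space :&: gl_part K m (n + n) true)%VS.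
Proof.
apply/subvP=> X; rewrite -[X in X \in osp_space]submxK => /osp_spaceP[HA HD HC].
rewrite -(mxpart_sum X); apply: memv_add; rewrite memv_cap mxpart_in andbT;
  by apply/osp_spaceP; split=> //; rewrite !(trmx0, mulmx0, mul0mx, oppr0).
Qed.

Definition osp_lie : lieSuperalgebra K :=
  sub_lie (g := gl_lie K m (n + n)) osp_space_br osp_space_graded.

End Orthosymplectic.

(* In what follows [C] plays the part of the complex numbers.

   The data attached to one of the Lie superalgebras of [listed]: the Cartan
   subalgebra, the invariant form, the fixed even positive system, and the
   condition on an anti-involution to be of one of the admitted types. *)
Section Weights.
Variables (C : numClosedFieldType) (g : lieSuperalgebra C) (h : {vspace g}).

Definition weight := 'Hom(subvs_of h, C^o).

(* [wt al H] is [al H], read in [C] so that the order of [C] applies. *)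
Definition wt (al : weight) (H : subvs_of h) : C := al H.

Definition root_space (z : bool) (al : weight) : {vspace g} :=
  (ls_part g z :&: lker (linfun (fun X : g =>
     linfun (fun H : subvs_of h => ls_br (vsval H) X - wt al H *: X))))%VS.

Definition is_root (z : bool) (al : weight) : bool :=
  (al != 0) && (root_space z al != 0%VS).

(* The induced form on weights: [la] is transported to the [H_la] in [h] with
   [(H_la, H) = la H], by the inverse of the isomorphism [H |-> (H, .)]. *)
Definition dual_form (form : g -> g -> C) (la mu : weight) : C :=
  let flat : 'Hom(subvs_of h, weight) :=
    linfun (fun H : subvs_of h =>
      linfun (fun H' : subvs_of h => form (vsval H) (vsval H') : C^o)) in
  mu ((flat^-1)%VF la).

End Weights.

Record datum (C : numClosedFieldType) := Datum {
  d_alg :> lieSuperalgebra C;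
  d_form : d_alg -> d_alg -> C;
  d_cartan : {vspace d_alg};
  d_pos0 : seq (weight d_cartan);
  d_omega : (d_alg -> d_alg) -> Prop
}.
Arguments d_form {C} _ _ _.
Arguments d_cartan {C} _.
Arguments d_pos0 {C} _.
Arguments d_omega {C} _ _.

Section Data.
Variable C : numClosedFieldType.

Definition ltpairs (n : nat) : seq ('I_n * 'I_n) :=
  [seq p : 'I_n * 'I_n <- enum {: 'I_n * 'I_n} | (p.1 < p.2)%N].

Definition adjoint_mx m n (X : 'M[C]_(m, n)) : 'M[C]_(n, m) :=
  map_mx Num.conj X^T.

Definition sig_mx (m p : nat) : 'M[C]_m :=
  diag_mx (\row_(i < m) (if (i < p)%N then 1 else - 1)).

(* diag(t_1 K, ..., t_r K, 0_(m-2r)) with r = floor(m/2), K = 'i Omega_1. *)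
Definition torus_mx (m : nat) (t : 'rV[C]_(m./2)) : 'M[C]_m :=
  \matrix_(i, j) \sum_(k < m./2) 'i * t 0 k *
     (((i == k.*2 :> nat) && (j == k.*2.+1 :> nat))%:R
      - ((i == k.*2.+1 :> nat) && (j == k.*2 :> nat))%:R).

Section TypeA.
Variables (m n : nat) (g : lieSuperalgebra C).
Variable mat : {linear g -> 'M[C]_(m + n)}.

Definition A_form (X Y : g) : C := mxstr (mat X *m mat Y).

Definition A_cartan : {vspace g} :=
  (linfun mat @^-1: limg (linfun (@diag_mx C (m + n))))%VS.

Definition A_eps (i : 'I_m) : weight A_cartan :=
  linfun (fun H : subvs_of A_cartan =>
            mat (vsval H) (lshift n i) (lshift n i) : C^o).

Definition A_delta (a : 'I_n) : weight A_cartan :=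
  linfun (fun H : subvs_of A_cartan =>
            mat (vsval H) (rshift m a) (rshift m a) : C^o).

Definition A_pos0 : seq (weight A_cartan) :=
  [seq A_eps p.1 - A_eps p.2 | p <- ltpairs m]
  ++ [seq A_delta p.1 - A_delta p.2 | p <- ltpairs n].

Definition A_omega (w : g -> g) : Prop :=
  exists p : nat, exists s : bool, (p <= m)%N /\
    let J := block_mx (sig_mx m p) 0 0 ((-1) ^+ s)%:M in
    forall X, mat (w X) = invmx J *m adjoint_mx (mat X) *m J.

Definition A_datum : datum C := Datum A_form A_pos0 A_omega.
End TypeA.

Definition gl_datum (n : nat) : datum C :=
  @A_datum n n (gl_lie C n n) idfun.

Definition sl_datum (m n : nat) : datum C :=
  @A_datum m n (sl_lie C m n) (@vsval _ _ _).

Section TypeBCD.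
Variables m n : nat.
Local Notation g := (osp_lie C m n).
Local Notation mat := (@vsval _ _ (osp_space C m n)).

Definition osp_form (X Y : g) : C := 2^-1 * mxstr (mat X *m mat Y).

Definition osp_torus (td : 'rV[C]_(m./2) * 'rV[C]_n) : 'M[C]_(m + (n + n)) :=
  block_mx (torus_mx td.1) 0
           0 ('i *: (Omega C n *m diag_mx (row_mx td.2 td.2))).

Definition osp_cartan : {vspace g} :=
  (linfun mat @^-1: limg (linfun osp_torus))%VS.

Definition osp_coord (H : subvs_of osp_cartan) : 'rV[C]_(m./2) * 'rV[C]_n :=
  ((linfun osp_torus)^-1)%VF (mat (vsval H)).

Definition osp_eps (i : 'I_(m./2)) : weight osp_cartan :=
  linfun (fun H : subvs_of osp_cartan => (osp_coord H).1 0 i : C^o).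

Definition osp_delta (a : 'I_n) : weight osp_cartan :=
  linfun (fun H : subvs_of osp_cartan => (osp_coord H).2 0 a : C^o).

Definition osp_pos0 : seq (weight osp_cartan) :=
  [seq osp_delta p.1 + osp_delta p.2 | p <- ltpairs n]
  ++ [seq osp_delta p.1 - osp_delta p.2 | p <- ltpairs n]
  ++ [seq 2 *: osp_delta a | a <- enum 'I_n]
  ++ [seq osp_eps p.1 + osp_eps p.2 | p <- ltpairs m./2]
  ++ [seq osp_eps p.1 - osp_eps p.2 | p <- ltpairs m./2]
  ++ (if odd m then [seq osp_eps i | i <- enum 'I_(m./2)] else [::]).

(* [torus_mx (const_mx 1)] is 'i (Omega_1 + ... + Omega_1). *)
Definition osp_omega (w : g -> g) : Prop :=
  exists J : 'M[C]_(m + (n + n)), exists s : bool,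
    (J = block_mx ((-1) ^+ s)%:M 0 0 ('i *: Omega C n)
     \/ ~~ odd m /\ J = block_mx (torus_mx (const_mx 1)) 0 0 ((-1) ^+ s)%:M)
    /\ forall X, mat (w X) = invmx J *m adjoint_mx (mat X) *m J.

Definition osp_datum : datum C := Datum osp_form osp_pos0 osp_omega.
End TypeBCD.

Section F4.
Variables (g : lieSuperalgebra C) (phi : {linear ('M[C]_7 * 'M[C]_2)%type -> g}).

Definition so7_sl2 (AB : 'M[C]_7 * 'M[C]_2) : Prop :=
  AB.1^T = - AB.1 /\ \tr AB.2 = 0.

(* The image of A in so(7) under the spin representation attached to gamma
   matrices [gam]; both Clifford modules of dimension 8 give the same
   so(7)-module up to isomorphism. *)
Definition spin (gam : 'I_7 -> 'M[C]_8) (A : 'M[C]_7) : 'M[C]_8 :=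
  \sum_i \sum_j (4^-1 * A i j) *: (gam i *m gam j).

Definition clifford (gam : 'I_7 -> 'M[C]_8) : Prop :=
  forall i j, gam i *m gam j + gam j *m gam i = (2 * (i == j)%:R)%:M.

Definition simple_lie : Prop :=
  forall I : {vspace g},
    (I <= I :&: ls_part g false + I :&: ls_part g true)%VS ->
    (forall X Y, Y \in I -> ls_br X Y \in I) ->
    I = 0%VS \/ I = fullv.

(* F(4) is the simple Lie superalgebra with even part so(7) + sl(2) (via [phi])
   and odd part spin (x) C^2, the latter being written as 8 x 2 matrices. *)
Definition is_F4 : Prop :=
  [/\ simple_lie,
      forall AB AB', so7_sl2 AB -> so7_sl2 AB' ->
        phi (AB.1 *m AB'.1 - AB'.1 *m AB.1, AB.2 *m AB'.2 - AB'.2 *m AB.2)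
        = ls_br (phi AB) (phi AB'),
      forall AB, so7_sl2 AB -> phi AB = 0 -> AB = 0,
      forall X, X \in ls_part g false <-> exists2 AB, so7_sl2 AB & X = phi AB
    & exists gam, exists psi : 'Hom('M[C]_(8, 2), g),
        [/\ clifford gam, lker psi = 0%VS, limg psi = ls_part g true
          & forall AB P, so7_sl2 AB ->
              ls_br (phi AB) (psi P) = psi (spin gam AB.1 *m P + P *m AB.2^T)]].

(* The supertrace of [f]: the trace of [f] composed with the grading operator. *)
Definition lstr (f : g -> g) : C :=
  let b := vbasis (fullv : {vspace g}) in
  let sg (X : g) := daddv_pi (ls_part g false) (ls_part g true) X
                    - daddv_pi (ls_part g true) (ls_part g false) X in
  \sum_i coord b i (f (sg (tnth b i))).

Definition F4_form (X Y : g) : C :=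
  6^-1 * lstr (fun Z => ls_br X (ls_br Y Z)).

Definition F4_torus (td : 'rV[C]_(7./2) * 'rV[C]_(2./2)) : g :=
  phi (torus_mx td.1, torus_mx td.2).

Definition F4_cartan : {vspace g} := limg (linfun F4_torus).

Definition F4_coord (H : subvs_of F4_cartan) : 'rV[C]_(7./2) * 'rV[C]_(2./2) :=
  ((linfun F4_torus)^-1)%VF (vsval H).

Definition F4_eps (i : 'I_(7./2)) : weight F4_cartan :=
  linfun (fun H : subvs_of F4_cartan => (F4_coord H).1 0 i : C^o).

(* The root of sl(2) takes the value 2d on dK. *)
Definition F4_delta : weight F4_cartan :=
  linfun (fun H : subvs_of F4_cartan => 2 * (F4_coord H).2 0 ord0 : C^o).

Definition F4_pos0 : seq (weight F4_cartan) :=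
  F4_delta :: [seq F4_eps i | i <- enum 'I_(7./2)]
  ++ [seq F4_eps p.1 + F4_eps p.2 | p <- ltpairs (7./2)]
  ++ [seq F4_eps p.1 - F4_eps p.2 | p <- ltpairs (7./2)].

Definition sig25_mx (k : 'I_3) : 'M[C]_7 :=
  diag_mx (\row_(i < 7) (if i./2 == k then 1 else - 1)).

(* [phi] identifies the even real form with so(7) + sl(2,R) in the first case
   and with so(2,5) + su(2) in the second, in such a way that [F4_cartan] is
   the complexification of a Cartan subalgebra of a maximal compact subalgebra.
   As [phi] is arbitrary, this is no restriction; the position [k] of the
   noncompact pair accounts for all numberings of the [F4_eps]. *)
Definition F4_omega (w : g -> g) : Prop :=
  (forall AB, so7_sl2 AB ->
     w (phi AB) = phi (adjoint_mx AB.1, - map_mx Num.conj AB.2))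
  \/ exists k, forall AB, so7_sl2 AB ->
     w (phi AB) = phi (sig25_mx k *m adjoint_mx AB.1 *m sig25_mx k,
                       adjoint_mx AB.2).

Definition F4_datum : datum C := Datum F4_form F4_pos0 F4_omega.
End F4.

Inductive listed : datum C -> Prop :=
| listed_sl m n of (0 < m)%N & (0 < n)%N & m <> n : listed (sl_datum m n)
| listed_gl n of (0 < n)%N : listed (gl_datum n)
| listed_osp m n of (0 < m)%N & (0 < n)%N : listed (osp_datum m n)
| listed_F4 g phi of @is_F4 g phi : listed (F4_datum phi).

End Data.

Section PositiveSystems.
Variables (C : numClosedFieldType) (D : datum C).
Local Notation h := (d_cartan D).
Local Notation hdual := (weight h).

Definition anti_involution (w : D -> D) : Prop :=
  [/\ forall X Y, w (X + Y) = w X + w Y,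
      forall c X, w (c *: X) = (c^*)%R *: w X,
      forall z X, X \in ls_part D z -> w X \in ls_part D z,
      involutive w
    & forall X Y, w (ls_br X Y) = ls_br (w Y) (w X)].

Variable P1 : seq hdual.

(* [P1] is the set of positive odd roots. *)
Definition pos (z : bool) : seq hdual := if z then P1 else d_pos0 D.

(* The even and odd roots that are positive are those that are positive on some
   regular element of the Cartan subalgebra on which all roots are real. *)
Definition positive_system : Prop :=
  uniq P1 /\
  exists H : subvs_of h, forall z al,
    (is_root z al -> 0 < wt al H \/ wt al H < 0) /\
    (al \in pos z) = is_root z al && (0 < wt al H).

Definition rho_part (z : bool) : hdual := 2^-1 *: \sum_(al <- pos z) al.
Definition rho : hdual := rho_part false - rho_part true.

Definition n1_plus : {vspace D} := (\sum_(al <- P1) root_space true al)%VS.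
Definition n1_minus : {vspace D} := (\sum_(al <- P1) root_space true (- al))%VS.

Definition adapted (w : D -> D) (eps : C) : Prop :=
  (eps = 1 \/ eps = - 1) /\
  exists N, exists d : N.-tuple D, exists x : N.-tuple D,
  [/\ basis_of n1_plus d, basis_of n1_minus x,
      forall i j, d_form D (tnth d i) (tnth x j) = (i == j)%:R
    & forall i, w (tnth x i) = eps *: tnth d i].

End PositiveSystems.

Definition subspace (K : fieldType) (V : lmodType K) (N : V -> Prop) : Prop :=
  N 0 /\ forall c u v, N u -> N v -> N (c *: u + v).

Record superrep (K : fieldType) (g : lieSuperalgebra K) := Superrep {
  sr_space :> lmodType K;
  sr_part : bool -> sr_space -> Prop;
  sr_act : {bilinear g -> sr_space -> sr_space};
  sr_sub : forall z, subspace (sr_part z);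
  sr_sum : forall v, exists v0 v1,
    [/\ sr_part false v0, sr_part true v1 & v = v0 + v1];
  sr_direct : forall v, sr_part false v -> sr_part true v -> v = 0;
  sr_graded : forall a b X v, X \in ls_part g a -> sr_part b v ->
    sr_part (a (+) b) (sr_act X v);
  sr_br : forall a b X Y v, X \in ls_part g a -> Y \in ls_part g b ->
    sr_act (ls_br X Y) v =
    sr_act X (sr_act Y v) - (-1) ^+ (a && b) *: sr_act Y (sr_act X v)
}.
Arguments sr_part {K g} _ _ _.
Arguments sr_act {K g _}.

Section Representations.
Variables (C : numClosedFieldType) (D : datum C) (M : superrep D).
Local Notation hdual := (weight (d_cartan D)).

Definition unitary (w : D -> D) : Prop :=
  exists F : {dot M for Num.conj},
    (forall v v', sr_part M false v -> sr_part M true v' -> F v v' = 0) /\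
    (forall X v v', F (sr_act X v) v' = F v (sr_act (w X) v')).

Definition weight_vector (la : hdual) (v : M) : Prop :=
  forall H, sr_act (vsval H) v = wt la H *: v.

Definition killed_by (z : bool) (al : hdual) (v : M) : Prop :=
  forall X, X \in root_space z al -> sr_act X v = 0.

Definition highest_weight (P1 : seq hdual) (La : hdual) : Prop :=
  exists z, exists v : M,
  [/\ v <> 0, sr_part M z v, weight_vector La v,
      forall z' al, al \in pos P1 z' -> killed_by z' al v
    & forall N : M -> Prop, subspace N ->
        (forall X u, N u -> N (sr_act X u)) -> N v -> forall u, N u].

Definition g0_submodule (N : M -> Prop) : Prop :=
  subspace N /\ forall X u, X \in ls_part D false -> N u -> N (sr_act X u).

Definition is_L0 (mu : hdual) (N : M -> Prop) : Prop :=
  [/\ g0_submodule N,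
      exists v, [/\ v <> 0, N v, weight_vector mu v
        & forall al, al \in d_pos0 D -> killed_by false al v]
    & forall N' : M -> Prop, g0_submodule N' -> (forall u, N' u -> N u) ->
        (forall u, N' u -> u = 0) \/ (forall u, N u -> N' u)].

(* The restriction of [M] to the even part is the direct sum of the
   [N mu k], and for each [mu] there are [mult mu] of them, all isomorphic to
   the simple highest weight module of highest weight [mu]. *)
Definition g0_decomposition (mult : hdual -> nat)
    (N : forall mu, 'I_(mult mu) -> M -> Prop) : Prop :=
  let I := {mu : hdual & 'I_(mult mu)} in
  let in_summand (u : I -> M) := forall i, N (tag i) (tagged i) (u i) in
  [/\ forall mu k, is_L0 mu (N mu k),
      forall v, exists s : seq I, exists2 u, in_summand u & v = \sum_(i <- s) u i
    & forall (s : seq I) u, uniq s -> in_summand u ->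
        \sum_(i <- s) u i = 0 -> forall i, i \in s -> u i = 0].

End Representations.

(* Main.v *)
(* The quadratic Casimir operator acts on M by the scalar (La + 2 rho, La), as one
   sees on the highest weight vector.  Let v be the highest weight vector of an even
   constituent L_0(mu).  Writing the Casimir operator in a basis of root vectors in
   which the odd part is formed with the dual bases x_i, d_i of the adapted positive
   system, its value on v is (mu + 2 rho, mu) v + 2 sum_i x_i d_i v.  Pairing with v
   and using w x_i = eps d_i turns this into
     - eps * gap * |v|^2 = 2 sum_i |d_i v|^2 >= 0.
   If equality holds, v is killed by all positive root vectors; if moreover
   mu <> La, unitarity makes v orthogonal to the highest weight vector and to the
   image of every negative root vector, hence to all of M.
   The argument needs an invariant nondegenerate form, the Cartan subalgebra as its
   own zero weight space, and one-dimensional root spaces; these are checked for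
   each family on an explicit eigenbasis.  The even part of F(4) is that of
   osp(7|2), and its odd root spaces are cut out by the rank-one joint
   eigenprojectors of the commuting involutions i gamma_{2k} gamma_{2k+1}. *)

From HB Require Import structures.
Require Import Defs.
From mathcomp Require Import all_boot all_order all_algebra.
From mathcomp Require Import sesquilinear ring zify.
From mathcomp Require Import reals complex.

Set Implicit Arguments.
Unset Strict Implicit.
Unset Printing Implicit Defensive.

Import Order.TTheory GRing.Theory Num.Theory.
Local Open Scope ring_scope.

(** * The Casimir operator *)

(** The families enter the argument only through [regular_datum]. About w it records just that h is
    stable; that w turns a negative root vector into something acting like the positive one is not
    checked root by root, but drawn from positivity of the Hermitian form on the weight vector at
    hand. The torus of osp(m|2n) is not diagonal in the given matrices. Writing Pi for the
    permutation matrix exchanging paired coordinates, 1 - ['i] Pi diagonalises it, and in the new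
    basis minus the supertranspose maps matrix units to multiples of matrix units. Hence every root
    vector is the projection of a matrix unit, and two units with the same root have proportional
    projections. The Killing form of F(4) is never evaluated: the dual bases of the adapted system
    exhibit a pair of vectors with product 1, and simplicity turns a nonzero invariant form into a
    nondegenerate one. *)

Lemma linfunE (K : fieldType) (U V : vectType K) (f : U -> V) :
  linear f -> linfun f =1 f.
Proof.
move=> fL; pose F := GRing.isLinear.Build _ _ _ _ f fL.
exact: (lfunE (HB.pack_for {linear U -> V} f F)).
Qed.

Section RootSpaces.
Variables (C : numClosedFieldType) (g : lieSuperalgebra C) (h : {vspace g}).
Implicit Types (al be : weight h) (X Y : g).

(** A [linfun] of a bare function agrees with it only once linearity is known, so the nested
    [linfun] of [root_space] calls for linearity in H and in X separately. *)
Lemma root_spaceP z al X : reflect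
  (X \in ls_part g z /\ forall H : subvs_of h, ls_br (vsval H) X = wt al H *: X)
  (X \in root_space z al).
Proof.
pose ev Y := linfun (fun H : subvs_of h => ls_br (vsval H) Y - wt al H *: Y).
have evE Y H : ev Y H = ls_br (vsval H) Y - wt al H *: Y.
  pose f (H : subvs_of h) : g := ls_br (vsval H) Y - wt al H *: Y.
  have fL : linear f.
    move=> c H1 H2; rewrite /f /wt !linearP linearPl scalerDl -scalerA scalerBr.
    by rewrite opprD addrACA.
  exact: (linfunE fL).
have evL : linear ev.
  move=> c Y1 Y2; apply/lfunP=> H; rewrite add_lfunE scale_lfunE !evE linearP /=.
  by rewrite scalerDr scalerBr opprD addrACA !scalerA mulrC.
have evK : (X \in lker (linfun ev)) = (ev X == 0).
  by rewrite memv_ker linfunE.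
rewrite /root_space memv_cap -/ev evK; apply: (iffP andP) => [[Xz /eqP X0]|[Xz X0]].
  by split=> // H; apply/eqP; rewrite -subr_eq0 -evE X0 zero_lfunE.
by split=> //; apply/eqP/lfunP=> H; rewrite evE X0 subrr zero_lfunE.
Qed.

Lemma sumv_ind (I : eqType) (s : seq I) (V : I -> {vspace g}) (P : g -> Prop) :
  P 0 -> (forall X Y, P X -> P Y -> P (X + Y)) ->
  (forall i X, i \in s -> X \in V i -> P X) ->
  forall X, X \in (\sum_(i <- s) V i)%VS -> P X.
Proof.
move=> P0 PD; elim: s => [|i s IHs] Ps X.
  by rewrite big_nil memv0 => /eqP->.
rewrite big_cons => /memv_addP[Y Yi [Z Zs ->]]; apply: PD.
  by apply: Ps Yi; rewrite mem_head.
by apply: IHs Zs => j W js; apply: Ps; rewrite in_cons js orbT.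
Qed.

End RootSpaces.

Record invariant_form (C : numClosedFieldType) (g : lieSuperalgebra C)
    (B : g -> g -> C) : Prop := InvariantForm {
  form_linearl : forall Y, linear_for *%R (B^~ Y);
  form_linearr : forall X, linear_for *%R (B X);
  form_even : forall a b X Y, X \in ls_part g a -> Y \in ls_part g b ->
    a != b -> B X Y = 0;
  form_sym : forall a X Y, X \in ls_part g a -> Y \in ls_part g a ->
    B Y X = (-1) ^+ a * B X Y;
  form_inv : forall X Y Z, B (ls_br X Y) Z = B X (ls_br Y Z);
  form_nondeg : forall X, (forall Y, B X Y = 0) -> X = 0
}.

(** For odd z, [root_space0] says that 0 is not an odd weight, because h is even. *)
Record regular_cartan (C : numClosedFieldType) (g : lieSuperalgebra C)
    (h : {vspace g}) : Prop := RegularCartan {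
  cartan_even : (h <= ls_part g false)%VS;
  cartan_abelian : forall H H', H \in h -> H' \in h -> ls_br H H' = 0;
  root_span : forall z, exists s : seq (weight h),
    (ls_part g z <= \sum_(al <- s) root_space z al)%VS;
  root_space0 : forall z, (root_space z (0 : weight h)%R <= h)%VS;
  root_space_dim : forall z (al : weight h), al != 0 ->
    (\dim (root_space z al) <= 1)%N
}.

Section Form.
Variables (C : numClosedFieldType) (g : lieSuperalgebra C) (B : g -> g -> C).
Hypothesis HB : invariant_form B.

Lemma formDl X Y Z : B (X + Y) Z = B X Z + B Y Z.
Proof. by have := form_linearl HB Z 1 X Y; rewrite scale1r mul1r. Qed.
Lemma form0l Z : B 0 Z = 0.
Proof. by apply: (addIr (B 0 Z)); rewrite -formDl !add0r. Qed.
Lemma formZl c X Z : B (c *: X) Z = c * B X Z.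
Proof. by have := form_linearl HB Z c X 0; rewrite addr0 form0l addr0. Qed.
Lemma form_suml I r (P : pred I) (F : I -> g) Z :
  B (\sum_(i <- r | P i) F i) Z = \sum_(i <- r | P i) B (F i) Z.
Proof. exact: (big_morph (B^~ Z) (fun X Y => formDl X Y Z) (form0l Z)). Qed.
Lemma formDr X Y Z : B Z (X + Y) = B Z X + B Z Y.
Proof. by have := form_linearr HB Z 1 X Y; rewrite scale1r mul1r. Qed.
Lemma form0r Z : B Z 0 = 0.
Proof. by apply: (addIr (B Z 0)); rewrite -formDr !add0r. Qed.
Lemma formZr c X Z : B Z (c *: X) = c * B Z X.
Proof. by have := form_linearr HB Z c X 0; rewrite addr0 form0r addr0. Qed.
Lemma form_sumr I r (P : pred I) (F : I -> g) Z :
  B Z (\sum_(i <- r | P i) F i) = \sum_(i <- r | P i) B Z (F i).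
Proof. exact: (big_morph (B Z) (fun X Y => formDr X Y Z) (form0r Z)). Qed.
End Form.

Lemma ls_decomp (K : fieldType) (g : lieSuperalgebra K) (X : g) :
  exists Y Z, [/\ Y \in ls_part g false, Z \in ls_part g true & X = Y + Z].
Proof.
have /memv_addP[Y Y0 [Z Z1 ->]] : X \in (ls_part g false + ls_part g true)%VS.
  by rewrite ls_sum memvf.
by exists Y, Z.
Qed.

Section Casimir.
Variables (C : numClosedFieldType) (g : lieSuperalgebra C) (B : g -> g -> C).
Hypothesis HB : invariant_form B.
Variables (M : superrep g) (I : Type) (s : seq I) (z : I -> bool) (b b' : I -> g).
Hypothesis bz : forall i, b i \in ls_part g (z i).
Hypothesis bz' : forall i, b' i \in ls_part g (z i).
Hypothesis bE : forall X, X = \sum_(i <- s) B X (b' i) *: b i.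
Hypothesis bE' : forall X, X = \sum_(i <- s) B (b i) X *: b' i.

Definition casimir (u : M) : M := \sum_(i <- s) sr_act (b' i) (sr_act (b i) u).

Lemma casimir_linear : linear casimir.
Proof.
move=> c u v; rewrite /casimir scaler_sumr -big_split; apply: eq_bigr => i _ /=.
by rewrite !linearPr.
Qed.

(** Moving Y through b' i and b i leaves terms with [Y, b' i] and [Y, b i]. Expanded in the bases b'
    and b they have the same coefficients [c i j] up to opposite signs, by invariance of B, and
    cancel once the double sum is exchanged. *)
Lemma casimir_central X u : sr_act X (casimir u) = casimir (sr_act X u).
Proof.
suff E a Y : Y \in ls_part g a -> sr_act Y (casimir u) = casimir (sr_act Y u).
  have [Y [Z [Y0 Z1 ->]]] := ls_decomp X.
  rewrite !linearDl (E _ _ Y0) (E _ _ Z1) -[in LHS](scale1r (casimir (sr_act Y u))).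
  by rewrite -casimir_linear scale1r.
move=> Ya {X}; rewrite /casimir linear_sumr.
pose c i j := (-1) ^+ (a && z j) *: (B (ls_br Y (b j))
  (b' i) *: sr_act (b' j) (sr_act (b i) u)).
have E1 i : sr_act (ls_br Y (b' i)) (sr_act (b i) u) = - \sum_(j <- s) c i j.
  rewrite [ls_br Y (b' i)]bE' linear_sumlz -sumrN; apply: eq_bigr => j _.
  rewrite -(form_inv HB) linearZl_LR /= (ls_anti (bz j) Ya) -scaleNr andbC.
  by rewrite /c formZl // mulNr scaleNr -scalerA.
have E2 j : (-1) ^+ (a && z j) *: sr_act (b' j) (sr_act (ls_br Y (b j)) u) =
    \sum_(i <- s) c i j.
  rewrite [in LHS](bE (ls_br Y (b j))) linear_sumlz linear_sumr scaler_sumr.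
  by apply: eq_bigr => i _; rewrite linearZl_LR linearZr_LR.
have E3 i : sr_act Y (sr_act (b' i) (sr_act (b i) u)) =
   sr_act (ls_br Y (b' i)) (sr_act (b i) u)
   + (-1) ^+ (a && z i) *: sr_act (b' i) (sr_act (ls_br Y (b i)) u)
   + sr_act (b' i) (sr_act (b i) (sr_act Y u)).
  rewrite (sr_br _ Ya (bz' i)) (sr_br _ Ya (bz i)) linearBr linearZr_LR /=.
  rewrite scalerBr scalerA -expr2 sqrr_sign scale1r.
  by rewrite addrA addrNK addrNK.
under eq_bigr => i _ do rewrite E3 E1 E2.
rewrite big_split big_split /= sumrN exchange_big /= addNr add0r //.
Qed.

End Casimir.

(** * Root vectors and the form on the Cartan subalgebra *)

Section RootVectors.
Variables (C : numClosedFieldType) (g : lieSuperalgebra C) (B : g -> g -> C).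
Variable h : {vspace g}.
Hypothesis HB : invariant_form B.
Hypothesis Hh : regular_cartan h.
Implicit Types (al be : weight h) (H : subvs_of h).

Lemma wtD al be H : wt (al + be) H = wt al H + wt be H.
Proof. by rewrite /wt add_lfunE. Qed.
Lemma wtN al H : wt (- al) H = - wt al H.
Proof. by rewrite /wt opp_lfunE. Qed.
Lemma wt0 H : wt (0 : weight h) H = 0.
Proof. by rewrite /wt zero_lfunE. Qed.
Lemma wt_neq0 al : al != 0 -> exists H, wt al H != 0.
Proof. by move=> /lfunPn[H]; rewrite zero_lfunE; exists H. Qed.
Lemma cartan_part H : vsval H \in ls_part g false.
Proof. exact: subvP (cartan_even Hh) _ (subvsP H). Qed.

Lemma cartan_root0 X : (X \in h) = (X \in root_space false (0 : weight h)).
Proof.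
apply/idP/idP => [Xh|]; last exact/subvP/(root_space0 Hh).
apply/root_spaceP; split=> [|H]; first exact: subvP (cartan_even Hh) _ Xh.
by rewrite wt0 scale0r (cartan_abelian Hh) ?subvsP.
Qed.

(** Invariance gives (al + be)(H) B X Y = 0 for every H, and some H makes the factor nonzero. *)
Lemma root_space_orth z1 z2 al be X Y : al + be != 0 ->
  X \in root_space z1 al -> Y \in root_space z2 be -> B X Y = 0.
Proof.
move=> /wt_neq0[H nz] /root_spaceP[Xz XH] /root_spaceP[Yz YH].
apply: (mulfI nz); rewrite mulr0 wtD mulrDl -formZl // -formZr // -XH -YH.
by rewrite -(form_inv HB) (ls_anti (cartan_part H) Xz) /= scale1r -scaleN1r formZl //
  mulN1r addNr.
Qed.

(** X is orthogonal to the other parity and to every root space except that of - al; were it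
    orthogonal to this one too, nondegeneracy would force X = 0. *)
Lemma root_space_dual z al X : X \in root_space z al -> X != 0 ->
  exists2 Y, Y \in root_space z (- al) & B X Y = 1.
Proof.
move=> Xal nzX.
suff [Y Yal nzY] : exists2 Y, Y \in root_space z (- al) & B X Y != 0.
  by exists ((B X Y)^-1 *: Y); rewrite ?memvZ // formZr // mulVf.
pose V := root_space z (- al).
case: (pickP (fun i => B X (tnth (vbasis V) i) != 0)) => [i nz|all0].
  by exists (tnth (vbasis V) i); rewrite // vbasis_mem // mem_tnth.
case/eqP: nzX; apply: (form_nondeg HB) => Y.
have orth Y1 : Y1 \in V -> B X Y1 = 0.
  move=> /coord_vbasis->; rewrite form_sumr // big1 // => i _.
  by rewrite formZr // -tnth_nth; move/eqP: (all0 i) => ->; rewrite mulr0.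
have [Xz _] := root_spaceP _ _ _ Xal.
have orthz z' Y1 : Y1 \in ls_part g z' -> B X Y1 = 0.
  case: (eqVneq z' z) => [-> {z'}|zz Yz]; last by rewrite (form_even HB Xz Yz) // eq_sym.
    have [s] := root_span Hh z; move/subvP/[apply].
    apply: (sumv_ind (P := fun U => B X U = 0)) => [|U W U0 W0|be U _ Ube];
      rewrite ?form0r // ?formDr ?U0 ?W0 ?addr0 //.
    have [E|ne] := eqVneq (al + be) 0; last exact: (root_space_orth ne Xal Ube).
    by apply: orth; rewrite /V (_ : - al = be) //; apply/esym/eqP; rewrite -addr_eq0 addrC E.
by have [Y0 [Y1 [/orthz E0 /orthz E1 ->]]] := ls_decomp Y; rewrite formDr // E0 E1 addr0.
Qed.

(* By one-dimensionality any nonzero vector of the root space will do. *)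
Definition root_vec z al : g := vpick (root_space z al).
(** Normalised by B e f = 1, so that e and f belong to dual bases; this is a root vector for - al
    and not the coroot in h. If the pairing vanishes, the inverse defaults to 0 and so does the
    vector. *)
Definition coroot_vec z al : g :=
  (B (root_vec z al) (root_vec z (- al)))^-1 *: root_vec z (- al).

Lemma root_vec_in z al : root_vec z al \in root_space z al.
Proof. exact: memv_pick. Qed.
Lemma coroot_vec_in z al : coroot_vec z al \in root_space z (- al).
Proof. by rewrite memvZ // memv_pick. Qed.

Lemma root_vec_span z al : al != 0 -> root_space z al = <[root_vec z al]>%VS.
Proof.
move=> nz; apply/esym/eqP; rewrite eqEdim -memvE root_vec_in dim_vline.
rewrite /root_vec vpick0; case: eqP => [->|_] /=; first by rewrite dimv0.
exact: root_space_dim.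
Qed.

Lemma root_vec_dual z al : is_root z al ->
  B (root_vec z al) (coroot_vec z al) = 1.
Proof.
case/andP=> nz nz1.
have [|Y] := root_space_dual (root_vec_in z al); first by rewrite /root_vec vpick0.
rewrite root_vec_span ?oppr_eq0 // => /vlineP[k ->]; rewrite formZr // => E.
rewrite /coroot_vec formZr // mulVf //; apply/eqP => E0.
by move/eqP: E; rewrite E0 mulr0 eq_sym oner_eq0.
Qed.

Lemma coroot_vec_span z al : is_root z al ->
  root_space z (- al) = <[coroot_vec z al]>%VS.
Proof.
move=> ral; have := root_vec_dual ral; case/andP: ral => nz nz1.
rewrite root_vec_span ?oppr_eq0 // /coroot_vec; set c := B _ (root_vec z (- al)).
have [->|c0] := eqVneq c 0.
  by rewrite invr0 scale0r form0r // => /eqP; rewrite eq_sym oner_eq0.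
move=> _; apply: subv_anti; rewrite -!memvE (memvZ _ (memv_line _)) andbT.
by apply/vlineP; exists c; rewrite scalerA divff // scale1r.
Qed.

Lemma is_rootN z al : is_root z al -> is_root z (- al).
Proof.
move=> ral; have := root_vec_dual ral; case/andP: ral => nz _ E.
rewrite /is_root oppr_eq0 nz -vpick0 /=; apply: contra_eq_neq E => E.
by rewrite /coroot_vec [root_vec z (- al)]E scaler0 form0r // eq_sym oner_eq0.
Qed.

(** Repeats the local [flat] of [dual_form], which makes [dual_formE] hold by computation. *)
Let flat : 'Hom(subvs_of h, weight h) :=
  linfun (fun H : subvs_of h =>
    linfun (fun H' : subvs_of h => B (vsval H) (vsval H') : C^o)).

Let flatE H H' : flat H H' = B (vsval H) (vsval H').
Proof.
pose f H1 := linfun (fun H' : subvs_of h => B (vsval H1) (vsval H') : C^o).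
have fE H1 H2 : f H1 H2 = B (vsval H1) (vsval H2).
  pose f2 (H' : subvs_of h) : C^o := B (vsval H1) (vsval H').
  have f2L : linear f2 by move=> c H3 H4; exact: (form_linearr HB).
  exact: (linfunE f2L).
have fL : linear f.
  move=> c H1 H2; apply/lfunP=> H3; rewrite add_lfunE scale_lfunE !fE.
  exact: (form_linearl HB).
by rewrite -fE /flat linfunE.
Qed.

Lemma cartan_orth z al X H : X \in root_space z al -> z || (al != 0) ->
  B (vsval H) X = 0.
Proof.
move=> Xal; have [|nz _] := boolP (al == 0).
  have [Xz _] := root_spaceP _ _ _ Xal.
  by case: z Xz {Xal} => // X1 _ _; apply: (form_even HB (cartan_part H) X1).
apply: (@root_space_orth false z 0 al) => //; first by rewrite add0r.
by rewrite -cartan_root0 subvsP.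
Qed.

(** The Cartan subalgebra is orthogonal to odd vectors and to even root spaces of nonzero weight, so
    an element of h orthogonal to h is orthogonal to everything. *)
Let flat_inj : injective flat.
Proof.
apply/lker0P; rewrite -subv0; apply/subvP => H; rewrite memv_ker memv0 => /eqP H0.
apply/eqP/val_inj => /=; apply: (form_nondeg HB) => Y.
have Ez z Y1 : Y1 \in ls_part g z -> B (vsval H) Y1 = 0.
  have [s] := root_span Hh z; move/subvP/[apply].
  apply: (sumv_ind (P := fun U => B (vsval H) U = 0)) => [|U W U0 W0|be U _ Ube];
    rewrite ?form0r // ?formDr ?U0 ?W0 ?addr0 //.
  have [E|ne] := boolP (z || (be != 0)); first exact: cartan_orth E.
  move: ne Ube; rewrite negb_or negbK; case: z => //= /eqP->; rewrite -cartan_root0 => Uh.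
  by rewrite -[U](@vsprojK _ _ h) // -flatE H0 zero_lfunE.
by have [Y0 [Y1 [/Ez E0 /Ez E1 ->]]] := ls_decomp Y; rewrite formDr // E0 E1 addr0.
Qed.

Definition sharp : 'Hom(weight h, subvs_of h) := (flat^-1)%VF.

Lemma dual_formE al be : dual_form B al be = wt be (sharp al).
Proof. by []. Qed.

(** [flat] is injective between spaces of equal dimension, hence onto, so [sharp] inverts it on
    every weight. *)
Lemma form_sharp al H : B (vsval (sharp al)) (vsval H) = wt al H.
Proof.
rewrite -flatE /sharp limg_lfunVK // (_ : limg flat = fullv) ?memvf //.
apply/eqP; rewrite eqEdim subvf limg_dim_eq; last first.
  by rewrite (eqP (introT lker0P flat_inj)) capv0.
by rewrite !dimvf /dim /= muln1.
Qed.

(** The bracket has weight 0 and so lies in h, where elements are determined by their pairings with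
    h; invariance moves H onto Y, where it acts by - al. *)
Lemma bracket_sharp z al X Y : X \in root_space z al -> Y \in root_space z (- al) ->
  ls_br X Y = B X Y *: vsval (sharp al).
Proof.
move=> /root_spaceP[Xz XH] /root_spaceP[Yz YH].
have : ls_br X Y \in h.
  apply: (subvP (root_space0 Hh false)); apply/root_spaceP.
  split=> [|H]; first by have := ls_graded Xz Yz; rewrite addbb.
  rewrite wt0 scale0r (ls_jacobi _ (cartan_part H) Xz) /= scale1r XH YH.
  by rewrite linearZl_LR linearZr_LR /= wtN scaleNr addrN.
move=> XYh; rewrite -(vsprojK XYh).
suff -> : vsproj h (ls_br X Y) = B X Y *: sharp al by [].
apply: flat_inj.
apply/lfunP => H; rewrite !flatE vsprojK // (form_inv HB).
rewrite linearZ /= formZl // form_sharp (ls_anti Yz (cartan_part H)) andbF scale1r.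
by rewrite YH wtN scaleNr opprK formZr // mulrC.
Qed.

Let n := \dim (fullv : {vspace subvs_of h}).
Definition cartan_basis (k : 'I_n) : subvs_of h := tnth (vbasis fullv) k.
Definition cartan_coord (k : 'I_n) : weight h :=
  linfun (coord (vbasis fullv) k : subvs_of h -> C^o).
(** [sharp] turns the coordinate functionals of a basis into its dual basis with respect to B. *)
Definition cartan_dual (k : 'I_n) : subvs_of h := sharp (cartan_coord k).

Lemma cartan_basisE H : H = \sum_k wt (cartan_coord k) H *: cartan_basis k.
Proof.
rewrite {1}(coord_vbasis (memvf H)); apply: eq_bigr => k _.
by rewrite /wt /cartan_coord lfunE /cartan_basis (tnth_nth 0).
Qed.

Lemma form_cartan_sym H H' : B (vsval H) (vsval H') = B (vsval H') (vsval H).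
Proof. by rewrite (form_sym HB (cartan_part H') (cartan_part H)) mul1r. Qed.

Lemma cartan_complete H :
  vsval H = \sum_k B (vsval H) (vsval (cartan_dual k)) *: vsval (cartan_basis k).
Proof.
rewrite {1}[H]cartan_basisE linear_sum; apply: eq_bigr => k _ /=.
by rewrite form_cartan_sym form_sharp.
Qed.

Lemma cartan_complete' H :
  vsval H = \sum_k B (vsval (cartan_basis k)) (vsval H) *: vsval (cartan_dual k).
Proof.
have -> : \sum_k B (vsval (cartan_basis k)) (vsval H) *: vsval (cartan_dual k) =
    vsval (\sum_k B (vsval (cartan_basis k)) (vsval H) *: cartan_dual k).
  by rewrite linear_sum.
apply: (congr1 (@vsval _ _ h)); apply: flat_inj.
apply/lfunP => H'; rewrite !flatE linear_sum /= form_suml //.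
rewrite {1}[H']cartan_basisE linear_sum /= form_sumr //.
apply: eq_bigr => k _; rewrite /= !(formZl, formZr) // form_sharp mulrC.
by rewrite form_cartan_sym.
Qed.

Lemma dual_form_cartan al be :
  dual_form B al be = \sum_k wt al (cartan_basis k) * wt be (cartan_dual k).
Proof.
rewrite dual_formE.
have -> : sharp al = \sum_k wt al (cartan_basis k) *: cartan_dual k.
  apply: val_inj; rewrite /= {1}(cartan_complete' (sharp al)) linear_sum /=.
  by apply: eq_bigr => k _; rewrite form_cartan_sym form_sharp.
by rewrite /wt linear_sum; apply: eq_bigr => k _; rewrite linearZ.
Qed.

Lemma dual_formDl al al' be :
  dual_form B (al + al') be = dual_form B al be + dual_form B al' be.
Proof. by rewrite !dual_formE /wt !linearD. Qed.

End RootVectors.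

(** Symmetry relates only vectors of the same parity, hence the passage through homogeneous
    components. *)
Lemma form_nondegr (C : numClosedFieldType) (g : lieSuperalgebra C) (B : g -> g -> C)
  (HB : invariant_form B) X : (forall Y, B Y X = 0) -> X = 0.
Proof.
have [X0 [X1 [X0e X1o ->]]] := ls_decomp X => E.
have Ez a Xa Y : Xa \in ls_part g a -> (forall Y, Y \in ls_part g a -> B Y Xa = 0) ->
  B Xa Y = 0.
  move=> Xaa Ea; have [Y0 [Y1 [Y0e Y1o ->]]] := ls_decomp Y.
  rewrite formDr //; case: a Xaa Ea => Xaa Ea.
    by rewrite (form_even HB Xaa Y0e) // (form_sym HB Y1o Xaa) Ea // mulr0 addr0.
  by rewrite (form_even HB Xaa Y1o) // (form_sym HB Y0e Xaa) Ea // mulr0 addr0.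
have X00 : X0 = 0.
  apply: (form_nondeg HB) => Y; apply: Ez X0e _ => Z Ze.
  by have := E Z; rewrite formDr // (form_even HB Ze X1o) // addr0.
have X10 : X1 = 0.
  apply: (form_nondeg HB) => Y; apply: Ez X1o _ => Z Zo.
  by have := E Z; rewrite formDr // (form_even HB Zo X0e) // add0r.
by rewrite X00 X10 addr0.
Qed.

(** [datum_uniq] matters because the Casimir operator and rho sum over the list of even positive
    roots; [datum_omega] lies behind the orthogonality of distinct weight spaces in a unitary
    module. *)
Record regular_datum (C : numClosedFieldType) (D : datum C) (w : D -> D) : Prop :=
  RegularDatum {
    datum_form : invariant_form (@d_form C D);
    datum_cartan : regular_cartan (d_cartan D);
    datum_uniq : uniq (d_pos0 D);
    datum_omega : forall X, X \in d_cartan D -> w X \in d_cartan D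
  }.

(** * Dual bases attached to a positive system *)

Section Triangular.
Variables (C : numClosedFieldType) (D : datum C).
Hypothesis HB : invariant_form (@d_form C D).
Hypothesis Hh : regular_cartan (d_cartan D).
Hypothesis U0 : uniq (d_pos0 D).
Local Notation h := (d_cartan D).
Local Notation B := (@d_form C D).
Variable P1 : seq (weight h).
Hypothesis HP1 : positive_system P1.
Local Notation pos := (pos P1).
Local Notation root_vec := (@root_vec C D h).
Local Notation coroot_vec := (@coroot_vec C D B h).

Lemma uniq_pos z : uniq (pos z).
Proof. by case: z => //=; case: HP1. Qed.

Lemma pos_root z al : al \in pos z -> is_root z al.
Proof. by case: HP1 => _ [H /(_ z al)[_ ->]] /andP[]. Qed.

Lemma pos_neq0 z al : al \in pos z -> al != 0.
Proof. by move/pos_root/andP => []. Qed.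

Lemma posD_neq0 z1 z2 al be : al \in pos z1 -> be \in pos z2 -> al + be != 0.
Proof.
case: HP1 => _ [H Hpos]; rewrite (Hpos z1 al).2 (Hpos z2 be).2.
case/andP=> _ al0 /andP[_ be0]; apply: contraTneq (addr_gt0 al0 be0) => E.
by rewrite -wtD E wt0 ltxx.
Qed.

Lemma root_pos z al : is_root z al -> (al \in pos z) || (- al \in pos z).
Proof.
move=> ral; case: HP1 => _ [H Hpos]; rewrite !(Hpos z _).2 ral (is_rootN HB Hh ral) /=.
by rewrite wtN oppr_gt0; case: (Hpos z al) => /(_ ral)[] ->; rewrite ?orbT.
Qed.

(** Root spaces of nonzero weight are lines, each spanned by the [root_vec] or the [coroot_vec] of a
    positive root. *)
Lemma triangular_ind (P : D -> Prop) :
  P 0 -> (forall X Y, P X -> P Y -> P (X + Y)) -> (forall c X, P X -> P (c *: X)) ->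
  (forall H : subvs_of h, P (vsval H)) ->
  (forall z al, al \in pos z -> P (root_vec z al)) ->
  (forall z al, al \in pos z -> P (coroot_vec z al)) -> forall X, P X.
Proof.
move=> P0 PD PZ Ph Pr Pc X.
suff Pz z Y : Y \in ls_part D z -> P Y.
  by have [Y [Z [/Pz PY /Pz PZ' ->]]] := ls_decomp X; apply: PD.
have [s] := root_span Hh z; move/subvP/[apply].
apply: (sumv_ind P0 PD) => al Z _ Zal.
have [Z0|nzZ] := eqVneq Z 0; first by rewrite Z0.
have [al0|nzal] := eqVneq al 0.
  rewrite -[Z](@vsprojK _ _ h) //; apply: (subvP (root_space0 Hh z)).
  by rewrite -al0.
have ral : is_root z al.
  by rewrite /is_root nzal; apply: contraNneq nzZ => E; rewrite E memv0 in Zal.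
have /orP[alp|alp] := root_pos ral.
  by move: Zal; rewrite (root_vec_span Hh) // => /vlineP[k ->]; apply/PZ/Pr.
move: Zal; rewrite -[al]opprK (coroot_vec_span HB Hh) ?pos_root //.
by move=> /vlineP[k ->]; apply/PZ/Pc.
Qed.

Local Notation n := (\dim (fullv : {vspace subvs_of h})).

Definition cas_index := ('I_n + bool * (bool * weight h))%type.
Definition cas_part (i : cas_index) :=
  match i with inl _ => false | inr p => p.2.1 end.
Definition cas_left (i : cas_index) : D :=
  match i with
  | inl k => vsval (cartan_basis k)
  | inr p => if p.1 then root_vec p.2.1 p.2.2 else coroot_vec p.2.1 p.2.2
  end.
(** The sign compensates B f e = (-1)^z B e f, so that the pairs remain dual when f stands on the
    left. *)
Definition cas_right (i : cas_index) : D :=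
  match i with
  | inl k => vsval (cartan_dual B k)
  | inr p => if p.1 then coroot_vec p.2.1 p.2.2
             else (-1) ^+ p.2.1 *: root_vec p.2.1 p.2.2
  end.
Definition pos_roots : seq (bool * weight h) :=
  [seq (false, al) | al <- pos false] ++ [seq (true, al) | al <- pos true].
Definition cas_seq : seq cas_index :=
  [seq inl k | k : 'I_n] ++ [seq inr (true, p) | p <- pos_roots]
  ++ [seq inr (false, p) | p <- pos_roots].

Lemma pos_rootsP z al : ((z, al) \in pos_roots) = (al \in pos z).
Proof.
by rewrite mem_cat; apply/orP/idP => [[]/mapP[be ? [-> ->]] //|];
  case: z => ?; [right|left]; apply/mapP; exists al.
Qed.

Lemma uniq_pos_roots : uniq pos_roots.
Proof.
rewrite cat_uniq !map_inj_uniq ?uniq_pos ?andbT //=; try by move=> ? ? [].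
by apply/hasPn => _ /mapP[al _ ->]; apply/mapP => -[].
Qed.

Lemma big_cas_seq (V : nmodType) (f : cas_index -> V) :
  \sum_(i <- cas_seq) f i = \sum_k f (inl k)
    + \sum_(p <- pos_roots) (f (inr (true, p)) + f (inr (false, p))).
Proof.
rewrite [in RHS]big_split /= /cas_seq; move: pos_roots => r.
by rewrite big_cat big_cat big_image !big_map.
Qed.

Lemma pos_rootsE (V : nmodType) (f : bool * weight h -> V) :
  \sum_(p <- pos_roots) f p
  = \sum_(al <- pos false) f (false, al) + \sum_(al <- pos true) f (true, al).
Proof. by rewrite big_cat !big_map. Qed.

Lemma root_vec_part z al : root_vec z al \in ls_part D z.
Proof. by have /root_spaceP[] := root_vec_in z al. Qed.
Lemma coroot_vec_part z al : coroot_vec z al \in ls_part D z.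
Proof. by have /root_spaceP[] := coroot_vec_in B z al. Qed.

Lemma cas_left_part i : cas_left i \in ls_part D (cas_part i).
Proof.
case: i => [k|[[] [z al]]] /=; [exact: cartan_part|exact: root_vec_part|].
exact: coroot_vec_part.
Qed.
Lemma cas_right_part i : cas_right i \in ls_part D (cas_part i).
Proof.
case: i => [k|[[] [z al]]] /=; [exact: cartan_part|exact: coroot_vec_part|].
by rewrite memvZ // root_vec_part.
Qed.

Lemma form_root_coroot z1 z2 al be : al \in pos z1 -> be \in pos z2 ->
  B (root_vec z1 al) (coroot_vec z2 be) = ((z1, al) == (z2, be))%:R.
Proof.
move=> al1 be2; have [[<- <-]|ne] := eqVneq (z1, al) (z2, be).
  by rewrite (root_vec_dual HB Hh) ?pos_root.
have [E|nez] := eqVneq z1 z2; last first.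
  by apply: (form_even HB) nez; rewrite ?root_vec_part ?coroot_vec_part.
apply: (root_space_orth HB Hh _ (root_vec_in _ _) (coroot_vec_in _ _ _)).
by rewrite subr_eq0; apply: contraNneq ne => ->; rewrite E.
Qed.

Lemma form_coroot_root z1 z2 al be : al \in pos z1 -> be \in pos z2 ->
  B (coroot_vec z1 al) (root_vec z2 be) = (-1) ^+ z2 * ((z1, al) == (z2, be))%:R.
Proof.
move=> al1 be2; have [E|nez] := eqVneq z1 z2; last first.
  rewrite (_ : _ == _ = false) ?mulr0; last by apply: contraNF nez => /eqP[-> _].
  by apply: (form_even HB) nez; rewrite ?root_vec_part ?coroot_vec_part.
rewrite (form_sym HB (root_vec_part z2 be)) -?E ?coroot_vec_part //.
by rewrite form_root_coroot // ?E // eq_sym.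
Qed.

Lemma form_root_root z1 z2 al be : al \in pos z1 -> be \in pos z2 ->
  B (root_vec z1 al) (root_vec z2 be) = 0.
Proof.
move=> al1 be2; apply: (root_space_orth HB Hh _ (root_vec_in _ _) (root_vec_in _ _)).
exact: posD_neq0 al1 be2.
Qed.

Lemma form_coroot_coroot z1 z2 al be : al \in pos z1 -> be \in pos z2 ->
  B (coroot_vec z1 al) (coroot_vec z2 be) = 0.
Proof.
move=> al1 be2.
apply: (root_space_orth HB Hh _ (coroot_vec_in _ _ _) (coroot_vec_in _ _ _)).
by rewrite -opprD oppr_eq0 (posD_neq0 al1 be2).
Qed.

Lemma sum_delta (V : lmodType C) (f : bool * weight h -> V) z al : al \in pos z ->
  \sum_(p <- pos_roots) ((z, al) == p)%:R *: f p = f (z, al).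
Proof.
rewrite -pos_rootsP => zal; rewrite (bigD1_seq (z, al)) ?uniq_pos_roots //=.
rewrite eqxx scale1r big1 ?addr0 // => p; rewrite eq_sym => /negPf->.
by rewrite scale0r.
Qed.

Lemma cartan_orthr z (al : weight h) X (H : subvs_of h) : al != 0 -> X \in root_space z al ->
  B X (vsval H) = 0.
Proof.
move=> nz Xal; apply: (@root_space_orth _ _ _ _ HB Hh z false al 0) => //.
  by rewrite addr0.
by rewrite -(cartan_root0 Hh) subvsP.
Qed.

(** [triangular_ind] reduces to X in h or X one of the e and f. Orthogonality of root spaces leaves
    only the Cartan block in the first case and a single term in the others. *)
Lemma cas_complete X : X = \sum_(i <- cas_seq) B X (cas_right i) *: cas_left i.
Proof.
elim/triangular_ind: X => [|X Y EX EY|c X EX|H|z al zal|z al zal].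
- by rewrite big1 // => i _; rewrite form0l // scale0r.
- rewrite {1}EX {1}EY -big_split; apply: eq_bigr => i _.
  by rewrite formDl // scalerDl.
- rewrite {1}EX scaler_sumr; apply: eq_bigr => i _.
  by rewrite formZl // scalerA.
- rewrite big_cas_seq -(cartan_complete HB Hh) big_seq big1 ?addr0 // => -[z al].
  rewrite pos_rootsP => zal /=; have nz := pos_neq0 zal.
  rewrite (cartan_orth HB Hh _ (coroot_vec_in _ _ _)) ?oppr_eq0 ?nz ?orbT //.
  rewrite formZr // (cartan_orth HB Hh _ (root_vec_in _ _)) ?nz ?orbT //.
  by rewrite mulr0 !scale0r addr0.
- rewrite big_cas_seq big1 ?add0r => [|k _].
    rewrite -{1}(sum_delta (fun p => root_vec p.1 p.2) zal) big_seq [RHS]big_seq.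
    apply: eq_bigr => -[z' be]; rewrite pos_rootsP => zbe /=.
    by rewrite form_root_coroot // formZr // form_root_root // mulr0 scale0r addr0.
  by rewrite /= (cartan_orthr _ _ (root_vec_in _ _)) ?(pos_neq0 zal) // scale0r.
- rewrite big_cas_seq big1 ?add0r => [|k _].
    rewrite -{1}(sum_delta (fun p => coroot_vec p.1 p.2) zal) big_seq [RHS]big_seq.
    apply: eq_bigr => -[z' be]; rewrite pos_rootsP => zbe /=.
    rewrite form_coroot_coroot // formZr // form_coroot_root // scale0r add0r.
    by rewrite mulrA -expr2 sqrr_sign mul1r.
  by rewrite /= (cartan_orthr _ _ (coroot_vec_in _ _ _)) ?oppr_eq0 ?(pos_neq0 zal) // scale0r.
Qed.

Lemma cas_complete' X : X = \sum_(i <- cas_seq) B (cas_left i) X *: cas_right i.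
Proof.
apply/eqP; rewrite -subr_eq0; apply/eqP/(form_nondegr HB) => Y.
rewrite -scaleN1r formDr // formZr // form_sumr // {1}[Y]cas_complete form_suml //.
rewrite mulN1r; apply/eqP; rewrite subr_eq0; apply/eqP/eq_bigr => i _.
by rewrite formZl // formZr // mulrC.
Qed.
End Triangular.

Section CasimirEigenvalue.
Variables (C : numClosedFieldType) (D : datum C).
Hypothesis HB : invariant_form (@d_form C D).
Hypothesis Hh : regular_cartan (d_cartan D).
Hypothesis U0 : uniq (d_pos0 D).
Local Notation h := (d_cartan D).
Local Notation B := (@d_form C D).
Variable P1 : seq (weight h).
Hypothesis HP1 : positive_system P1.
Variable M : superrep D.
Local Notation E p := (root_vec (h := h) p.1 p.2).
Local Notation F p := (coroot_vec B (h := h) p.1 p.2).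
Local Notation Omega :=
  (@casimir C D M _ (cas_seq P1) (@cas_left C D) (@cas_right C D)).

Lemma dual_form_rho mu :
  dual_form B (2 *: rho P1) mu
  = \sum_(al <- pos P1 false) dual_form B al mu - \sum_(al <- pos P1 true) dual_form B al mu.
Proof.
rewrite /rho scalerBr /rho_part !scalerA divff ?pnatr_eq0 // !scale1r.
by rewrite dual_formE linearB /wt linearB !linear_sum.
Qed.

(** A root al of parity z contributes f e + (-1)^z e f. Since e f = [e, f] + (-1)^z f e, and [e, f]
    is the element of h representing al, this is 2 f e plus the scalar (-1)^z (al, mu) on v. The
    scalars add up to (2 rho, mu). *)
Lemma casimir_weight_vector mu (v : M) : weight_vector mu v ->
  Omega v = dual_form B (mu + 2 *: rho P1) mu *: v
    + 2 *: \sum_(p <- pos_roots P1) sr_act (F p) (sr_act (E p) v).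
Proof.
move=> vmu; rewrite /casimir (big_cas_seq P1).
have -> : \sum_k sr_act (cas_right (inl k)) (sr_act (cas_left (inl k)) v)
    = dual_form B mu mu *: v.
  rewrite (dual_form_cartan HB Hh) scaler_suml; apply: eq_bigr => k _ /=.
  by rewrite vmu linearZ_LR /= vmu scalerA.
rewrite dual_formDl scalerDl -addrA; congr (_ + _).
have Ep p : p \in pos_roots P1 ->
  sr_act (cas_right (inr (true, p))) (sr_act (cas_left (inr (true, p))) v)
  + sr_act (cas_right (inr (false, p))) (sr_act (cas_left (inr (false, p))) v)
  = (-1) ^+ p.1 *: (dual_form B p.2 mu *: v) + 2 *: sr_act (F p) (sr_act (E p) v).
  case: p => z al; rewrite pos_rootsP /= => zal.
  have := sr_br v (root_vec_part z al) (coroot_vec_part (D := D) z al).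
  rewrite (bracket_sharp HB Hh (root_vec_in z al) (coroot_vec_in B z al)).
  rewrite (root_vec_dual HB Hh (pos_root HP1 zal)) scale1r vmu andbb -dual_formE.
  move: (coroot_vec B z al) (root_vec z al) => f e Ea;
    rewrite linearZl_LR /= Ea scalerBr scalerA -expr2 sqrr_sign scale1r.
  by rewrite scalerDl scale1r addrA addrNK addrC.
rewrite (eq_big_seq _ Ep) big_split /= -scaler_sumr; congr (_ + _).
rewrite pos_rootsE dual_form_rho scalerBl !scaler_suml; congr (_ + _).
  by apply: eq_bigr => al _; rewrite scale1r.
by rewrite -sumrN; apply: eq_bigr => al _; rewrite scaleN1r.
Qed.

(** An eigenspace of a central operator is a submodule, and this one contains the generator v0. *)
Lemma casimir_constant La (v0 : M) : weight_vector La v0 ->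
  (forall p, p \in pos_roots P1 -> sr_act (E p) v0 = 0) ->
  (forall N : M -> Prop, subspace N ->
     (forall X u, N u -> N (sr_act X u)) -> N v0 -> forall u, N u) ->
  forall u, Omega u = dual_form B (La + 2 *: rho P1) La *: u.
Proof.
move=> v0La Ev0 gen.
have lin := @casimir_linear C D M _ (cas_seq P1) (@cas_left C D) (@cas_right C D).
have lin0 : Omega 0 = 0.
  by rewrite /casimir big1 // => i _; rewrite !linear0r.
have := casimir_weight_vector v0La; set k := dual_form _ _ _ => Ov0.
apply: (gen (fun u => Omega u = k *: u)).
- split=> [|c u v Eu Ev]; first by rewrite lin0 scaler0.
  by rewrite lin Eu Ev scalerDr !scalerA mulrC.
- move=> X u Eu; rewrite -(casimir_central HB (z := @cas_part C D)) ?Eu ?linearZr_LR //.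
  + exact: cas_left_part. + exact: cas_right_part.
  + exact: cas_complete. + exact: cas_complete'.
rewrite Ov0 big_seq big1 ?scaler0 ?addr0 // => p pp.
by rewrite Ev0 // linear0r.
Qed.

End CasimirEigenvalue.

(** * Unitary modules and the inequality *)

Section Unitary.
Variables (C : numClosedFieldType) (D : datum C) (w : D -> D).
Hypothesis HD : regular_datum w.
Hypothesis hw : anti_involution w.
Local Notation h := (d_cartan D).
Local Notation B := (@d_form C D).
Variable P1 : seq (weight h).
Hypothesis HP1 : positive_system P1.
Variable M : superrep D.
Local Notation E p := (root_vec (h := h) p.1 p.2).
Local Notation F p := (coroot_vec B (h := h) p.1 p.2).
Variable Q : {dot M for Num.conj}.
Hypothesis Qw : forall X v v', Q (sr_act X v) v' = Q v (sr_act (w X) v').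
Let HB := datum_form HD.
Let Hh := datum_cartan HD.
Let wh H : w (vsval H) \in h := datum_omega HD (subvsP (H : subvs_of h)).
Let om (H : subvs_of h) : subvs_of h := vsproj h (w (vsval H)).
Let omE H : vsval (om H) = w (vsval H). Proof. by rewrite vsprojK. Qed.
Let om_inv H : om (om H) = H.
Proof. by apply: val_inj; case: hw => _ _ _ wK _; rewrite /= !omE wK. Qed.

(** [om] is the conjugation induced by w on h. A weight occurring in a unitary module is real for
    it, because Q v v is nonzero. *)
Lemma unitary_weight mu (v : M) H : weight_vector mu v -> v != 0 ->
  (wt mu (om H))^* = wt mu H.
Proof.
move=> vmu nz; have := Qw (vsval H) v v.
rewrite vmu -omE vmu linearZl_LR linearZr_LR /= => E.
by apply/esym/(mulIf (_ : Q v v != 0)) => //; rewrite dnorm_eq0.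
Qed.

(** Reality of nu lets H cross the form without a conjugate, so mu H and nu H scale Q u v
    equally. *)
Lemma unitary_orth mu nu (u v : M) : weight_vector mu u -> weight_vector nu v ->
  mu != nu -> Q u v = 0.
Proof.
move=> umu vnu ne; have [->|nz] := eqVneq v 0; first by rewrite linear0r.
have /lfunPn[H neH] := ne; have := Qw (vsval H) u v.
rewrite umu -omE vnu linearZl_LR linearZr_LR /= (unitary_weight _ vnu nz) => /eqP.
by rewrite -subr_eq0 -mulrBl mulf_eq0 subr_eq0 (negPf neH) => /eqP.
Qed.

(* The weight of [w (F p)] is forced to be the positive root by unitarity. *)
Lemma omega_coroot_kills mu (v : M) z al : weight_vector mu v ->
  al \in pos P1 z -> killed_by z al v -> sr_act (w (coroot_vec B z al)) v = 0.
Proof.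
move=> vmu zal kv; set f := coroot_vec B z al.
have [v0|nzv] := eqVneq v 0; first by rewrite v0 linear0r.
(* Suppose w f v is nonzero. Its weight and mu are both real for [om], hence so is the weight of w
   f, which must then be al; thus w f lies in a root space that kills v. *)
apply/eqP; apply: contraT => nz; case/negP: (nz); apply/eqP; apply: kv.
have [fz fH] := root_spaceP _ _ _ (coroot_vec_in B z al).
case: hw => wD wZ wz wK wbr.
have wfH H : ls_br (vsval H) (w f) = (wt al (om H))^* *: w f.
  rewrite -[H in vsval H]om_inv omE -wbr (ls_anti fz (cartan_part Hh _)) andbF scale1r.
  by rewrite fH wtN scaleNr opprK wZ.
have wfz := wz _ _ fz.
have ufH H : sr_act (vsval H) (sr_act (w f) v)
    = (wt mu H + (wt al (om H))^*) *: sr_act (w f) v.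
  have := sr_br v (cartan_part Hh H) wfz; rewrite /= scale1r vmu linearZr_LR /= wfH.
  rewrite linearZl_LR /= => /eqP; rewrite eq_sym subr_eq => /eqP ->.
  by rewrite scalerDl addrC.
apply/root_spaceP; split=> // H; rewrite wfH; congr (_ *: _).
have := Qw (vsval H) (sr_act (w f) v) (sr_act (w f) v).
rewrite ufH -omE ufH linearZl_LR linearZr_LR /= om_inv => /(mulIf _)-/(_ _)/esym.
rewrite dnorm_eq0 => /(_ nz); rewrite rmorphD /= conjCK (unitary_weight _ vmu nzv).
by move/addrI.
Qed.

Lemma highest_weight_unique La mu (v0 v : M) :
  weight_vector La v0 -> weight_vector mu v -> mu != La ->
  (forall z al, al \in pos P1 z -> killed_by z al v0) ->
  (forall z al, al \in pos P1 z -> killed_by z al v) ->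
  (forall N : M -> Prop, subspace N ->
     (forall X u, N u -> N (sr_act X u)) -> N v0 -> forall u, N u) ->
  v = 0.
Proof.
move=> v0La vmu ne kv0 kv gen.
(* The span of [v0] under the negative root vectors is already stable under g. *)
pose W u := forall N : M -> Prop, subspace N -> N v0 ->
  (forall z al u, al \in pos P1 z -> N u -> N (sr_act (coroot_vec B z al) u)) -> N u.
have W0 : W 0 by move=> N [].
have WP c u u' : W u -> W u' -> W (c *: u + u').
  by move=> Wu Wu' N sN N0 NF; apply: sN.2; [apply: Wu|apply: Wu'].
have WZ c u : W u -> W (c *: u) by move=> Wu; rewrite -[c *: u]addr0; apply: WP.
have WD u u' : W u -> W u' -> W (u + u') by move=> Wu; rewrite -[u]scale1r; apply: WP.
have Wv0 : W v0 by move=> N.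
have WF z al u : al \in pos P1 z -> W u -> W (sr_act (coroot_vec B z al) u).
  by move=> zal Wu N sN N0 NF; apply: (NF z al) => //; apply: Wu.
have WX u : W u -> forall X, W (sr_act X u).
  move=> Wu; suff [//] : W u /\ forall X, W (sr_act X u).
  (* Stability under all X is part of the induction: moving Y past a negative root vector leaves a
     bracket that may be any element of the algebra. *)
  apply: (Wu (fun u => W u /\ forall X, W (sr_act X u))).
  - split=> [|c u1 u2 [W1 X1] [W2 X2]]; first by split=> // X; rewrite linear0r.
    by split=> [|X]; [apply: WP|rewrite linearPr; apply: WP].
  - split=> //; apply: (triangular_ind HB Hh HP1).
    + by rewrite linear0l.
    + by move=> X Y WX WY; rewrite linearDl; apply: WD.
    + by move=> c X WX; rewrite linearZl_LR; apply: WZ.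
    + by move=> H; rewrite v0La; apply: WZ.
    + by move=> z al zal; rewrite (kv0 z al zal) // root_vec_in.
    + by move=> z al zal; apply: WF.
  move=> z al u1 zal [Wu1 Xu1]; split=> [|X]; first exact: WF.
  have fz := coroot_vec_part (D := D) z al.
  suff Wa a Y : Y \in ls_part D a -> W (sr_act Y (sr_act (coroot_vec B z al) u1)).
    by have [Y [Z [/Wa WY /Wa WZ' ->]]] := ls_decomp X; rewrite linearDl; apply: WD.
  move=> Ya; have /esym/eqP := sr_br u1 Ya fz; rewrite subr_eq => /eqP ->.
  by apply: WD; [exact: Xu1|apply: WZ; apply: WF zal _; exact: Xu1].
have all_W u : W u.
  by apply: (gen W) => // X u1 Wu; apply: WX.
apply/eqP; rewrite -[v == 0](dnorm_eq0 Q); apply/eqP.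
apply: (all_W v (fun u => Q u v = 0)).
- split=> [|c u1 u2 E1 E2]; first by rewrite linear0l.
  by rewrite linearPl /= E1 E2 mulr0 addr0.
- by apply: unitary_orth v0La vmu _; rewrite eq_sym.
by move=> z al u zal _; rewrite Qw (omega_coroot_kills vmu zal (kv _ _ zal)) linear0r.
Qed.

End Unitary.

(** The coefficients B (d i) f occur both when d i is expanded in root vectors and when f is
    expanded in the x i, so both sums equal the same double sum. This passes from root vectors to
    the bases on which w is known. *)
Lemma dual_basis_sum (C : numClosedFieldType) (D : datum C)
  (HB : invariant_form (@d_form C D)) (Hh : regular_cartan (d_cartan D))
  (P1 : seq (weight (d_cartan D))) (HP1 : positive_system P1)
  (M : superrep D) n (d x : n.-tuple D) (v : M) :
  basis_of (n1_plus P1) d -> basis_of (n1_minus P1) x ->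
  (forall i j, d_form D (tnth d i) (tnth x j) = (i == j)%:R) ->
  \sum_(al <- P1) sr_act (coroot_vec (@d_form C D) true al)
     (sr_act (root_vec true al) v)
  = \sum_i sr_act (tnth x i) (sr_act (tnth d i) v).
Proof.
move=> bd bx dx.
have dE X : X \in n1_plus P1 ->
    X = \sum_(al <- P1) d_form D X (coroot_vec (@d_form C D) true al) *: root_vec true al.
  apply: (sumv_ind (P := fun X => X = \sum_(al <- P1) d_form D X (coroot_vec (@d_form C D) true
    al) *: root_vec true al)).
  - by rewrite big1 // => i _; rewrite form0l // scale0r.
  - move=> X' Y {1}-> {1}->; rewrite -big_split; apply: eq_bigr => i _.
    by rewrite formDl // scalerDl.
  move=> al Y alp; rewrite (root_vec_span Hh) ?(pos_neq0 HP1 (z := true) alp) //.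
  move=> /vlineP[k ->]; rewrite (bigD1_seq al) ?(proj1 HP1) //=.
  rewrite formZl // (form_root_coroot HB Hh HP1 (z1 := true) (z2 := true)) // eqxx mulr1.
  rewrite big_seq_cond big1 ?addr0 // => be /andP[bep ne].
  rewrite formZl // (form_root_coroot HB Hh HP1 (z1 := true) (z2 := true)) //.
  rewrite (_ : _ == _ = false) ?mulr0 ?scale0r //.
  by apply: contraNF ne => /eqP[->].
have xE X : X \in n1_minus P1 -> X = \sum_i d_form D (tnth d i) X *: tnth x i.
  move=> Xm; rewrite {1}(coord_basis bx Xm); apply: eq_bigr => i _.
  rewrite -tnth_nth {2}(coord_basis bx Xm) form_sumr //; congr (_ *: _).
  rewrite (bigD1 i) //= formZr // -tnth_nth dx eqxx mulr1 big1 ?addr0 // => j.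
  by rewrite eq_sym formZr // -tnth_nth dx => /negPf->; rewrite mulr0.
under [RHS]eq_bigr => i _.
  rewrite {1}(dE (tnth d i)) ?(basis_mem bd) ?mem_tnth // linear_sumlz linear_sumr.
  over.
rewrite exchange_big big_seq [RHS]big_seq; apply: eq_bigr => al alp /=.
rewrite {1}(xE (coroot_vec (@d_form C D) true al)).
  rewrite linear_sumlz; apply: eq_bigr => i _.
  by rewrite !linearZl_LR linearZr_LR.
have := coroot_vec_in (@d_form C D) true al; rewrite /n1_minus (big_rem al) //=.
exact/subvP/addvSl.
Qed.

Theorem casimir_gap_ge0 (C : numClosedFieldType) (D : datum C) (w : D -> D)
  (HD : regular_datum w) (hw : anti_involution w)
  (P1 : seq (weight (d_cartan D))) (HP1 : positive_system P1)
  (eps : C) (hadapted : adapted P1 w eps)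
  (M : superrep D) (hM : unitary M w)
  (La mu : weight (d_cartan D)) (hLa : highest_weight M P1 La) (v : M) :
  v <> 0 -> weight_vector mu v ->
  (forall al, al \in d_pos0 D -> killed_by false al v) ->
  let casimir_gap : C :=
    - dual_form (d_form D) (La + 2 *: rho P1) La
    + dual_form (d_form D) (mu + 2 *: rho P1) mu in
  0 <= - eps * casimir_gap /\ (mu <> La -> 0 < - eps * casimir_gap).
Proof.
move=> /eqP nzv vmu kv /=.
have [HB Hh U0 wh] := HD; case: hM => Q [_ Qw].
case: hLa => zz [v0 [_ _ v0La kv0 gen]].
case: hadapted => eps1 [n [d [x [bd bx dx wx]]]].
set c := - dual_form _ _ _ + _.
have cv : c *: v = - (2 *: \sum_i sr_act (tnth x i) (sr_act (tnth d i) v)).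
  have Ev0 p : p \in pos_roots P1 -> sr_act (root_vec p.1 p.2) v0 = 0.
    by case: p => z al; rewrite pos_rootsP => zal; rewrite (kv0 z al zal) ?root_vec_in.
  have := casimir_constant HB Hh U0 HP1 v0La Ev0 _ v.
  rewrite (casimir_weight_vector HB Hh HP1 vmu) => Ev.
  have {Ev}Ev := Ev (fun N sN NX Nv0 => gen N sN NX Nv0).
  rewrite scalerDl scaleNr -Ev opprD addrAC addNr add0r pos_rootsE /= big_seq big1.
    by rewrite add0r (dual_basis_sum HB Hh HP1 _ bd bx dx).
  by move=> al ale; rewrite (kv al ale) ?root_vec_in // linear0r.
have epsE : eps^* = eps /\ eps * eps = 1.
  by case: eps1 => ->; rewrite ?rmorphN1 ?conjC1 ?mulrNN ?mulr1.
have cE : - eps * c * Q v v = 2 * \sum_i Q (sr_act (tnth d i) v) (sr_act (tnth d i) v).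
  have -> : - eps * c * Q v v = - eps * Q (c *: v) v by rewrite linearZl_LR mulrA.
  rewrite cv linearNl linearZl_LR linear_sumlz /= mulrNN mulrCA; congr (_ * _).
  rewrite mulr_sumr; apply: eq_bigr => i _; rewrite Qw wx.
  by rewrite linearZl_LR linearZr_LR /= mulrA epsE.1 epsE.2 mul1r.
have Qv : 0 < Q v v by rewrite dnorm_gt0.
have ge0 : 0 <= - eps * c.
  by rewrite -(pmulr_lge0 _ Qv) cE mulr_ge0 ?ler0n // sumr_ge0 // => i _; apply: dnorm_ge0.
split=> // /eqP ne; rewrite lt_def ge0 andbT; apply: contraTneq nzv => c0.
move: cE; rewrite c0 mul0r => /esym/eqP; rewrite mulf_eq0 pnatr_eq0 /=.
rewrite psumr_eq0 => [/allP d0|i _]; last exact: dnorm_ge0.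
have dv i : sr_act (tnth d i) v = 0.
  by apply/eqP; rewrite -(dnorm_eq0 Q); apply: d0; rewrite mem_index_enum.
apply/negPn/eqP; apply: (highest_weight_unique HD hw HP1 Qw v0La vmu ne kv0 _ gen).
case=> al alp; last exact: kv.
move=> X Xal; have Xn : X \in n1_plus P1.
  by rewrite /n1_plus (big_rem al) //=; apply: subvP (addvSl _ _) _ Xal.
rewrite (coord_basis bd Xn) linear_sumlz big1 // => i _.
by rewrite linearZl_LR -tnth_nth dv scaler0.
Qed.

(** * Root families *)

Section RootFamily.
Variables (C : numClosedFieldType) (g : lieSuperalgebra C) (h : {vspace g}).

(** Induction on s: for H separating al from be, the vector [H, Y] - be(H) Y is a nonzero multiple
    of Y and has lost its component of weight be. *)
Lemma root_space_indep z (al : weight h) s Y : al \notin s ->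
  Y \in root_space z al -> Y \in (\sum_(be <- s) root_space z be)%VS -> Y = 0.
Proof.
move=> als Yal; have [_ YH] := root_spaceP _ _ _ Yal.
elim: s als => [|be s IHs]; first by rewrite big_nil memv0 => _ /eqP.
rewrite in_cons negb_or big_cons => /andP[ne als] /memv_addP[U Ube [Z Zs E]].
have /lfunPn[H neH] := ne; apply: IHs als _.
have [_ UH] := root_spaceP _ _ _ Ube.
have stab W : W \in (\sum_(be <- s) root_space z be)%VS ->
    ls_br (vsval H) W \in (\sum_(be <- s) root_space z be)%VS.
  apply: (sumv_ind (P := fun W => ls_br (vsval H) W \in (\sum_(be <- s) root_space z be)%VS)).
  - by rewrite linear0r mem0v.
  - by move=> V1 V2 W1 W2; rewrite linearDr memvD.
  move=> ga V gas Vga; have [_ ->] := root_spaceP _ _ _ Vga; apply: memvZ.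
  by rewrite (big_rem ga) //=; apply: subvP (addvSl _ _) _ Vga.
have nz : wt al H - wt be H != 0 by rewrite subr_eq0.
rewrite -[Y]scale1r -(mulVf nz) -scalerA memvZ // scalerBl -YH {1}E linearDr UH.
by rewrite E scalerDr opprD addrACA subrr add0r memvB ?stab ?memvZ.
Qed.

Variables (z : bool) (I : finType) (X : I -> g) (chi : I -> weight h).
Hypothesis Xchi : forall a, X a \in root_space z (chi a).
Hypothesis Xspan : (ls_part g z <= \sum_a <[X a]>)%VS.
Hypothesis X0 : forall a, chi a = 0 -> X a \in h.
Hypothesis X1 : forall a, chi a != 0 ->
  exists Y, forall b, chi b = chi a -> X b \in <[Y]>%VS.

(** Expand Y in the family. The part over weights other than al lies in the root space of al and in
    the sum of the other root spaces, so it vanishes. Zero vectors and repeated weights in the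
    family do no harm. *)
Lemma root_space_family (al : weight h) :
  (root_space z al <= \sum_(a | chi a == al) <[X a]>)%VS.
Proof.
apply/subvP => Y Yal; have [Yz _] := root_spaceP _ _ _ Yal.
have /memv_sumP[U UX EY] := subvP Xspan _ Yz.
have Uchi a : U a \in root_space z (chi a).
  by have /vlineP[k ->] := UX a isT; rewrite memvZ.
rewrite (bigID (fun a => chi a == al)) /= in EY.
set S1 := \sum_(a | _) U a in EY; set S2 := \sum_(a | _) U a in EY.
have S1al : S1 \in root_space z al.
  by apply: memv_suml => a /eqP <-.
suff S20 : S2 = 0.
  by rewrite EY S20 addr0; apply: memv_sumr => a _; apply: UX.
apply: (@root_space_indep z al [seq chi a | a <- enum I & chi a != al]).
- by apply/mapP => -[a]; rewrite mem_filter => /andP[/eqP ne _] E; apply: ne.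
- by rewrite (_ : S2 = Y - S1) ?memvB // EY addrAC subrr add0r.
rewrite big_map big_filter big_enum_cond /=.
by apply: memv_sumr => a _.
Qed.

Lemma root_family_regular :
  [/\ exists s : seq (weight h), (ls_part g z <= \sum_(al <- s) root_space z al)%VS,
      (root_space z (0 : weight h)%R <= h)%VS
    & forall al : weight h, al != 0 -> (\dim (root_space z al) <= 1)%N].
Proof.
split=> [||al nz].
- exists [seq chi a | a <- enum I]; apply: subv_trans Xspan _.
  rewrite big_map big_enum /=; apply/subv_sumP => a _.
  by apply: (sumv_sup a) => //; rewrite -memvE.
- apply: subv_trans (root_space_family 0) _; apply/subv_sumP => a /eqP a0.
  by rewrite -memvE X0.
apply: leq_trans (dimvS (root_space_family al)) _.
case: (pickP (fun a : I => chi a == al)) => [a /eqP chia|none]; last first.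
  by rewrite big_pred0 // dimv0.
have [|Y XY] := X1 (a := a); first by rewrite chia.
apply: leq_trans (_ : \dim <[Y]> <= 1)%N; last by rewrite dim_vline leq_b1.
apply/dimvS/subv_sumP => b /eqP chib; rewrite -memvE; apply: XY.
by rewrite chia.
Qed.
End RootFamily.

Lemma regular_cartan_intro (C : numClosedFieldType) (g : lieSuperalgebra C) (h : {vspace g}) :
  (h <= ls_part g false)%VS ->
  (forall H H', H \in h -> H' \in h -> ls_br H H' = 0) ->
  (forall z,
    [/\ exists s : seq (weight h), (ls_part g z <= \sum_(al <- s) root_space z al)%VS,
        (root_space z (0 : weight h)%R <= h)%VS
      & forall al : weight h, al != 0 -> (\dim (root_space z al) <= 1)%N]) ->
  regular_cartan h.
Proof. by move=> h0 hab hz; split=> // [z|z|z al nz]; case: (hz z) => // _ _; apply. Qed.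

(** * Supertrace forms and root vectors from matrix units *)

Section MatrixSupertrace.
Variables (K : fieldType) (m n : nat).
Local Notation M := 'M[K]_(m + n).
Local Notation gl_part := (gl_part K m n).
Implicit Types X Y Z : M.

Definition idx_odd (i : 'I_(m + n)) : bool := (m <= i)%N.

Lemma mxpartE a X i j :
  mxpart a X i j = if idx_odd i (+) idx_odd j == a then X i j else 0.
Proof.
have odd_l k : idx_odd (lshift n k) = false by apply/negbTE; rewrite /idx_odd -ltnNge /=.
have odd_r k : idx_odd (rshift m k) = true by rewrite /idx_odd /= leq_addr.
rewrite /mxpart -[X in RHS]submxK.
case: (split_ordP i) => i' ->; case: (split_ordP j) => j' ->; case: a;
by rewrite ?odd_l ?odd_r !(block_mxEul, block_mxEur, block_mxEdl, block_mxEdr) ?mxE.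
Qed.

Lemma delta_mx_part i j : delta_mx i j \in gl_part (idx_odd i (+) idx_odd j).
Proof.
rewrite gl_partE; apply/eqP/matrixP => k l; rewrite mxpartE !mxE.
by case: ifP => // /eqP E; case: eqP => //= ki; case: eqP => // lj;
  move: E; rewrite ki lj; case: (_ (+) _).
Qed.

Lemma mxstr_mulC a b X Y : X \in gl_part a -> Y \in gl_part b ->
  mxstr (Y *m X) = (-1) ^+ (a && b) * mxstr (X *m Y).
Proof.
move=> /mxpart_id <- /mxpart_id <-; rewrite /mxstr.
case: a b => [] [] /=; rewrite !mulmx_block !(mul0mx, mulmx0, addr0, add0r);
rewrite !(block_mxKul, block_mxKdr) ?(mxtrace0, subrr, mulr0) //.
  rewrite (mxtrace_mulC (ursubmx Y)) (mxtrace_mulC (dlsubmx Y)).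
  by rewrite expr1 mulN1r opprB.
by rewrite (mxtrace_mulC (ulsubmx Y)) (mxtrace_mulC (drsubmx Y)) mul1r.
Qed.

Lemma mxstr_odd X : X \in gl_part true -> mxstr X = 0.
Proof.
by move=> /mxpart_id <-; rewrite /mxstr /= block_mxKul block_mxKdr !mxtrace0 subrr.
Qed.

(** By trilinearity of the defect [f], homogeneous arguments suffice. There the terms U V W agree,
    and V U W becomes U W V by a signed cyclic move of V. *)
Lemma mxstr_br_inv X Y Z : mxstr (gl_br X Y *m Z) = mxstr (X *m gl_br Y Z).
Proof.
suff H a b c U V W : U \in gl_part a -> V \in gl_part b -> W \in gl_part c ->
    mxstr (gl_br U V *m W) = mxstr (U *m gl_br V W).
  pose f (U V W : M) : K := mxstr (gl_br U V *m W) - mxstr (U *m gl_br V W).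
  have f1 U U' V W : f (U + U') V W = f U V W + f U' V W.
    rewrite /f (linearDl (@gl_br K m n)) !mulmxDl !(linearD (@mxstr K m n)).
    by rewrite opprD addrACA.
  have f2 U V V' W : f U (V + V') W = f U V W + f U V' W.
    rewrite /f (linearDl (@gl_br K m n)) (linearDr (@gl_br K m n)).
    by rewrite mulmxDl mulmxDr !(linearD (@mxstr K m n)) opprD addrACA.
  have f3 U V W W' : f U V (W + W') = f U V W + f U V W'.
    rewrite /f (linearDr (@gl_br K m n)) !mulmxDr !(linearD (@mxstr K m n)).
    by rewrite opprD addrACA.
  have f0 a b c : f (mxpart a X) (mxpart b Y) (mxpart c Z) = 0.
    by rewrite /f (H _ _ _ _ _ _ (mxpart_in a X) (mxpart_in b Y) (mxpart_in c Z)) subrr.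
  apply/eqP; rewrite -subr_eq0 -/(f X Y Z) -[X]mxpart_sum -[Y]mxpart_sum -[Z]mxpart_sum.
  by rewrite !(f1, f2, f3) !f0 !addr0.
move=> Ua Vb Wc; rewrite (gl_brE Ua Vb) (gl_brE Vb Wc) mulmxBl mulmxBr !linearB /=.
rewrite -scalemxAl -scalemxAr !linearZ /= mulmxA; congr (_ - _).
have := mxstr_mulC (mulmx_part Ua Wc) Vb; rewrite !mulmxA => ->.
(* For odd total parity the supertraces vanish; otherwise the parity of W is that of U V, and the
   two signs coincide. *)
rewrite mulrA; have [E|ne] := eqVneq (a (+) b (+) c) true.
  rewrite -mulmxA mxstr_odd ?mulr0 //.
  by have := mulmx_part Ua (mulmx_part Wc Vb); rewrite [c (+) b]addbC addbA E.
congr (_ * _); have -> : c = a (+) b by move: ne; case: a b c {Ua Vb Wc} => [] [] [].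
by case: a b {ne Ua Vb Wc} => [] [] /=; rewrite -?expr2 ?sqrr_sign ?mulr1 ?mul1r.
Qed.

End MatrixSupertrace.

Section SupertraceForm.
Variables (C : numClosedFieldType) (g : lieSuperalgebra C) (m n : nat).
Variable mat : {linear g -> 'M[C]_(m + n)}.
Hypothesis mat_br : forall X Y, mat (ls_br X Y) = gl_br (mat X) (mat Y).
Hypothesis mat_part : forall a X, X \in ls_part g a -> mat X \in gl_part C m n a.

Lemma invariant_supertrace (k : C) : k != 0 ->
  (forall X, (forall Y, mxstr (mat X *m mat Y) = 0) -> X = 0) ->
  invariant_form (fun X Y => k * mxstr (mat X *m mat Y)).
Proof.
move=> k0 nd; split=> [Y c X Z|X c Y Z|a b X Y Xa Yb|a X Y Xa Ya|X Y Z|X E].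
- by rewrite linearP mulmxDl -scalemxAl linearP /= mulrDr mulrCA.
- by rewrite linearP mulmxDr -scalemxAr linearP /= mulrDr mulrCA.
- case: a b Xa Yb => [] [] // /mat_part Xa /mat_part Yb _;
  by rewrite (mxstr_odd (mulmx_part Xa Yb)) mulr0.
- by rewrite (mxstr_mulC (mat_part Xa) (mat_part Ya)) andbb mulrCA.
- by rewrite !mat_br mxstr_br_inv.
apply: nd => Y; apply: (mulfI k0); by rewrite E mulr0.
Qed.
End SupertraceForm.

Section MatrixFamily.
Variables (C : numClosedFieldType) (g : lieSuperalgebra C) (h : {vspace g}) (m n : nat).
Variables (E : {linear 'M[C]_(m + n) -> g}) (lam : 'I_(m + n) -> weight h).
Hypothesis Ewt : forall i j (H : subvs_of h),
  ls_br (vsval H) (E (delta_mx i j)) = wt (lam i - lam j) H *: E (delta_mx i j).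
Hypothesis Epart : forall i j, E (delta_mx i j) \in ls_part g (idx_odd i (+) idx_odd j).

(** Units of the wrong parity become 0, so that both parities use the same index type. *)
Definition mx_root_vec (z : bool) (p : 'I_(m + n) * 'I_(m + n)) : g :=
  if idx_odd p.1 (+) idx_odd p.2 == z then E (delta_mx p.1 p.2) else 0.

Lemma mx_root_vec_in z p : mx_root_vec z p \in root_space z (lam p.1 - lam p.2).
Proof.
rewrite /mx_root_vec; case: eqP => [<-|_]; last exact: mem0v.
by apply/root_spaceP; split=> [|H]; [apply: Epart|apply: Ewt].
Qed.

Lemma mx_root_vec_span z : (forall Y, Y \in ls_part g z -> exists x, Y = E x) ->
  (ls_part g z <= \sum_p <[mx_root_vec z p]>)%VS.
Proof.
move=> onto; apply/subvP => Y Yz; have [x Yx] := onto _ Yz.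
pose V y := \sum_p x p.1 p.2 *: mx_root_vec y p.
have VE : Y = V z + V (~~ z).
  rewrite Yx {1}[x]matrix_sum_delta pair_big linear_sum -big_split /=.
  apply: eq_bigr => p _; rewrite linearZ -scalerDr /mx_root_vec /=; congr (_ *: _).
  by case: (_ (+) _) z {onto V Yz} => [] [] /=; rewrite ?addr0 ?add0r.
have Vz y : V y \in ls_part g y.
  by apply: memv_suml => p _; rewrite memvZ //; have /root_spaceP[] := mx_root_vec_in y p.
have V0 : V (~~ z) = 0.
  apply/eqP; rewrite -memv0 -(ls_direct g).
  have : V (~~ z) \in ls_part g z by rewrite (_ : V _ = Y - V z) ?memvB //
    VE addrAC subrr add0r.
  by case: z Vz {onto Yz VE} => Vz V1; rewrite memv_cap V1 Vz.
by rewrite VE V0 addr0; apply: memv_sumr => p _; apply: memvZ; apply: memv_line.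
Qed.
End MatrixFamily.

Lemma uniq_ltpairs n : uniq (ltpairs n).
Proof. by rewrite filter_uniq // enum_uniq. Qed.

(** Applied with T the adjoint of a Cartan matrix: the conjugation by J in the anti-involution then
    disappears. *)
Lemma invmx_conj (C : numClosedFieldType) N (J T : 'M[C]_N) :
  J *m J = 1%:M -> J *m T = T *m J -> invmx J *m T *m J = T.
Proof. by move=> JJ JT; rewrite -mulmxA -JT mulKmx //; case: (mulmx1_unit JJ). Qed.

Lemma diag_part (K : fieldType) m n (d : 'rV[K]_(m + n)) :
  diag_mx d \in gl_part K m n false.
Proof.
rewrite gl_partE; apply/eqP/matrixP => k l; rewrite mxpartE !mxE.
by have [->|_] := eqVneq k l; rewrite ?addbb // mulr0n if_same.
Qed.

Lemma gl_br_diag (C : numClosedFieldType) m n (d : 'rV[C]_(m + n)) i j :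
  gl_br (diag_mx d) (delta_mx i j) = (d 0 i - d 0 j) *: delta_mx i j.
Proof.
rewrite (gl_brE (diag_part d) (delta_mx_part _ i j)) /= expr0 scale1r.
apply/matrixP => k l; rewrite mul_diag_mx mul_mx_diag !mxE.
by case: eqP => [->|_]; case: eqP => [->|_] /=; rewrite ?(mulr1, mulr0, mul1r, mul0r, subrr).
Qed.

Lemma mxstrE (K : fieldType) m n (X : 'M[K]_(m + n)) :
  mxstr X = \sum_k (-1) ^+ idx_odd k * X k k.
Proof.
rewrite /mxstr big_split_ord /= /mxtrace -sumrN; congr (_ + _); apply: eq_bigr => i _.
  by rewrite !mxE /idx_odd leqNgt /= ltn_ord mul1r.
by rewrite !mxE /idx_odd /= leq_addr mulN1r.
Qed.

(** Reading off single entries in this way is what yields nondegeneracy of the supertrace forms. *)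
Lemma mxstr_delta (K : fieldType) m n (X : 'M[K]_(m + n)) i j :
  mxstr (X *m delta_mx j i) = (-1) ^+ idx_odd i * X i j.
Proof.
rewrite mxstrE (bigD1 i) //= big1 ?addr0 => [|k /negPf ki].
  rewrite mxE (bigD1 j) //= mxE !eqxx mulr1 big1 ?addr0 // => l /negPf lj.
  by rewrite mxE lj mulr0.
by rewrite mxE big1 ?mulr0 // => l _; rewrite mxE ki andbF mulr0.
Qed.

(** * The series gl(n|n) and sl(m|n), treated together *)

Section TypeA.
Variables (C : numClosedFieldType) (m n : nat) (g : lieSuperalgebra C).
Variables (mat : {linear g -> 'M[C]_(m + n)}) (E : {linear 'M[C]_(m + n) -> g}).
Variable c : 'M[C]_(m + n) -> C.
Hypothesis mat_inj : injective mat.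
Hypothesis mat_br : forall X Y, mat (ls_br X Y) = gl_br (mat X) (mat Y).
Hypothesis mat_part : forall a X, (X \in ls_part g a) = (mat X \in gl_part C m n a).
Hypothesis matK : cancel mat E.
Hypothesis EK : forall x, mat (E x) = x - (c x)%:M.
Hypothesis c_delta : forall i j, i != j -> c (delta_mx i j) = 0.
Hypothesis c_str : forall X x, c x * mxstr (mat X) = 0.
Local Notation h := (A_cartan mat).
Local Notation A := (A_datum mat).

Lemma A_cartanP X : reflect (exists d, mat X = diag_mx d) (X \in h).
Proof.
rewrite /A_cartan -memv_preim lfunE; apply: (iffP memv_imgP) => [[d _ ->]|[d ->]].
  by exists d; rewrite lfunE.
by exists d; rewrite ?memvf ?lfunE.
Qed.

Definition A_lam (k : 'I_(m + n)) : weight h :=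
  linfun (fun H : subvs_of h => mat (vsval H) k k : C^o).

Lemma A_lamE k H : wt (A_lam k) H = mat (vsval H) k k.
Proof.
by rewrite /wt /A_lam linfunE // => a H1 H2; rewrite !linearP !mxE.
Qed.

(** E corrects a matrix by the scalar c x so that it lands in the algebra. For gl this c is zero,
    for sl the supertrace of [mat Y] is; either way the form does not see the correction. *)
Lemma A_scalar_str x Y : mxstr (mat Y *m (c x)%:M) = 0.
Proof. by rewrite mul_mx_scalar linearZ /= c_str. Qed.

Lemma A_form_invariant : invariant_form (@A_form C m n g mat).
Proof.
have mp a X : X \in ls_part g a -> mat X \in gl_part C m n a by rewrite mat_part.
have := invariant_supertrace mat_br mp (oner_neq0 C).
case=> [|Hl Hr He Hs Hi Hn].
  move=> X EX; apply: mat_inj; rewrite linear0; apply/matrixP => i j.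
  have := EX (E (delta_mx j i)); rewrite EK mulmxBr linearB /= A_scalar_str subr0.
  rewrite mxstr_delta => /eqP; rewrite mulf_eq0 signr_eq0 /= => /eqP->.
  by rewrite mxE.
split=> //.
- by move=> Y a X Z; have := Hl Y a X Z; rewrite !mul1r.
- by move=> Y a X Z; have := Hr Y a X Z; rewrite !mul1r.
- by move=> a b X Y Xa Yb ab; have := He a b X Y Xa Yb ab; rewrite mul1r.
- by move=> a X Y Xa Ya; have := Hs a X Y Xa Ya; rewrite !mul1r.
- by move=> X Y Z; have := Hi X Y Z; rewrite !mul1r.
by move=> X EX; apply: Hn => Y; rewrite mul1r; apply: EX.
Qed.

Lemma gl_br_scalar (d : 'rV[C]_(m + n)) (a : C) : gl_br (diag_mx d) a%:M = 0.
Proof.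
rewrite -diag_const_mx (gl_brE (diag_part d) (diag_part _)) /= expr0 scale1r.
by apply/matrixP => i j; rewrite mul_diag_mx mul_mx_diag !mxE; case: eqVneq => [->|_];
  rewrite ?mulr1n ?mulr0n; ring.
Qed.

Lemma A_wt i j (H : subvs_of h) :
  ls_br (vsval H) (E (delta_mx i j)) = wt (A_lam i - A_lam j) H *: E (delta_mx i j).
Proof.
have [d dH] := A_cartanP _ (subvsP H).
apply: mat_inj; rewrite mat_br linearZ /= EK dH linearBr /= gl_br_scalar subr0.
rewrite gl_br_diag wtD wtN !A_lamE dH !mxE !eqxx !mulr1n scalerBr.
have [->|ij] := eqVneq i j; first by rewrite subrr !scale0r subr0.
by rewrite c_delta // scale_scalar_mx mulr0 raddf0 subr0.
Qed.

Lemma A_part i j : E (delta_mx i j) \in ls_part g (idx_odd i (+) idx_odd j).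
Proof.
rewrite mat_part EK; have [->|ij] := eqVneq i j.
  by rewrite addbb memvB // -?diag_const_mx ?diag_part // -(addbb (idx_odd j)) delta_mx_part.
by rewrite c_delta // raddf0 subr0 delta_mx_part.
Qed.

Lemma A_diag_in i : E (delta_mx i i) \in h.
Proof.
apply/A_cartanP; exists (delta_mx 0 i - const_mx (c (delta_mx i i))).
rewrite EK linearB /= diag_const_mx; congr (_ - _).
apply/matrixP => k l; rewrite !mxE /=; have [->|kl] := eqVneq k l.
  by rewrite andbb mulr1n.
rewrite mulr0n; have [<-|//] := eqVneq k i; by rewrite eq_sym (negPf kl).
Qed.

Lemma A_lam_delta i a :
  wt (A_lam i) (vsproj h (E (delta_mx a a))) = (i == a)%:R - c (delta_mx a a).
Proof.
by rewrite A_lamE vsprojK ?A_diag_in // EK !mxE eqxx mulr1n andbb.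
Qed.

(** At the image of a diagonal unit a root takes a difference of two Kronecker deltas, the
    corrections by c cancelling. In characteristic zero, 1 = b - b' for truth values forces b to be
    true. *)
Lemma A_lam_inj i j k l : i != j -> A_lam i - A_lam j = A_lam k - A_lam l ->
  (k, l) = (i, j).
Proof.
move=> ij Ewt; have Ea a : (i == a)%:R - (j == a)%:R = (k == a)%:R - (l == a)%:R :> C.
  have := congr1 (fun al => wt al (vsproj h (E (delta_mx a a)))) Ewt.
  by rewrite !wtD !wtN !A_lam_delta !opprB !addrA !addrNK.
have aux (b b' : bool) : 1 = b%:R - b'%:R :> C -> b.
  case: b b' => [] [] //=; last by rewrite subrr => /eqP; rewrite oner_eq0.
  by move=> /(congr1 (+%R^~ 1)) /eqP; rewrite sub0r addNr -mulr2n pnatr_eq0.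
have /eqP-> : k == i.
  by apply: (aux _ (l == i)); rewrite -Ea eqxx eq_sym (negPf ij) subr0.
have /eqP-> // : l == j.
apply: (aux _ (k == j)); rewrite -[RHS]opprB -Ea eqxx (negPf ij) sub0r opprK.
by [].
Qed.

Lemma A_regular_cartan : regular_cartan h.
Proof.
apply: regular_cartan_intro => [||z].
- by apply/subvP => H /A_cartanP[d dH]; rewrite mat_part dH diag_part.
- move=> H H' /A_cartanP[d dH] /A_cartanP[d' dH']; apply: mat_inj.
  rewrite mat_br dH dH' linear0 (gl_brE (diag_part d) (diag_part d')) /= scale1r.
  by apply/matrixP => i j; rewrite mul_diag_mx mul_mx_diag !mxE; case: eqVneq => [->|_];
    rewrite ?mulr1n ?mulr0n; ring.
apply: (@root_family_regular _ _ _ z _ (mx_root_vec E z) (fun p => A_lam p.1 - A_lam p.2)).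
- by move=> p; apply: mx_root_vec_in; [apply: A_wt|apply: A_part].
- apply: (mx_root_vec_span A_wt A_part) => Y _.
  by exists (mat Y); rewrite matK.
- move=> [i j] /eqP; rewrite subr_eq0 /mx_root_vec => /eqP /= Eij.
  have [<-|ij] := eqVneq i j; first by case: ifP; rewrite ?A_diag_in ?mem0v.
  have := @A_lam_inj i j j i ij; rewrite Eij => /(_ erefl)[E1 _].
  by rewrite E1 eqxx in ij.
move=> [i j] /= nz; exists (mx_root_vec E z (i, j)) => -[k l] /= Ekl.
have ij : i != j by apply: contraNneq nz => ->; rewrite subrr.
by rewrite (A_lam_inj ij (esym Ekl)) memv_line.
Qed.

Lemma A_uniq : uniq (A_pos0 mat).
Proof.
pose L := [seq (lshift n p.1, lshift n p.2) | p <- ltpairs m]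
  ++ [seq (rshift m p.1, rshift m p.2) | p <- ltpairs n].
have -> : A_pos0 mat = [seq A_lam q.1 - A_lam q.2 | q <- L].
  by rewrite map_cat -!map_comp.
have Lne q : q \in L -> q.1 != q.2.
  rewrite mem_cat => /orP[] /mapP[p]; rewrite mem_filter => /andP[lt _] -> /=.
    by rewrite (inj_eq (@lshift_inj _ _)) -(inj_eq val_inj) neq_ltn lt.
  by rewrite (inj_eq (@rshift_inj _ _)) -(inj_eq val_inj) neq_ltn lt.
rewrite map_inj_in_uniq => [|[i j] [k l] /Lne ij _ /= E1]; last first.
  by rewrite (A_lam_inj ij E1).
rewrite cat_uniq !map_inj_uniq ?uniq_ltpairs //=.
- rewrite andbT; apply/hasPn => _ /mapP[p _ ->]; apply/mapP => -[q _].
  by move=> /(congr1 fst) /eqP; rewrite eq_rlshift.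
- by move=> [a b] [a' b'] /eqP; rewrite xpair_eqE /= !eq_rshift => /andP[/eqP-> /eqP->].
by move=> [a b] [a' b'] /eqP; rewrite xpair_eqE /= !eq_lshift => /andP[/eqP-> /eqP->].
Qed.

(** J is diagonal with entries 1 and -1, so it is an involution commuting with diagonal matrices. *)
Lemma A_omega_cartan w X : A_omega mat w -> X \in h -> w X \in h.
Proof.
move=> [p [s [_ /= wE]]] /A_cartanP[d dX]; apply/A_cartanP.
exists (map_mx Num.conj d); rewrite wE dX.
have -> : adjoint_mx (diag_mx d) = diag_mx (map_mx Num.conj d).
  by apply/matrixP => i j; rewrite !mxE eq_sym; case: eqP => [->|_];
    rewrite ?mulr1n ?mulr0n ?conjC0.
pose dJ := row_mx (\row_(i < m) (if (i < p)%N then 1 else - 1)) (const_mx ((-1) ^+ s))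
  : 'rV[C]_(m + n).
have -> : block_mx (sig_mx C m p) 0 0 ((-1) ^+ s)%:M = diag_mx dJ.
  by rewrite diag_mx_row diag_const_mx.
apply: invmx_conj; last by apply/matrixP => i j; rewrite mul_diag_mx mul_mx_diag !mxE;
  case: eqVneq => [->|_];
    rewrite ?mulr1n ?mulr0n; ring.
rewrite -[1%:M]diag_const_mx; apply/matrixP => i j; rewrite mul_diag_mx !mxE.
case: eqVneq => [->|_]; rewrite ?mulr1n ?mulr0n ?mulr0 //.
case: splitP => k _; rewrite mxE; last by rewrite -expr2 sqrr_sign.
by case: ifP; rewrite ?mulr1 ?mulrNN ?mulr1.
Qed.

Lemma A_regular_datum w : A_omega mat w -> @regular_datum C A w.
Proof.
move=> wA; split; [exact: A_form_invariant|exact: A_regular_cartan|exact: A_uniq|].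
by move=> X; apply: A_omega_cartan.
Qed.
End TypeA.

Lemma gl_regular_datum (C : numClosedFieldType) n w :
  d_omega (gl_datum C n) w -> regular_datum w.
Proof.
apply: (@A_regular_datum C n n (gl_lie C n n) idfun idfun (fun=> 0)) => //.
- by move=> x; rewrite raddf0 subr0.
- by move=> X x; rewrite mul0r.
Qed.

(** As m <> n, the identity has nonzero supertrace m - n, and dividing the supertrace by it gives
    the c for which E projects gl(m|n) onto sl(m|n) along the scalars. *)
Lemma sl_regular_datum (C : numClosedFieldType) m n w : m <> n ->
  d_omega (sl_datum C m n) w -> regular_datum w.
Proof.
move=> mn.
pose str1 : C := m%:R - n%:R.
have str1E : mxstr (1%:M : 'M[C]_(m + n)) = str1.
  by rewrite /mxstr scalar_mx_block block_mxKul block_mxKdr !mxtrace1.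
have str1_neq0 : str1 != 0 by rewrite subr_eq0 eqr_nat; apply/eqP.
pose c (x : 'M[C]_(m + n)) := mxstr x / str1.
pose e x := vsproj (sl_space C m n) (x - (c x)%:M).
have eL : linear e.
  move=> a x y; rewrite /e -linearP /c (linearP (@mxstr C m n)); congr (vsproj _ _).
  by rewrite mulrDl -mulrA raddfD /= -scale_scalar_mx scalerBr opprD addrACA.
pose E : {linear _ -> _} := HB.pack e (GRing.isLinear.Build _ _ _ _ e eL).
have EK x : vsval (E x) = x - (c x)%:M.
  rewrite /E /= /e vsprojK // sl_spaceE linearB /= -[X in _ - mxstr X]scalemx1 linearZ /=.
  by rewrite str1E /c divfK // subrr.
apply: (@A_regular_datum C m n (sl_lie C m n) (@vsval _ _ _) E c) => //.
- exact: val_inj.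
- by move=> X Y; apply: (vsval_br (g := gl_lie C m n) (@sl_space_br C m n)).
- by move=> a X; exact: (sub_partE (g := gl_lie C m n)).
- move=> X; apply: val_inj; rewrite [LHS]EK /c.
  by have := subvsP X; rewrite sl_spaceE => /eqP ->; rewrite mul0r raddf0 subr0.
- move=> i j ij; rewrite /c mxstrE big1 ?mul0r // => k _; rewrite !mxE.
  by case: eqP => [->|_]; rewrite ?(negPf ij) ?mulr0.
by move=> X x; have := subvsP X; rewrite sl_spaceE => /eqP->; rewrite mulr0.
Qed.

(** * Orthosymplectic Lie superalgebras *)

Section Pairing.
Variables (C : numClosedFieldType) (N : nat) (pt : 'I_N -> 'I_N) (s : 'I_N -> C).
Hypothesis ptK : involutive pt.
Hypothesis s_pt : forall i, s (pt i) = - s i.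
Implicit Types (x : 'M[C]_N) (tau : 'I_N -> C).

Definition pair_mx : 'M[C]_N := \matrix_(i, j) (j == pt i)%:R.
Definition sgn_mx : 'M[C]_N := diag_mx (\row_i s i).
(** Common shape of the orthogonal torus with blocks t K and of the symplectic torus ['i] Omega
    diag(D, D): index i is paired with pt i, and s carries the sign. *)
Definition pair_torus tau : 'M[C]_N :=
  \matrix_(i, j) ('i * s i * tau i * (j == pt i)%:R).
(** Its columns are eigenvectors of every [pair_torus] with tau constant on pairs. Since [pair_mx]
    squares to 1, its product with 1 + ['i] Pi is 2, whence the inverse. *)
Definition pair_basis : 'M[C]_N := 1%:M - 'i *: pair_mx.
Definition pair_basis_inv : 'M[C]_N := 2^-1 *: (1%:M + 'i *: pair_mx).

Lemma pt_eq i j : (i == pt j) = (pt i == j).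
Proof. by rewrite -(inj_eq (inv_inj ptK)) ptK. Qed.

Lemma mul_pair_mx M (x : 'M[C]_(N, M)) : pair_mx *m x = \matrix_(i, j) x (pt i) j.
Proof.
apply/matrixP => i j; rewrite !mxE (bigD1 (pt i)) //= mxE eqxx mul1r big1 ?addr0 //.
by move=> k /negPf nk; rewrite mxE nk mul0r.
Qed.

Lemma mul_mx_pair M (x : 'M[C]_(M, N)) : x *m pair_mx = \matrix_(i, j) x i (pt j).
Proof.
apply/matrixP => i j; rewrite !mxE (bigD1 (pt j)) //= mxE ptK eqxx mulr1 big1 ?addr0 //.
by move=> k nk; rewrite mxE pt_eq eq_sym pt_eq eq_sym (eq_sym j) -pt_eq (negPf nk) mulr0.
Qed.

Lemma pair_mx_sqr : pair_mx *m pair_mx = 1%:M.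
Proof. by rewrite mul_pair_mx; apply/matrixP => i j; rewrite !mxE ptK eq_sym. Qed.

Lemma tr_pair_mx : pair_mx^T = pair_mx.
Proof. by apply/matrixP => i j; rewrite !mxE pt_eq eq_sym. Qed.

Lemma pair_sgn : pair_mx *m sgn_mx = - (sgn_mx *m pair_mx).
Proof.
rewrite mul_pair_mx mul_mx_pair; apply/matrixP => i j; rewrite !mxE -pt_eq.
by case: eqVneq => [->|]; rewrite ?mulr1n ?mulr0n ?oppr0 // s_pt.
Qed.

Lemma tr_basis : pair_basis^T = pair_basis.
Proof. by rewrite linearB linearZ /= trmx1 tr_pair_mx. Qed.
Lemma tr_basis_inv : pair_basis_inv^T = pair_basis_inv.
Proof. by rewrite linearZ linearD linearZ /= trmx1 tr_pair_mx. Qed.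

Lemma basis_invK : pair_basis *m pair_basis_inv = 1%:M.
Proof.
rewrite /pair_basis /pair_basis_inv -scalemxAr mulmxDr !mulmxBl !mul1mx mulmx1.
rewrite -scalemxAl -scalemxAr pair_mx_sqr scalerA -expr2 sqrCi scaleN1r opprK.
rewrite addrA addrNK -mulr2n -scaler_nat scalerA mulVf ?scale1r ?pnatr_eq0 //.
Qed.

Lemma pair_basisC : pair_mx *m pair_basis = pair_basis *m pair_mx.
Proof. by rewrite mulmxBl mulmxBr mulmx1 mul1mx -scalemxAl -scalemxAr. Qed.

Lemma basis_invE : pair_basis_inv = (2^-1 * 'i) *: (pair_mx *m pair_basis).
Proof.
rewrite /pair_basis mulmxBr mulmx1 -scalemxAr pair_mx_sqr -scalerA; congr (_ *: _).
by rewrite scalerBr scalerA -expr2 sqrCi scaleN1r opprK addrC.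
Qed.

(** S anticommutes with Pi, so carrying it across 1 - ['i] Pi yields 1 + ['i] Pi. *)
Lemma sgn_basis_inv : sgn_mx *m pair_basis = 2 *: (pair_basis_inv *m sgn_mx).
Proof.
rewrite /pair_basis /pair_basis_inv -scalemxAl scalerA divff ?pnatr_eq0 // scale1r.
by rewrite mulmxBr mulmxDl mulmx1 mul1mx -scalemxAr -scalemxAl pair_sgn scalerN.
Qed.

Lemma torus_basis tau : (forall i, tau (pt i) = tau i) ->
  pair_torus tau *m pair_basis = pair_basis *m diag_mx (\row_i (s i * tau i)).
Proof.
move=> tau_pt; rewrite /pair_basis mulmxBr mulmx1 -scalemxAr mul_mx_pair mulmxBl mul1mx.
rewrite -scalemxAl mul_pair_mx; apply/matrixP => i j; rewrite !mxE.
rewrite (inj_eq (inv_inj ptK)) (eq_sym j i) (eq_sym j (pt i)).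
have i2 : 'i * 'i = -1 :> C by rewrite -expr2 sqrCi.
have [ij|ij] := eqVneq i j; have [pij|pij] := eqVneq (pt i) j.
(* A fixed point of pt satisfies s i = - s i, so its eigenvalue is 0; for odd m this is the last
   orthogonal coordinate. *)
- have s0 : s i = 0.
    have := s_pt i; rewrite pij -ij => /eqP; rewrite -subr_eq0 opprK -mulr2n mulrn_eq0 /=.
    by move/eqP.
  by rewrite s_pt s0; ring.
- by rewrite !mulr0n !mulr1n !mulr1 !mulr0 !mulrA i2; ring.
- by rewrite !mulr0n !mulr1n !mulr1 !mulr0 s_pt tau_pt; ring.
by rewrite !mulr0n !mulr0; ring.
Qed.

Lemma torusE tau : (forall i, tau (pt i) = tau i) ->
  pair_torus tau = pair_basis *m diag_mx (\row_i (s i * tau i)) *m pair_basis_inv.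
Proof. by move=> /torus_basis <-; rewrite -mulmxA basis_invK mulmx1. Qed.

Lemma torus_adjoint tau : (forall i, tau (pt i) = tau i) -> (forall i, (s i)^* = s i) ->
  adjoint_mx (pair_torus tau) = pair_torus (fun i => (tau i)^*).
Proof.
move=> tau_pt sR; apply/matrixP => i j; rewrite !mxE !rmorphM /= conjCi sR.
rewrite pt_eq eq_sym -[RHS]/(_ * _); case: eqP => [->|_] /=; last by rewrite !conjC0 !mulr0.
by rewrite conjC1 s_pt tau_pt; ring.
Qed.

End Pairing.

Section PairingMore.
Variables (C : numClosedFieldType) (N : nat) (pt : 'I_N -> 'I_N) (s : 'I_N -> C).
Hypothesis ptK : involutive pt.
Hypothesis s_pt : forall i, s (pt i) = - s i.
Local Notation Pi := (pair_mx C pt).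
Local Notation P := (pair_basis C pt).
Local Notation Pv := (pair_basis_inv C pt).
Local Notation S := (sgn_mx s).

Lemma basis_pair : P *m Pi = (- (2 * 'i)) *: Pv.
Proof.
rewrite (basis_invE _ ptK) -pair_basisC // scalerA.
by rewrite mulNr mulrACA divff ?pnatr_eq0 // mul1r -expr2 sqrCi opprK scale1r.
Qed.

Lemma pair_inv : Pi *m Pv = (2^-1 * 'i) *: P.
Proof. by rewrite (basis_invE _ ptK) -scalemxAr mulmxA pair_mx_sqr // mul1mx. Qed.

Lemma sgn_pair_inv : S *m Pi *m Pv = 'i *: (Pv *m S).
Proof.
rewrite -mulmxA pair_inv -scalemxAr (sgn_basis_inv ptK s_pt) scalerA mulrAC.
by rewrite mulVf ?pnatr_eq0 // mul1r.
Qed.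

Lemma basis_sgn_pair : P *m S *m Pi = 'i *: (S *m P).
Proof.
rewrite -mulmxA -[S *m Pi]opprK -(pair_sgn ptK s_pt) mulmxN mulmxA basis_pair.
by rewrite -scalemxAl scaleNr opprK (sgn_basis_inv ptK s_pt) scalerA mulrC.
Qed.
End PairingMore.

Section OspIndices.
Variables (C : numClosedFieldType) (m n : nat).

(** Exchanges the two coordinates of each block K; for odd m the last coordinate is fixed, and
    [sg_so] gives it sign 0. *)
Definition pt_so_nat (i : nat) : nat :=
  if odd i then i.-1 else if (i.+1 < m)%N then i.+1 else i.
Lemma pt_so_lt (i : 'I_m) : (pt_so_nat i < m)%N.
Proof. by case: i => i im /=; rewrite /pt_so_nat; case: ifP; [lia|case: ifP]. Qed.
Definition pt_so (i : 'I_m) : 'I_m := Ordinal (pt_so_lt i).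
Definition sg_so (i : 'I_m) : C :=
  if odd i then - 1 else if (i.+1 < m)%N then 1 else 0.
(** The sum avoids building an ordinal from i./2, which for odd m is out of range at the last index;
    the value there is 0. *)
Definition tau_so (t : 'rV[C]_(m./2)) (i : 'I_m) : C :=
  \sum_k t 0 k * (k == i./2 :> nat)%:R.

Lemma pt_soK : involutive pt_so.
Proof.
by case=> i im; apply: val_inj; rewrite /= /pt_so_nat; do !case: ifP => //; lia.
Qed.
Lemma sg_pt_so i : sg_so (pt_so i) = - sg_so i.
Proof.
case: i => i im; rewrite /sg_so /= /pt_so_nat; do !case: ifP => //; rewrite ?opprK ?oppr0 //;
  lia.
Qed.
Lemma tau_pt_so t i : tau_so t (pt_so i) = tau_so t i.
Proof.
rewrite /tau_so (_ : (pt_so i)./2 = i./2) //; case: i => i im /=.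
by rewrite /pt_so_nat; do !case: ifP => //; lia.
Qed.

Lemma torus_mxE t : torus_mx t = pair_torus pt_so sg_so (tau_so t).
Proof.
apply/matrixP => i j; rewrite !mxE /tau_so mulr_sumr mulr_suml; apply: eq_bigr => k _.
case: i j k => i im [j jm] [k km]; rewrite /sg_so -(inj_eq val_inj) /= /pt_so_nat.
case: ifP => oi; [|case: ifP => im1].
- rewrite (_ : i == k.*2 = false) ?sub0r; last by lia.
  rewrite (_ : k == i./2 = (i == k.*2.+1)); last by lia.
  rewrite (_ : j == i.-1 = (j.+1 == i)); last by lia.
  by case: eqP => [->|_]; rewrite ?eqSS; case: eqP => _ /=; ring.
- rewrite (_ : i == k.*2.+1 = false) ?subr0; last by lia.
  rewrite (_ : k == i./2 = (i == k.*2)); last by lia.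
  by case: eqP => [->|_] /=; case: eqP => _ /=; ring.
have -> : (i == k.*2.+1) = false by lia.
have -> : (i == k.*2) = false by lia.
by rewrite /= subrr !(mulr0, mul0r).
Qed.

Definition pt_sp (i : 'I_(n + n)) : 'I_(n + n) :=
  match split i with inl a => rshift n a | inr a => lshift n a end.
Definition sg_sp (i : 'I_(n + n)) : C := if split i is inl _ then 1 else - 1.
Definition tau_sp (d : 'rV[C]_n) (i : 'I_(n + n)) : C := row_mx d d 0 i.

Lemma pt_spl a : pt_sp (lshift n a) = rshift n a.
Proof. by rewrite /pt_sp (unsplitK (inl a)). Qed.
Lemma pt_spr a : pt_sp (rshift n a) = lshift n a.
Proof. by rewrite /pt_sp (unsplitK (inr a)). Qed.
Lemma sg_spl a : sg_sp (lshift n a) = 1.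
Proof. by rewrite /sg_sp (unsplitK (inl a)). Qed.
Lemma sg_spr a : sg_sp (rshift n a) = - 1.
Proof. by rewrite /sg_sp (unsplitK (inr a)). Qed.
Definition spE := (pt_spl, pt_spr, sg_spl, sg_spr).

Lemma pt_spK : involutive pt_sp.
Proof. by move=> i; case: (split_ordP i) => a ->; rewrite !spE. Qed.
Lemma sg_pt_sp i : sg_sp (pt_sp i) = - sg_sp i.
Proof. by case: (split_ordP i) => a ->; rewrite !spE ?opprK. Qed.
Lemma tau_pt_sp d i : tau_sp d (pt_sp i) = tau_sp d i.
Proof. by rewrite /tau_sp; case: (split_ordP i) => a ->;
  rewrite !spE !(row_mxEl, row_mxEr). Qed.
Lemma sg_sp_sqr i : sg_sp i * sg_sp i = 1.
Proof. by case: (split_ordP i) => a ->; rewrite !spE ?mulrNN mulr1. Qed.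

Lemma OmegaE : Omega C n = sgn_mx sg_sp *m pair_mx C pt_sp.
Proof.
apply/matrixP => i j; rewrite mul_diag_mx /Omega.
case: (split_ordP i) => a ->; case: (split_ordP j) => b ->;
rewrite !(block_mxEul, block_mxEur, block_mxEdl, block_mxEdr) !mxE !spE;
by rewrite ?eq_lshift ?eq_rshift ?eq_lrshift ?eq_rlshift ?(mul1r, mulr0) // ?mulN1r eq_sym.
Qed.

Lemma Omega_torusE (d : 'rV[C]_n) :
  'i *: (Omega C n *m diag_mx (row_mx d d)) = pair_torus pt_sp sg_sp (tau_sp d).
Proof.
rewrite OmegaE -mulmxA mul_mx_diag; have := tau_pt_sp d; rewrite /tau_sp.
move: (row_mx d d) => r rE; apply/matrixP => i j; rewrite mxE mul_diag_mx !mxE.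
by case: eqP => [->|_] /=; rewrite ?rE; ring.
Qed.

Definition pt_osp (i : 'I_(m + (n + n))) : 'I_(m + (n + n)) :=
  match split i with inl a => lshift _ (pt_so a) | inr a => rshift _ (pt_sp a) end.
(** Eigenvalues of the torus matrix in [osp_basis]: each t_k and d_a with both signs, and 0 once
    more for odd m. *)
Definition lam_osp (td : 'rV[C]_(m./2) * 'rV[C]_n) (i : 'I_(m + (n + n))) : C :=
  match split i with
  | inl a => sg_so a * tau_so td.1 a
  | inr a => sg_sp a * tau_sp td.2 a
  end.
Definition osp_basis : 'M[C]_(m + (n + n)) :=
  block_mx (pair_basis C pt_so) 0 0 (pair_basis C pt_sp).
Definition osp_basis_inv : 'M[C]_(m + (n + n)) :=
  block_mx (pair_basis_inv C pt_so) 0 0 (pair_basis_inv C pt_sp).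

Lemma pt_ospl a : pt_osp (lshift _ a) = lshift _ (pt_so a).
Proof. by rewrite /pt_osp (unsplitK (inl a)). Qed.
Lemma pt_ospr a : pt_osp (rshift _ a) = rshift _ (pt_sp a).
Proof. by rewrite /pt_osp (unsplitK (inr a)). Qed.
Lemma lam_ospl td a : lam_osp td (lshift _ a) = sg_so a * tau_so td.1 a.
Proof. by rewrite /lam_osp (unsplitK (inl a)). Qed.
Lemma lam_ospr td a : lam_osp td (rshift _ a) = sg_sp a * tau_sp td.2 a.
Proof. by rewrite /lam_osp (unsplitK (inr a)). Qed.
Definition ospE := (pt_ospl, pt_ospr, lam_ospl, lam_ospr).

Lemma pt_ospK : involutive pt_osp.
Proof.
by move=> i; case: (split_ordP i) => a ->; rewrite !ospE ?pt_soK ?pt_spK.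
Qed.

Lemma lam_osp_pt td i : lam_osp td (pt_osp i) = - lam_osp td i.
Proof.
case: (split_ordP i) => a ->; rewrite !ospE ?sg_pt_so ?sg_pt_sp ?tau_pt_so ?tau_pt_sp;
by rewrite mulNr.
Qed.

Lemma osp_basis_invK : osp_basis *m osp_basis_inv = 1%:M.
Proof.
rewrite mulmx_block !(mul0mx, mulmx0, addr0, add0r) !basis_invK ?scalar_mx_block //.
  exact: pt_spK. exact: pt_soK.
Qed.
Lemma osp_basis_Kinv : osp_basis_inv *m osp_basis = 1%:M.
Proof. exact/mulmx1C/osp_basis_invK. Qed.

Lemma osp_torusE td :
  osp_torus td = osp_basis *m diag_mx (\row_i lam_osp td i) *m osp_basis_inv.
Proof.
have -> : \row_i lam_osp td i = row_mx (\row_i (sg_so i * tau_so td.1 i))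
    (\row_i (sg_sp i * tau_sp td.2 i)).
  apply/rowP => i; rewrite mxE; case: (split_ordP i) => a ->;
  by rewrite !ospE ?row_mxEl ?row_mxEr mxE.
rewrite diag_mx_row !mulmx_block !(mul0mx, mulmx0, addr0, add0r) /osp_torus.
rewrite torus_mxE Omega_torusE (torusE pt_soK sg_pt_so (tau_pt_so _)).
by rewrite (torusE pt_spK sg_pt_sp (tau_pt_sp _)).
Qed.
End OspIndices.

(** * The supertranspose and its matrix in the eigenbasis of the torus *)

Section OspInvolution.
Variables (C : numClosedFieldType) (m n : nat).
Local Notation M := 'M[C]_(m + (n + n)).
Local Notation Om := (Omega C n).
Implicit Types X Y x : M.

(* Minus the supertranspose for the orthosymplectic form. *)
Definition osp_inv X : M :=
  block_mx (- (ulsubmx X)^T) (- ((dlsubmx X)^T *m Om))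
           (- (Om *m (ursubmx X)^T)) (Om *m (drsubmx X)^T *m Om).

Lemma osp_inv_block A B D E : osp_inv (block_mx A B D E) =
  block_mx (- A^T) (- (D^T *m Om)) (- (Om *m B^T)) (Om *m E^T *m Om).
Proof. by rewrite /osp_inv !(block_mxKul, block_mxKur, block_mxKdl, block_mxKdr). Qed.

Lemma osp_inv_linear : linear osp_inv.
Proof.
move=> c X Y; rewrite /osp_inv scale_block_mx add_block_mx.
rewrite /ulsubmx /ursubmx /dlsubmx /drsubmx !linearP /=.
by congr block_mx; rewrite ?(mulmxDl, mulmxDr) -?(scalemxAl, scalemxAr) ?opprD ?scalerN
  ?mulmxDl -?scalemxAl.
Qed.
HB.instance Definition _ := GRing.isLinear.Build C M M *:%R osp_inv osp_inv_linear.

Let trN p q (V : 'M[C]_(p, q)) : (- V)^T = - V^T.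
Proof. exact: raddfN. Qed.
Let trB p q (V W : 'M[C]_(p, q)) : (V - W)^T = V^T - W^T.
Proof. exact: raddfB. Qed.
Let tN p (V : 'M[C]_p) : \tr (- V) = - \tr V.
Proof. exact: raddfN. Qed.

Lemma Omega_mulK k (Z : 'M[C]_(_, k)) : Om *m (Om *m Z) = - Z.
Proof. by rewrite mulmxA Omega_sqr mulNmx mul1mx. Qed.

Lemma osp_invK : involutive osp_inv.
Proof.
move=> X; rewrite -[X in LHS]submxK !osp_inv_block -[RHS]submxK; congr block_mx.
- by rewrite trN trmxK opprK.
- rewrite trN trmx_mul trmxK Omega_tr mulNmx opprK mulmxN.
  by rewrite mulNmx -mulmxA Omega_sqr mulmxN mulmx1 opprK.
- by rewrite trN trmx_mul trmxK Omega_tr !(mulmxN, mulNmx) Omega_mulK !opprK.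
- rewrite !trmx_mul trmxK Omega_tr !(mulNmx, mulmxN) opprK -!mulmxA.
  by rewrite Omega_mulK Omega_sqr mulmxN mulmx1 opprK.
Qed.

Lemma osp_space_inv X : (X \in osp_space C m n) = (osp_inv X == X).
Proof.
rewrite -[X]submxK osp_inv_block.
move: (ulsubmx X) (ursubmx X) (dlsubmx X) (drsubmx X) => A B D E.
apply/osp_spaceP/eqP => [[HA HE HD]|/eq_block_mx[HA HB HD HE]].
  rewrite -HA -HE -HD {1}HD trN trmx_mul trmxK Omega_tr mulmxN mulNmx opprK.
  by rewrite mulNmx -mulmxA Omega_sqr mulmxN mulmx1 opprK.
by split.
Qed.

Lemma osp_inv_part a X : X \in gl_part C m (n + n) a -> osp_inv X \in gl_part C m (n + n) a.
Proof.
move=> /mxpart_id <-; rewrite gl_partE; case: a; rewrite /mxpart /= osp_inv_block;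
by rewrite !(block_mxKul, block_mxKur, block_mxKdl, block_mxKdr) !(trmx0, mul0mx, mulmx0,
  oppr0) block_mx0.
Qed.

(** Consequently projecting a matrix onto osp does not change its pairing with an element of osp, so
    nondegeneracy is inherited from gl. *)
Lemma osp_inv_str X Y : mxstr (osp_inv X *m osp_inv Y) = mxstr (X *m Y).
Proof.
rewrite -[X]submxK -[Y]submxK !osp_inv_block !mulmx_block /mxstr.
rewrite !block_mxKul !block_mxKdr !raddfD /= !(mulNmx, mulmxN) !opprK.
rewrite mulmxA -(mulmxA _ Om Om) Omega_sqr mulmxN mulmx1 mulNmx.
rewrite -trmx_mul mxtrace_tr mxtrace_mulC.
move: (ulsubmx X) (ursubmx X) (dlsubmx X) (drsubmx X) => A B D E.
move: (ulsubmx Y) (ursubmx Y) (dlsubmx Y) (drsubmx Y) => A' B' D' E'.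
have -> : \tr (- (D^T *m B'^T)) = - \tr (D *m B').
  by rewrite tN -trmx_mul mxtrace_tr mxtrace_mulC.
have -> : \tr (Om *m B^T *m (D'^T *m Om)) = - \tr (B *m D').
  rewrite mxtrace_mulC mulmxA -(mulmxA _ Om Om) Omega_sqr mulmxN mulmx1 mulNmx tN.
  by rewrite -trmx_mul mxtrace_tr.
have -> : \tr (Om *m E^T *m Om *m (Om *m E'^T *m Om)) = \tr (E *m E').
  rewrite -!mulmxA Omega_mulK mulmxN mulmxN tN mxtrace_mulC -!mulmxA Omega_sqr.
  by rewrite !mulmxN mulmx1 tN opprK -trmx_mul mxtrace_tr mxtrace_mulC.
by ring.
Qed.

(** Taking X in the torus, the projection onto osp commutes with the torus action and so preserves
    weights. *)
Lemma osp_inv_br X Y : X \in osp_space C m n -> X \in gl_part C m (n + n) false ->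
  osp_inv (gl_br X Y) = gl_br X (osp_inv Y).
Proof.
move=> Xo /mxpart_id X0; move: Xo; rewrite -X0 /mxpart => /osp_spaceP[HA HD _].
move: (ulsubmx X) (drsubmx X) HA HD => A D HA HD.
have tA : A^T = - A by rewrite {2}HA opprK.
have tD : D^T = Om *m (D *m Om).
  by rewrite {2}HD -!mulmxA Omega_sqr Omega_mulK mulmxN mulmx1 opprK.
rewrite -[Y]submxK osp_inv_block !gl_br_block osp_inv_block.
move: (ulsubmx Y) (ursubmx Y) (dlsubmx Y) (drsubmx Y) => A' B' D' E'.
rewrite !(mul0mx, mulmx0, addr0, add0r); congr block_mx.
- rewrite !trB !trmx_mul tA !(mulmxN, mulNmx).
  by mx_abel.
- rewrite !trB !trmx_mul tA tD !(mulmxBl, mulmxN, mulNmx) -!mulmxA Omega_sqr.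
  by rewrite !mulmxN mulmx1; mx_abel.
- rewrite !trB !trmx_mul tA tD !(mulmxBr, mulmxN, mulNmx) -!mulmxA !Omega_mulK.
  by mx_abel.
rewrite !trB !trmx_mul tD !(mulmxBr, mulmxBl, mulmxN, mulNmx) -!mulmxA !Omega_mulK.
by rewrite Omega_sqr !mulmxN mulmx1; mx_abel.
Qed.

(* [osp_inv] in the eigenbasis of the torus: it permutes the matrix units up to scalars. *)
Definition osp_inv_coef (i j : 'I_(m + (n + n))) : C :=
  match split i, split j with
  | inl _, inl _ => - 1
  | inl _, inr b => 'i * sg_sp C b
  | inr a, inl _ => 'i * sg_sp C a
  | inr a, inr b => - (sg_sp C a * sg_sp C b)
  end.

Lemma osp_inv_coef_neq0 i j : osp_inv_coef i j != 0.
Proof.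
have sg0 a : sg_sp C a != 0 :> C.
  by have := oner_neq0 C; rewrite -(sg_sp_sqr C a) mulf_eq0 orbb.
rewrite /osp_inv_coef; case: split => a; case: split => b;
by rewrite ?oppr_eq0 ?mulf_neq0 ?oppr_eq0 ?oner_neq0 ?neq0Ci.
Qed.

Definition osp_inv_mx x : M :=
  \matrix_(i, j) (osp_inv_coef i j * x (pt_osp j) (pt_osp i)).

(** Transposition fixes P and its inverse V, both symmetric. The products P Pi, Pi V, S Pi V and P S
    Pi are multiples of V, P, V S and S P, which lets the base change pass through each block. *)
Lemma osp_inv_conj x :
  osp_inv (osp_basis C m n *m x *m osp_basis_inv C m n)
  = osp_basis C m n *m osp_inv_mx x *m osp_basis_inv C m n.
Proof.
pose P1 := pair_basis C (@pt_so m); pose V1 := pair_basis_inv C (@pt_so m).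
pose P2 := pair_basis C (@pt_sp n); pose V2 := pair_basis_inv C (@pt_sp n).
pose Pi1 := pair_mx C (@pt_so m); pose Pi2 := pair_mx C (@pt_sp n).
pose S := sgn_mx (@sg_sp C n).
have K1 := @pt_soK m; have K2 := @pt_spK n; have s2 := @sg_pt_sp C n.
have -> : osp_inv_mx x = block_mx
   (- (Pi1 *m (ulsubmx x)^T *m Pi1)) (- 'i *: (Pi1 *m (dlsubmx x)^T *m S *m Pi2))
   ('i *: (S *m Pi2 *m (ursubmx x)^T *m Pi1)) (- (Pi2 *m S *m (drsubmx x)^T *m S *m Pi2)).
  apply/matrixP => i j; rewrite mxE /osp_inv_coef.
  case: (split_ordP i) => a ->; case: (split_ordP j) => b ->;
  rewrite !ospE !(block_mxEul, block_mxEur, block_mxEdl, block_mxEdr).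
  - rewrite mulN1r.
    by rewrite /Pi1 mul_mx_pair // mul_pair_mx !mxE.
  - by rewrite [RHS]mxE /Pi2 mul_mx_pair // mxE mul_mx_diag mxE mul_pair_mx !mxE s2; ring.
  - rewrite [RHS]mxE /Pi1 mul_mx_pair // mxE -mulmxA mul_diag_mx mxE mul_pair_mx !mxE.
    by ring.
  rewrite [RHS]mxE /Pi2 mul_mx_pair // mxE mul_mx_diag mxE -!mulmxA mul_pair_mx mxE.
  by rewrite mul_diag_mx !mxE !s2; ring.
rewrite -[x in LHS]submxK !mulmx_block !(mul0mx, mulmx0, addr0, add0r) osp_inv_block.
move: (ulsubmx x) (ursubmx x) (dlsubmx x) (drsubmx x) => A B D E.
have tP1 : P1^T = P1 by apply: tr_basis.
have tP2 : P2^T = P2 by apply: tr_basis.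
have tV1 : V1^T = V1 by apply: tr_basis_inv.
have tV2 : V2^T = V2 by apply: tr_basis_inv.
have PP1 : P1 *m Pi1 = (- (2 * 'i)) *: V1 by apply: basis_pair.
have VP1 : Pi1 *m V1 = (2^-1 * 'i) *: P1 by apply: pair_inv.
have VP2 : Pi2 *m V2 = (2^-1 * 'i) *: P2 by apply: pair_inv.
have SV : S *m Pi2 *m V2 = 'i *: (V2 *m S) by apply: sgn_pair_inv.
have PS : P2 *m S *m Pi2 = 'i *: (S *m P2) by apply: basis_sgn_pair.
have SP : S *m P2 = 2 *: (V2 *m S) by apply: sgn_basis_inv.
have PiS : Pi2 *m S = - (S *m Pi2) by apply: pair_sgn.
have c1 : - (2 * 'i) * (2^-1 * 'i) = 1 :> C.
  by rewrite mulNr mulrACA divff ?pnatr_eq0 // mul1r -expr2 sqrCi opprK.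
have i2 : 'i * 'i = - 1 :> C by rewrite -expr2 sqrCi.
have t2 : 2^-1 * 2 = 1 :> C by rewrite mulVf ?pnatr_eq0.
rewrite !trmx_mul OmegaE -/S -/Pi2 -/P1 -/P2 -/V1 -/V2 tP1 tP2 tV1 tV2.
clearbody P1 V1 P2 V2 Pi1 Pi2 S; congr block_mx.
- have -> : P1 *m - (Pi1 *m A^T *m Pi1) *m V1 = - ((P1 *m Pi1) *m A^T *m (Pi1 *m V1)).
    by rewrite mulmxN mulNmx !mulmxA.
  by rewrite PP1 VP1 -!scalemxAl -scalemxAr scalerA c1 scale1r mulmxA.
- have -> : P1 *m (- 'i *: (Pi1 *m D^T *m S *m Pi2)) *m V2
      = - 'i *: ((P1 *m Pi1) *m D^T *m (S *m Pi2 *m V2)).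
    by rewrite -scalemxAr -scalemxAl !mulmxA.
  rewrite PP1 SV -!scalemxAl -scalemxAr !scalerA.
  have -> : V1 *m D^T *m (V2 *m S) = 2^-1 *: (V1 *m D^T *m (S *m P2)).
    by rewrite SP -scalemxAr scalerA mulVf ?scale1r ?pnatr_eq0.
  have -> : V1 *m (D^T *m P2) *m (S *m Pi2) = 'i *: (V1 *m D^T *m (S *m P2)).
    by rewrite -!mulmxA (mulmxA P2) PS -!scalemxAr.
  rewrite scalerA -scaleNr; congr (_ *: _).
  (* [ring] knows neither the square of ['i] nor the inverse of 2; the scalar is regrouped so that
     [i2] and [t2] apply. *)
  transitivity (('i * 'i) * 'i * (2^-1 * 2) : C); [rewrite i2 t2; ring | ring].
- have -> : P2 *m ('i *: (S *m Pi2 *m B^T *m Pi1)) *m V1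
      = 'i *: ((P2 *m S *m Pi2) *m B^T *m (Pi1 *m V1)).
    by rewrite -scalemxAr -scalemxAl !mulmxA.
  rewrite PS VP1 SP -!scalemxAl -scalemxAr !scalerA.
  have -> : S *m Pi2 *m (V2 *m (B^T *m P1)) = 'i *: (V2 *m S *m B^T *m P1).
    by rewrite mulmxA SV -scalemxAl !mulmxA.
  rewrite -scaleNr; congr (_ *: _).
  transitivity (('i * 'i) * 'i * (2^-1 * 2) : C); [rewrite i2 t2; ring | ring].
have -> : P2 *m - (Pi2 *m S *m E^T *m S *m Pi2) *m V2
    = (P2 *m S *m Pi2) *m E^T *m (S *m Pi2 *m V2).
  by rewrite PiS !(mulmxN, mulNmx) opprK !mulmxA.
have -> : S *m Pi2 *m (V2 *m (E^T *m P2)) *m (S *m Pi2)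
    = (S *m Pi2 *m V2) *m E^T *m (P2 *m S *m Pi2).
  by rewrite !mulmxA.
by rewrite PS SV SP !scalerA -!(scalemxAl, scalemxAr) !scalerA [in LHS]mulrC.
Qed.
End OspInvolution.

(** * Weights coming in opposite pairs *)

Section PairedWeights.
Variables (C : numClosedFieldType) (g : lieSuperalgebra C) (h : {vspace g}).
Variables (N : nat) (pt : 'I_N -> 'I_N) (lam : 'I_N -> weight h).
Hypothesis ptK : involutive pt.
Hypothesis lam_pt : forall i, lam (pt i) = - lam i.
Hypothesis pt_fixed : forall i j, pt i = i -> pt j = j -> i = j.
Hypothesis lam_dual : forall a, exists H, forall j,
  wt (lam j) H = (j == a)%:R - (j == pt a)%:R.

(** At the element of h dual to i the left-hand side is positive, so k or l has to contribute to the
    right-hand side. *)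
Lemma paired_sum_mem i j k l : pt i != i -> j != pt i ->
  lam i + lam j = lam k + lam l -> (k == i) || (l == i).
Proof.
move=> ii ji /(congr1 (fun al : weight h => wt al)) E.
have [H HE] := lam_dual i; have := congr1 (@^~ H) E.
rewrite !wtD !HE eqxx (eq_sym i) (negPf ii) (negPf ji) !subr0 => /eqP.
rewrite addrACA -opprD eq_sym subr_eq -!natrD eqr_nat.
by case: (k == i); case: (l == i).
Qed.

Lemma paired_lam_inj : injective lam.
Proof.
suff inj i j : pt i != i -> lam i = lam j -> i = j.
  move=> i j Eij; have [ii|] := eqVneq (pt i) i; last by move/inj; apply.
  have [jj|] := eqVneq (pt j) j; first exact: pt_fixed.
  by move/inj => /(_ i (esym Eij)).
move=> ii /(congr1 (fun al : weight h => wt al)) E.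
have [H HE] := lam_dual i; have := congr1 (@^~ H) E.
rewrite !HE eqxx (eq_sym i) (negPf ii) subr0 => /eqP; rewrite eq_sym subr_eq.
by rewrite -(natrD _ 1) eqr_nat; case: (eqVneq j i).
Qed.

(** At a fixed point of pt the dual element sees nothing. If i is one, the argument starts from j,
    which cannot be fixed as well because pt has at most one fixed point. *)
Lemma paired_sum_inj i j k l : j != pt i -> lam i + lam j = lam k + lam l ->
  (k, l) = (i, j) \/ (k, l) = (j, i).
Proof.
suff main i' j' k' l' : pt i' != i' -> j' != pt i' ->
    lam i' + lam j' = lam k' + lam l' -> (k', l') = (i', j') \/ (k', l') = (j', i').
  move=> ji E; have [ii|ii] := eqVneq (pt i) i; last exact: main.
  have [jj|jj] := eqVneq (pt j) j.
    by case/eqP: ji; rewrite ii; apply: pt_fixed.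
  have ij : i != pt j by rewrite -(inj_eq (inv_inj ptK)) ptK eq_sym.
  rewrite addrC in E; case: (main j i k l jj ij E) => [[-> ->]|[-> ->]]; by [right|left].
move=> ii ji E; have /orP[/eqP k'i|/eqP l'i] := paired_sum_mem ii ji E.
  by left; move: E; rewrite k'i => /addrI/paired_lam_inj->.
right; move: E; rewrite l'i [RHS]addrC => /addrI/paired_lam_inj->; by [].
Qed.

(** A difference is the sum lam i + lam (pt j). The two pairs of indices allowed are those of the
    matrix units that [osp_inv] exchanges up to a scalar. *)
Lemma paired_diff_inj i j k l : i != j -> lam i - lam j = lam k - lam l ->
  (k, l) = (i, j) \/ (k, l) = (pt j, pt i).
Proof.
rewrite -!lam_pt => ij /paired_sum_inj -[].
- by rewrite (inj_eq (inv_inj ptK)) eq_sym.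
- by case=> -> /(inv_inj ptK) ->; left.
by case=> -> <-; rewrite ptK; right.
Qed.

(** Sorting the indices selects one representative of each unordered pair. *)
Lemma paired_sum_sorted (L : seq ('I_N * 'I_N)) :
  (forall p, p \in L -> p.2 != pt p.1) -> (forall p, p \in L -> (p.1 <= p.2)%N) ->
  uniq L -> uniq [seq lam p.1 + lam p.2 | p <- L].
Proof.
move=> Lpt Lle; rewrite map_inj_in_uniq // => -[i j] [k l] Lij Lkl /= E.
case: (paired_sum_inj (Lpt _ Lij) E) => // -[Ek El]; rewrite Ek El in Lkl *.
have /= ij := Lle _ Lij; have /= ji := Lle _ Lkl.
by have /val_inj-> : i = j :> nat by apply/eqP; rewrite eqn_leq ij ji.
Qed.
End PairedWeights.

Lemma uniq_cat_key (T K : eqType) (key : T -> K) (a : K) (s t : seq T) :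
  (forall x, x \in s -> key x = a) -> (forall x, x \in t -> key x != a) ->
  uniq s -> uniq t -> uniq (s ++ t).
Proof.
move=> sa ta us ut; rewrite cat_uniq us ut andbT /=; apply/hasPn => x /ta.
by apply: contraNN => /sa->.
Qed.

Section OspWeights.
Variables (C : numClosedFieldType) (m n : nat).

Lemma pt_osp_fixed i j : pt_osp i = i -> pt_osp j = j -> i = j :> 'I_(m + (n + n)).
Proof.
case: (split_ordP i) => a ->; case: (split_ordP j) => b ->; rewrite !ospE.
- move=> /lshift_inj/(congr1 val) /= Ea /lshift_inj/(congr1 val) /= Eb.
  congr lshift; apply: val_inj => /=; move: Ea Eb; rewrite /pt_so_nat.
  by case: a b => a am [b bm] /=; do 4?case: ifP; lia.
- move=> _ /rshift_inj; case: (split_ordP b) => c ->; rewrite !spE => /eqP.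
    by rewrite eq_rlshift. by rewrite eq_lrshift.
- move=> /rshift_inj; case: (split_ordP a) => c ->; rewrite !spE => /eqP.
    by rewrite eq_rlshift. by rewrite eq_lrshift.
move=> /rshift_inj; case: (split_ordP a) => c ->; rewrite !spE => /eqP.
  by rewrite eq_rlshift. by rewrite eq_lrshift.
Qed.

Lemma lam_osp_linear i : linear_for *%R ((@lam_osp C m n)^~ i).
Proof.
move=> c [t d] [t' d']; case: (split_ordP i) => a ->; rewrite !ospE /=.
  rewrite /tau_so !mulr_sumr -big_split /=.
  by apply: eq_bigr => k _; rewrite !mxE; ring.
rewrite /tau_sp; case: (split_ordP a) => b ->; rewrite !(row_mxEl, row_mxEr) !mxE;
by ring.
Qed.

Lemma lam_osp_dual (a : 'I_(m + (n + n))) : exists td, forall j,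
  lam_osp td j = (j == a)%:R - (j == pt_osp a)%:R :> C.
Proof.
case: (split_ordP a) => {}a ->.
  (* The factor [sg_so C a] makes the eigenvalue at a equal to 1. For the fixed index of odd m it is
     0, in agreement with a = pt a. *)
  exists (\row_k (sg_so C a * (k == a./2 :> nat)%:R), 0) => j.
  case: (split_ordP j) => b ->; rewrite !ospE /=; last first.
    by rewrite /tau_sp !eq_rlshift; case: (split_ordP b) => c ->;
      rewrite !(row_mxEl, row_mxEr) mxE mulr0 subrr.
  rewrite !eq_lshift; have -> : tau_so (\row_k (sg_so C a * (k == a./2 :> nat)%:R)) b
      = sg_so C a * ((a./2 == b./2) && (a./2 < m./2)%N)%:R.
    rewrite /tau_so; have [lt|ge] := ltnP a./2 m./2.
      rewrite (bigD1 (Ordinal lt)) //= mxE /= eqxx mulr1 andbT big1 ?addr0 // => k.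
      by rewrite -(inj_eq val_inj) /= => /negPf nk; rewrite mxE nk mulr0 mul0r.
    rewrite big1 ?andbF ?mulr0 // => k _; rewrite mxE.
    by rewrite (_ : k == a./2 :> nat = false) ?mulr0 ?mul0r //; have := ltn_ord k; lia.
  rewrite -!(inj_eq val_inj) /= /sg_so /pt_so_nat.
  case: a b => a am [b bm] /=; case: (boolP (odd a)) => oa.
    have -> : (a./2 == b./2) && (a./2 < m./2)%N = (b == a) || (b == a.-1) by lia.
    case: (eqVneq b a) => [->|ba]; first by rewrite oa (_ : a == a.-1 = false) /=; [ring|lia].
    case: (eqVneq b a.-1) => [E|_] /=; last by ring.
    rewrite (_ : odd b = false); last by lia.
    rewrite (_ : (b.+1 < m)%N); last by lia.
    by rewrite /=; ring.
  case: (boolP (a.+1 < m)%N) => am1; last first.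
    by rewrite subrr !(mul0r, mulr0).
  have -> : (a./2 == b./2) && (a./2 < m./2)%N = (b == a) || (b == a.+1) by lia.
  case: (eqVneq b a) => [->|ba].
    by rewrite (negPf oa) am1 (_ : a == a.+1 = false) /=; [ring|lia].
  case: (eqVneq b a.+1) => [->|_] /=; last by ring.
  by rewrite oa /=; ring.
case: (split_ordP a) => {}a ->.
  exists (0, delta_mx 0 a) => j; case: (split_ordP j) => b ->; rewrite !ospE.
    by rewrite !eq_lrshift subrr /tau_so big1 ?mulr0 // => k _; rewrite mxE mul0r.
  rewrite !eq_rshift /tau_sp; case: (split_ordP b) => c ->;
    rewrite !spE !(row_mxEl, row_mxEr) mxE;
  by rewrite ?eq_lshift ?eq_rshift ?eq_lrshift ?eq_rlshift /=; ring.
exists (0, - delta_mx 0 a) => j; case: (split_ordP j) => b ->; rewrite !ospE.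
  by rewrite !eq_lrshift subrr /tau_so big1 ?mulr0 // => k _; rewrite mxE mul0r.
rewrite !eq_rshift /tau_sp; case: (split_ordP b) => c ->;
  rewrite !spE !(row_mxEl, row_mxEr) !mxE;
by rewrite ?eq_lshift ?eq_rshift ?eq_lrshift ?eq_rlshift /=; ring.
Qed.
End OspWeights.

Section OspPositive.
Variables (C : numClosedFieldType) (m n : nat) (g : lieSuperalgebra C) (h : {vspace g}).
Variable lam : 'I_(m + (n + n)) -> weight h.
Hypothesis lam_pt : forall i, lam (pt_osp i) = - lam i.
Hypothesis lam_dual : forall a, exists H, forall j,
  wt (lam j) H = (j == a)%:R - (j == pt_osp a)%:R.

Lemma eps_idx_lt (i : 'I_(m./2)) : (i.*2 < m)%N.
Proof. by have := ltn_ord i; lia. Qed.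
Definition eps_idx (i : 'I_(m./2)) : 'I_(m + (n + n)) :=
  lshift (n + n) (Ordinal (eps_idx_lt i)).
Definition delta_idx (a : 'I_n) : 'I_(m + (n + n)) := rshift m (lshift n a).

Definition osp_pos (eps : 'I_(m./2) -> weight h) (del : 'I_n -> weight h) :=
  [seq del p.1 + del p.2 | p <- ltpairs n]
  ++ [seq del p.1 - del p.2 | p <- ltpairs n]
  ++ [seq 2 *: del a | a <- enum 'I_n]
  ++ [seq eps p.1 + eps p.2 | p <- ltpairs m./2]
  ++ [seq eps p.1 - eps p.2 | p <- ltpairs m./2]
  ++ (if odd m then [seq eps i | i <- enum 'I_(m./2)] else [::]).

Lemma pt_eps_idx i : pt_osp (eps_idx i) = i.*2.+1 :> nat.
Proof.
by rewrite /eps_idx ospE /= /pt_so_nat odd_double; have := ltn_ord i; case: ifP => //; lia.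
Qed.
Lemma pt_delta_idx a : pt_osp (delta_idx a) = (m + (n + a))%N :> nat.
Proof. by rewrite /delta_idx ospE spE. Qed.

(** Classes 0 and 1 are the two members of an orthogonal pair, 2 the unpaired index, 3 and 4 the two
    symplectic halves. *)
Definition idx_class (i : 'I_(m + (n + n))) : nat :=
  if (i < m)%N then if odd i then 1 else if (i.+1 < m)%N then 0 else 2
  else if (i < m + n)%N then 3 else 4.

(** Every listed root is lam p.1 + lam p.2 for a sorted pair: a difference uses pt, 2 delta repeats
    an index, and eps alone is completed by the middle index of weight 0. The six blocks are told
    apart by [key], whose last entry separates 2 delta_a from delta_a + delta_b. *)
Lemma uniq_osp_pos : (0 < n)%N ->
  uniq (osp_pos (fun i => lam (eps_idx i)) (fun a => lam (delta_idx a))).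
Proof.
(* With n > 0 the index m.-1 is legal even for m = 0; it is the unpaired index only when m is
   odd. *)
move=> n0; have m0 : (m.-1 < m + (n + n))%N by lia.
pose mid : 'I_(m + (n + n)) := Ordinal m0.
pose L :=
  [seq (delta_idx p.1, delta_idx p.2) | p <- ltpairs n]
  ++ [seq (delta_idx p.1, pt_osp (delta_idx p.2)) | p <- ltpairs n]
  ++ [seq (delta_idx a, delta_idx a) | a <- enum 'I_n]
  ++ [seq (eps_idx p.1, eps_idx p.2) | p <- ltpairs m./2]
  ++ [seq (eps_idx p.1, pt_osp (eps_idx p.2)) | p <- ltpairs m./2]
  ++ (if odd m then [seq (eps_idx i, mid) | i <- enum 'I_(m./2)] else [::]).
have dE a : delta_idx a = (m + a)%N :> nat by [].
have eE i : eps_idx i = i.*2 :> nat by [].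
have lam_mid : odd m -> lam mid = 0.
  move=> om; have E : pt_osp mid = mid.
    have lt : (m.-1 < m)%N by lia.
    rewrite (_ : mid = lshift (n + n) (Ordinal lt)); last exact: val_inj.
    rewrite ospE; congr lshift; apply: val_inj; rewrite /= /pt_so_nat.
    by do !case: ifP; lia.
  apply/lfunP => H; rewrite zero_lfunE -/(wt (lam mid) H).
  have /(congr1 (fun al => wt al H)) := lam_pt mid; rewrite E wtN => /eqP.
  by rewrite -subr_eq0 opprK -mulr2n mulrn_eq0 => /eqP.
have -> : osp_pos (fun i => lam (eps_idx i)) (fun a => lam (delta_idx a))
    = [seq lam p.1 + lam p.2 | p <- L].
  rewrite /osp_pos /L; move: (enum 'I_n) (enum 'I_(m./2)) (ltpairs n) (ltpairs _) =>
    r1 r2 r3 r4.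
  rewrite !map_cat -!map_comp; congr (_ ++ (_ ++ (_ ++ (_ ++ (_ ++ _))))).
  - by apply: eq_map => p /=; rewrite lam_pt.
  - by apply: eq_map => p /=; rewrite scaler_nat mulr2n.
  - by apply: eq_map => p /=; rewrite lam_pt.
  by case: ifP => // om; rewrite -map_comp; apply: eq_map => i /=; rewrite lam_mid ?addr0.
have lt2 k (p : 'I_k * 'I_k) : p \in ltpairs k -> (p.1 < p.2)%N.
  by rewrite mem_filter => /andP[].
have ltm (i : 'I_(m./2)) : (i.*2.+1 < m)%N by have := ltn_ord i; lia.
have cE i : idx_class (eps_idx i) = 0%N.
  by rewrite /idx_class eE odd_double ltm (ltn_trans _ (ltm i)).
have cpE i : idx_class (pt_osp (eps_idx i)) = 1%N.
  by rewrite /idx_class pt_eps_idx ltm /= odd_double.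
have cD a : idx_class (delta_idx a) = 3%N.
  by rewrite /idx_class dE ltnNge leq_addr /= ltn_add2l ltn_ord.
have cpD a : idx_class (pt_osp (delta_idx a)) = 4%N.
  by rewrite /idx_class pt_delta_idx ltnNge leq_addr /= ltn_add2l ltnNge leq_addr.
have cM : odd m -> idx_class mid = 2%N.
  by move=> om; rewrite /idx_class /=; do !case: ifP; lia.
have pI := inv_inj (@pt_ospK m n).
have LP p : p \in L -> (p.2 != pt_osp p.1) && (p.1 <= p.2)%N.
  have ne (i j : 'I_(m + (n + n))) : i <> j :> nat -> i != j.
    by move=> ij; apply: contra_notN ij => /eqP->.
  rewrite !mem_cat => /or4P[||/mapP[a _ ->]|/or3P[||]];
    try (move=> /mapP[[[q1 q1n] [q2 q2n]] /lt2 /= qq ->]).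
  - by apply/andP; split; [apply: ne|]; rewrite /= ?pt_delta_idx ?dE /=; lia.
  - by apply/andP; split; [rewrite (inj_eq pI); apply: ne|]; rewrite /= ?pt_delta_idx ?dE /=;
    lia.
  - by apply/andP; split; [apply: ne|]; rewrite /= ?pt_delta_idx ?dE /=; have := ltn_ord a; lia.
  - by apply/andP; split; [apply: ne|]; rewrite /= ?pt_eps_idx ?eE /=; lia.
  - by apply/andP; split; [rewrite (inj_eq pI); apply: ne|]; rewrite /= ?pt_eps_idx ?eE /=; lia.
  case: ifP => // om /mapP[i _ ->]; have := ltn_ord i.
  by move=> im; apply/andP; split; [apply: ne|]; rewrite /= ?pt_eps_idx ?eE /=; lia.
apply: (paired_sum_sorted (@pt_ospK m n) (@pt_osp_fixed m n) lam_dual).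
- by move=> p /LP/andP[].
- by move=> p /LP/andP[].
pose key (p : 'I_(m + (n + n)) * 'I_(m + (n + n))) :=
  (idx_class p.1, idx_class p.2, p.1 == p.2).
have dI : injective delta_idx by move=> a b /rshift_inj/lshift_inj.
have eI : injective eps_idx.
  by move=> a b /(congr1 val) /= E; apply: val_inj => /=; lia.
have kne (i j : 'I_(m + (n + n))) : (i < j)%N -> (i == j) = false.
  by move=> ij; apply: contraTF ij => /eqP->; rewrite ltnn.
have k1 p : p \in [seq (delta_idx p.1, delta_idx p.2) | p <- ltpairs n]
  -> key p = (3, 3, false)%N.
  by move=> /mapP[q /lt2 qq ->]; rewrite /key /= !cD (inj_eq dI) -(inj_eq val_inj) ltn_eqF.
have k2 p : p \in [seq (delta_idx p.1, pt_osp (delta_idx p.2)) | p <- ltpairs n]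
  -> key p = (3, 4, false)%N.
  move=> /mapP[q /lt2 qq ->]; rewrite /key /= cD cpD kne // dE pt_delta_idx.
  by have := ltn_ord q.1; lia.
have k3 p : p \in [seq (delta_idx a, delta_idx a) | a <- enum 'I_n] -> key p = (3, 3, true)%N.
  by move=> /mapP[a _ ->]; rewrite /key /= cD eqxx.
have k4 p : p \in [seq (eps_idx p.1, eps_idx p.2) | p <- ltpairs m./2]
  -> key p = (0, 0, false)%N.
  by move=> /mapP[q /lt2 qq ->]; rewrite /key /= !cE (inj_eq eI) -(inj_eq val_inj) ltn_eqF.
have k5 p : p \in [seq (eps_idx p.1, pt_osp (eps_idx p.2)) | p <- ltpairs m./2]
  -> key p = (0, 1, false)%N.
  by move=> /mapP[q /lt2 qq ->]; rewrite /key /= cE cpE kne // eE pt_eps_idx; lia.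
have k6 p : p \in (if odd m then [seq (eps_idx i, mid) | i <- enum 'I_(m./2)] else [::]) ->
  key p = (0, 2, false)%N.
  case: ifP => // om /mapP[i _ ->]; rewrite /key /= cE cM // kne // eE /=.
  by have := ltm i; lia.
apply: (uniq_cat_key (key := key) k1) => [p||].
- by rewrite !mem_cat => /orP[/k2|/or4P[/k3|/k4|/k5|/k6]] ->.
- rewrite map_inj_uniq ?uniq_ltpairs // => -[a b] [c d] /eqP.
  by rewrite xpair_eqE /= !(inj_eq dI) => /andP[/eqP-> /eqP->].
apply: (uniq_cat_key (key := key) k2) => [p||].
- by rewrite !mem_cat => /or4P[/k3|/k4|/k5|/k6] ->.
- rewrite map_inj_uniq ?uniq_ltpairs // => -[a b] [c d] /eqP.
  by rewrite xpair_eqE /= (inj_eq pI) !(inj_eq dI) => /andP[/eqP-> /eqP->].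
apply: (uniq_cat_key (key := key) k3) => [p||].
- by rewrite !mem_cat => /or3P[/k4|/k5|/k6] ->.
- rewrite map_inj_uniq ?enum_uniq // => a b /eqP.
  by rewrite xpair_eqE (inj_eq dI) andbb => /eqP.
apply: (uniq_cat_key (key := key) k4) => [p||].
- by rewrite !mem_cat => /orP[/k5|/k6] ->.
- rewrite map_inj_uniq ?uniq_ltpairs // => -[a b] [c d] /eqP.
  by rewrite xpair_eqE /= !(inj_eq eI) => /andP[/eqP-> /eqP->].
apply: (uniq_cat_key (key := key) k5) => [p||].
- by move=> /k6 ->.
- rewrite map_inj_uniq ?uniq_ltpairs // => -[a b] [c d] /eqP.
  by rewrite xpair_eqE /= (inj_eq pI) !(inj_eq eI) => /andP[/eqP-> /eqP->].
case: ifP => // _; rewrite map_inj_uniq ?enum_uniq // => a b /eqP.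
by rewrite xpair_eqE (inj_eq eI) eqxx andbT => /eqP.
Qed.
End OspPositive.

Lemma osp_torus_linear (C : numClosedFieldType) m n : linear (@osp_torus C m n).
Proof.
move=> c td td'; rewrite !osp_torusE scalemxAl scalemxAr -mulmxDl -mulmxDr.
congr (_ *m _ *m _); rewrite -linearP /=; congr diag_mx; apply/rowP => i.
by rewrite !mxE lam_osp_linear.
Qed.

Section OspConjugation.
Variables (C : numClosedFieldType) (m n : nat).
Local Notation P := (osp_basis C m n).
Local Notation Pv := (osp_basis_inv C m n).
Local Notation gl_part := (gl_part C m (n + n)).

Lemma block_diag_part (A : 'M[C]_m) (D : 'M[C]_(n + n)) : block_mx A 0 0 D \in gl_part false.
Proof. by rewrite gl_partE /= block_mxKur block_mxKdl block_mx0. Qed.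

Lemma osp_conj_part a x : x \in gl_part a -> P *m x *m Pv \in gl_part a.
Proof.
move=> xa; rewrite -[a]addFb -[false (+) a]addbF.
by apply: mulmx_part (block_diag_part _ _); apply: mulmx_part xa; apply: block_diag_part.
Qed.

Lemma osp_conj_mul x y : P *m x *m Pv *m (P *m y *m Pv) = P *m (x *m y) *m Pv.
Proof. by rewrite !mulmxA -(mulmxA _ Pv P) osp_basis_Kinv mulmx1 -(mulmxA P x y). Qed.

Lemma osp_conjK x : Pv *m (P *m x *m Pv) *m P = x.
Proof. by rewrite !mulmxA osp_basis_Kinv mul1mx -mulmxA osp_basis_Kinv mulmx1. Qed.

Lemma osp_torus_br td i j :
  gl_br (osp_torus td) (P *m delta_mx i j *m Pv)
  = (lam_osp td i - lam_osp td j) *: (P *m delta_mx i j *m Pv).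
Proof.
rewrite osp_torusE (gl_brE (osp_conj_part (diag_part _)) (osp_conj_part (delta_mx_part _ i j))).
rewrite !osp_conj_mul /= scale1r -mulmxBl -mulmxBr.
have := gl_br_diag (\row_i lam_osp td i) i j.
rewrite (gl_brE (diag_part _) (delta_mx_part _ i j)) /= scale1r => ->.
by rewrite !mxE -scalemxAr -scalemxAl.
Qed.

Lemma osp_torus_comm td td' : osp_torus td *m osp_torus td' = osp_torus td' *m osp_torus td :>
  'M[C]_(m + (n + n)).
Proof. by rewrite !osp_torusE !osp_conj_mul diag_mxC. Qed.

Lemma osp_torus_part td : osp_torus td \in gl_part false.
Proof. exact: block_diag_part. Qed.

(** After conjugation to diagonal form the coordinates are the eigenvalues at [eps_idx] and
    [delta_idx]. *)
Lemma osp_torus_inj : injective (@osp_torus C m n).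
Proof.
move=> [t d] [t' d'] E.
have {}E : forall i, lam_osp (t, d) i = lam_osp (t', d') i.
  move=> i; have /(congr1 (fun X => Pv *m X *m P)) := E; rewrite !osp_torusE !osp_conjK.
  by move=> /matrixP/(_ i i); rewrite !mxE eqxx !mulr1n.
congr (_, _); apply/rowP => k.
  have := E (eps_idx n k); rewrite /eps_idx !ospE /=.
  have lt := ltn_ord k.
  rewrite /sg_so /= odd_double (_ : (k.*2.+1 < m)%N) ?mul1r; last by lia.
  have T u : tau_so u (Ordinal (eps_idx_lt k)) = u 0 k :> C.
    rewrite /tau_so (bigD1 k) //= doubleK eqxx mulr1 big1 ?addr0 // => l.
    by rewrite -(inj_eq val_inj) /= => /negPf->; rewrite mulr0.
  by rewrite !T.
have := E (delta_idx m k); rewrite /delta_idx !ospE !spE !mul1r /= /tau_sp.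
by rewrite !row_mxEl.
Qed.
End OspConjugation.

(** * Root vectors common to osp(m|2n) and the even part of F(4) *)

Section OspFamily.
Variables (C : numClosedFieldType) (m n : nat) (g : lieSuperalgebra C) (h : {vspace g}).
Variables (coord : subvs_of h -> 'rV[C]_(m./2) * 'rV[C]_n).
Variable emb : {linear 'M[C]_(m + (n + n)) -> g}.
Hypothesis coord_lin : linear coord.
Hypothesis coordK : forall H, emb (osp_torus (coord H)) = vsval H.
Hypothesis torus_in : forall td, emb (osp_torus td) \in h.
Hypothesis coord_torus : forall td, coord (vsproj h (emb (osp_torus td))) = td.
Hypothesis emb_br : forall td x,
  ls_br (emb (osp_torus td)) (emb x) = emb (gl_br (osp_torus td) x).
Hypothesis emb_inv : forall x, emb (osp_inv x) = emb x.
Hypothesis emb_part : forall a x, x \in gl_part C m (n + n) a -> emb x \in ls_part g a.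
Local Notation P := (osp_basis C m n).
Local Notation Pv := (osp_basis_inv C m n).

Definition osp_lam (i : 'I_(m + (n + n))) : weight h :=
  linfun (fun H : subvs_of h => lam_osp (coord H) i : C^o).

Lemma osp_lamE i H : wt (osp_lam i) H = lam_osp (coord H) i.
Proof.
rewrite /wt /osp_lam linfunE // => a H1 H2; rewrite coord_lin.
exact: lam_osp_linear.
Qed.

Lemma osp_lam_pt i : osp_lam (pt_osp i) = - osp_lam i.
Proof.
apply/lfunP => H; rewrite opp_lfunE -!/(wt _ _) !osp_lamE; exact: lam_osp_pt.
Qed.

Lemma osp_lam_dual a : exists H, forall j,
  wt (osp_lam j) H = (j == a)%:R - (j == pt_osp a)%:R.
Proof.
have [td tdE] := lam_osp_dual C a; exists (vsproj h (emb (osp_torus td))) => j.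
by rewrite osp_lamE coord_torus.
Qed.

Lemma osp_emb_linear : linear (fun x => emb (P *m x *m Pv)).
Proof. by move=> c x y; rewrite mulmxDr mulmxDl -scalemxAr -scalemxAl linearP. Qed.
Definition osp_emb : {linear 'M[C]_(m + (n + n)) -> g} :=
  HB.pack (fun x => emb (P *m x *m Pv))
    (GRing.isLinear.Build _ _ _ _ (fun x => emb (P *m x *m Pv)) osp_emb_linear).

Lemma osp_emb_wt i j (H : subvs_of h) :
  ls_br (vsval H) (osp_emb (delta_mx i j))
  = wt (osp_lam i - osp_lam j) H *: osp_emb (delta_mx i j).
Proof.
rewrite -coordK /= emb_br osp_torus_br wtD wtN !osp_lamE linearZ /=.
by [].
Qed.

Lemma osp_emb_part i j : osp_emb (delta_mx i j) \in ls_part g (idx_odd i (+) idx_odd j).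
Proof. exact/emb_part/osp_conj_part/delta_mx_part. Qed.

(** [emb] does not distinguish x from [osp_inv x], and in the eigenbasis [osp_inv] takes a matrix
    unit to a multiple of another. *)
Lemma osp_emb_delta i j :
  osp_emb (delta_mx i j)
  = osp_inv_coef C (pt_osp j) (pt_osp i) *: osp_emb (delta_mx (pt_osp j) (pt_osp i)).
Proof.
rewrite /= -emb_inv osp_inv_conj -linearZ /= scalemxAl scalemxAr; congr (emb (_ *m _ *m _)).
apply/matrixP => k l; rewrite !mxE !(pt_eq (@pt_ospK m n)) andbC.
have [<-|_] := eqVneq (pt_osp k) j; last by rewrite !mulr0.
by have [<-|_] := eqVneq (pt_osp l) i; rewrite ?mulr0 // !pt_ospK.
Qed.

Lemma osp_lam_inj : injective osp_lam.
Proof. exact: paired_lam_inj (@pt_osp_fixed m n) osp_lam_dual. Qed.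

Lemma osp_family_in z p : mx_root_vec osp_emb z p \in root_space z (osp_lam p.1 - osp_lam p.2).
Proof. exact: (mx_root_vec_in osp_emb_wt osp_emb_part). Qed.

Lemma osp_family_span z : (forall Y, Y \in ls_part g z -> exists x, Y = emb x) ->
  (ls_part g z <= \sum_p <[mx_root_vec osp_emb z p]>)%VS.
Proof.
move=> onto; apply: (mx_root_vec_span osp_emb_wt osp_emb_part) => Y /onto[x ->].
exists (Pv *m x *m P); rewrite /= !mulmxA osp_basis_invK mul1mx.
by rewrite -mulmxA osp_basis_invK mulmx1.
Qed.

(** Weight 0 forces equal indices. Twice the image of the diagonal unit at i is the image of the
    difference of the units at i and pt i, and that difference is the torus element dual to i. *)
Lemma osp_family0 z p : osp_lam p.1 - osp_lam p.2 = 0 -> mx_root_vec osp_emb z p \in h.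
Proof.
move/subr0_eq/osp_lam_inj; rewrite /mx_root_vec => <-; case: ifP => _; last exact: mem0v.
have [td tdE] := lam_osp_dual C p.1.
suff : 2 *: osp_emb (delta_mx p.1 p.1) = emb (osp_torus td).
  move=> E; rewrite -[osp_emb _]scale1r -(mulVf (_ : 2 != 0 :> C)) ?pnatr_eq0 //.
  by rewrite -scalerA E memvZ.
rewrite scaler_nat mulr2n {2}osp_emb_delta -linearZ -linearD /= osp_torusE.
congr (emb (_ *m _ *m _)).
have -> : osp_inv_coef C (pt_osp p.1) (pt_osp p.1) = - 1.
  rewrite /osp_inv_coef; case: split => // a.
  by rewrite sg_sp_sqr.
apply/matrixP => k l; rewrite !mxE tdE; have [<-|kl] := eqVneq k l.
  by rewrite !andbb mulr1n mulN1r.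
rewrite mulr0n; have [<-|_] := eqVneq k p.1; have [Ek|_] := eqVneq k (pt_osp k).
- by rewrite -Ek eq_sym (negPf kl) mulr0 addr0.
- by rewrite eq_sym (negPf kl) mulr0 addr0.
- by rewrite /= add0r; case: eqVneq => [E|]; rewrite ?mulr0 // -E eq_sym (negPf kl) mulr0.
by rewrite /= add0r; case: eqVneq => [E|]; rewrite ?mulr0 // -E eq_sym (negPf kl) mulr0.
Qed.

(** By [paired_diff_inj] at most two matrix units share a nonzero root, and [osp_emb_delta] makes
    their images proportional. *)
Lemma osp_family1 z p : osp_lam p.1 - osp_lam p.2 != 0 ->
  exists Y, forall q, osp_lam q.1 - osp_lam q.2 = osp_lam p.1 - osp_lam p.2 ->
    mx_root_vec osp_emb z q \in <[Y]>%VS.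
Proof.
rewrite subr_eq0 (inj_eq osp_lam_inj) => ne; exists (osp_emb (delta_mx p.1 p.2)).
move=> [k l] /esym E; rewrite /mx_root_vec ![_.1]/= ![_.2]/=; case: ifP => _; last exact: mem0v.
case: (paired_diff_inj (@pt_ospK m n) osp_lam_pt (@pt_osp_fixed m n) osp_lam_dual ne E) =>
  -[-> ->].
  exact: memv_line.
apply/vlineP; exists (osp_inv_coef C (pt_osp p.2) (pt_osp p.1))^-1.
by rewrite (osp_emb_delta p.1) scalerA mulVf ?scale1r // osp_inv_coef_neq0.
Qed.

Lemma osp_lam_eps i H : wt (osp_lam (eps_idx n i)) H = (coord H).1 0 i.
Proof.
rewrite osp_lamE /eps_idx !ospE /sg_so /= odd_double.
have lt := ltn_ord i; rewrite (_ : (i.*2.+1 < m)%N) ?mul1r; last by lia.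
rewrite /tau_so (bigD1 i) //= doubleK eqxx mulr1 big1 ?addr0 // => l.
by rewrite -(inj_eq val_inj) /= => /negPf->; rewrite mulr0.
Qed.

Lemma osp_lam_delta a H : wt (osp_lam (delta_idx m a)) H = (coord H).2 0 a.
Proof. by rewrite osp_lamE /delta_idx !ospE !spE !mul1r /= /tau_sp row_mxEl. Qed.
End OspFamily.

(** * The orthosymplectic family *)

Section OspDatum.
Variables (C : numClosedFieldType) (m n : nat).
Local Notation g := (osp_lie C m n).
Local Notation h := (osp_cartan C m n).
Local Notation M := 'M[C]_(m + (n + n)).
Local Notation val := (@vsval _ _ (osp_space C m n)).

Definition osp_proj (x : M) : g := vsproj (osp_space C m n) (2^-1 *: (x + osp_inv x)).

Lemma osp_projE x : val (osp_proj x) = 2^-1 *: (x + osp_inv x).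
Proof.
rewrite /osp_proj vsprojK // osp_space_inv linearZ linearD /= osp_invK.
by rewrite addrC.
Qed.

Lemma osp_projK (X : g) : osp_proj (val X) = X.
Proof.
apply: val_inj; rewrite [LHS]osp_projE; have := subvsP X; rewrite osp_space_inv => /eqP->.
by rewrite -mulr2n -scaler_nat scalerA mulVf ?scale1r ?pnatr_eq0.
Qed.

Lemma osp_proj_linear : linear osp_proj.
Proof.
move=> c x y; apply: val_inj; rewrite [RHS]/= [LHS]osp_projE [X in _ = _ *: X + _]osp_projE.
rewrite [X in _ = _ + X]osp_projE linearP /= addrACA.
by rewrite -[c *: x + _]scalerDr [LHS]scalerDr !scalerA [c * _]mulrC.
Qed.
HB.instance Definition _ := GRing.isLinear.Build C M g *:%R osp_proj osp_proj_linear.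

Lemma osp_val_br (X Y : g) : val (ls_br X Y) = gl_br (val X) (val Y).
Proof. exact: (vsval_br (g := gl_lie C m (n + n)) (@osp_space_br C m n)). Qed.

Lemma osp_val_part a (X : g) : (X \in ls_part g a) = (val X \in gl_part C m (n + n) a).
Proof. exact: (sub_partE (g := gl_lie C m (n + n))). Qed.

Lemma osp_torus_space td : osp_torus td \in osp_space C m n.
Proof.
rewrite osp_space_inv osp_torusE osp_inv_conj; apply/eqP; congr (_ *m _ *m _).
apply/matrixP => i j; rewrite !mxE (inj_eq (inv_inj (@pt_ospK m n))) (eq_sym j i).
have [->|_] := eqVneq i j; rewrite ?mulr0n ?mulr0 // !mulr1n lam_osp_pt.
rewrite /osp_inv_coef; case: split => a; rewrite ?sg_sp_sqr; ring.
Qed.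

Lemma osp_proj_torus td : val (osp_proj (osp_torus td)) = osp_torus td.
Proof.
have td_in := osp_torus_space td.
by rewrite -[in LHS](vsprojK td_in) osp_projK vsprojK.
Qed.

Lemma osp_cartanP (X : g) : reflect (exists td, val X = osp_torus td) (X \in h).
Proof.
rewrite /osp_cartan -memv_preim lfunE; have L := @osp_torus_linear C m n.
apply: (iffP memv_imgP) => -[td]; first by move=> _ E; exists td; rewrite -(linfunE L).
by move=> E; exists td; rewrite ?memvf // linfunE.
Qed.

Lemma osp_coordE td (H : subvs_of h) : val (vsval H) = osp_torus td -> osp_coord H = td.
Proof.
move=> E; rewrite /osp_coord E -(linfunE (@osp_torus_linear C m n)) lker0_lfunK //.
by apply/lker0P => td1 td2; rewrite !(linfunE (@osp_torus_linear C m n)); apply: osp_torus_inj.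
Qed.

Lemma osp_coordK (H : subvs_of h) : val (vsval H) = osp_torus (osp_coord H).
Proof. by have [td E] := osp_cartanP _ (subvsP H); rewrite (osp_coordE E). Qed.

Lemma osp_coord_linear : linear (@osp_coord C m n).
Proof.
by move=> c H1 H2; apply: osp_coordE; rewrite osp_torus_linear -!osp_coordK.
Qed.
End OspDatum.

Lemma adjoint_block (C : numClosedFieldType) m1 m2 n1 n2
  (A : 'M[C]_(m1, n1)) B D (E : 'M[C]_(m2, n2)) :
  adjoint_mx (block_mx A B D E)
  = block_mx (adjoint_mx A) (adjoint_mx D) (adjoint_mx B) (adjoint_mx E).
Proof. by rewrite /adjoint_mx tr_block_mx map_block_mx. Qed.

Lemma sg_so_conj (C : numClosedFieldType) m (i : 'I_m) : (sg_so C i)^* = sg_so C i.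
Proof. by rewrite /sg_so; do 2?case: ifP => _; rewrite ?rmorphN1 ?conjC1 ?conjC0. Qed.

Lemma sg_sp_conj (C : numClosedFieldType) n (i : 'I_(n + n)) : (sg_sp C i)^* = sg_sp C i.
Proof. by rewrite /sg_sp; case: split => _; rewrite ?rmorphN1 ?conjC1. Qed.

Lemma torus_mx_adjoint (C : numClosedFieldType) m (t : 'rV[C]_(m./2)) :
  adjoint_mx (torus_mx t) = torus_mx (map_mx Num.conj t).
Proof.
rewrite !torus_mxE (torus_adjoint (@pt_soK m) (@sg_pt_so C m)); last first.
- exact: sg_so_conj. - exact: tau_pt_so.
apply/matrixP => i j; rewrite !mxE; congr (_ * _ * _); rewrite /tau_so rmorph_sum.
by apply: eq_bigr => k _; rewrite rmorphM /= !mxE rmorph_nat.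
Qed.

Lemma Omega_torus_adjoint (C : numClosedFieldType) n (d : 'rV[C]_n) :
  let T d := 'i *: (Omega C n *m diag_mx (row_mx d d)) in
  adjoint_mx (T d) = T (map_mx Num.conj d).
Proof.
rewrite /= !Omega_torusE (torus_adjoint (@pt_spK n) (@sg_pt_sp C n)); last first.
- exact: sg_sp_conj. - exact: tau_pt_sp.
apply/matrixP => i j; rewrite !mxE; congr (_ * _ * _); rewrite /tau_sp.
by case: (split_ordP i) => a ->; rewrite !(row_mxEl, row_mxEr) mxE.
Qed.

Lemma osp_torus_adjoint (C : numClosedFieldType) m n (td : 'rV[C]_(m./2) * 'rV[C]_n) :
  adjoint_mx (osp_torus td) = osp_torus (map_mx Num.conj td.1, map_mx Num.conj td.2).
Proof.
rewrite /osp_torus adjoint_block torus_mx_adjoint Omega_torus_adjoint /=.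
by congr block_mx; rewrite /adjoint_mx trmx0 map_mx0.
Qed.

(** The off-diagonal positions compose to the diagonal, and the sign of s (pt i) cancels the square
    of ['i]. The formula is symmetric in tau and tau', so torus matrices commute; where s squares to
    1, tau = 1 gives an involution. *)
Lemma pair_torus_comm (C : numClosedFieldType) N (pt : 'I_N -> 'I_N) s tau tau' :
  involutive pt -> (forall i, s (pt i) = - s i) ->
  (forall i, tau (pt i) = tau i) -> (forall i, tau' (pt i) = tau' i) ->
  pair_torus pt s tau *m pair_torus pt s tau' = diag_mx (\row_i (s i * s i * tau i * tau' i))
    :> 'M[C]_N.
Proof.
move=> ptK s_pt tau_pt tau'_pt.
apply/matrixP => i j; rewrite !mxE (bigD1 (pt i)) //= big1 => [|k /negPf nk].
  rewrite !mxE ptK s_pt tau'_pt eqxx addr0 (eq_sym j i) /=.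
  transitivity (- ('i ^+ 2) * (s i * s i * tau i * tau' i * (i == j)%:R) :> C); first by ring.
  by rewrite sqrCi opprK mul1r; case: eqVneq => _; rewrite ?mulr1n ?mulr0n ?mulr1 ?mulr0.
by rewrite !mxE nk mulr0 mul0r.
Qed.

Lemma torus_mx_mul (C : numClosedFieldType) m (t t' : 'rV[C]_(m./2)) :
  torus_mx t *m torus_mx t' = diag_mx (\row_i (sg_so C i * sg_so C i * tau_so t i * tau_so t'
    i)) :> 'M[C]_m.
Proof.
by rewrite !torus_mxE pair_torus_comm //; [exact: pt_soK|exact: sg_pt_so|exact:
  tau_pt_so|exact: tau_pt_so].
Qed.

Lemma torus_mxC (C : numClosedFieldType) m (t t' : 'rV[C]_(m./2)) :
  torus_mx t *m torus_mx t' = torus_mx t' *m torus_mx t :> 'M[C]_m.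
Proof. by rewrite !torus_mx_mul; congr diag_mx; apply/rowP => i; rewrite !mxE mulrAC. Qed.

Lemma Omega_torus_mul (C : numClosedFieldType) n (d d' : 'rV[C]_n) :
  let T d := 'i *: (Omega C n *m diag_mx (row_mx d d)) in
  T d *m T d' = diag_mx (\row_i (tau_sp d i * tau_sp d' i)).
Proof.
rewrite /= !Omega_torusE pair_torus_comm.
- by congr diag_mx; apply/rowP => i; rewrite !mxE sg_sp_sqr mul1r.
- exact: pt_spK. - exact: sg_pt_sp. - exact: tau_pt_sp. - exact: tau_pt_sp.
Qed.

Lemma Omega_torusC (C : numClosedFieldType) n (d d' : 'rV[C]_n) :
  let T d := 'i *: (Omega C n *m diag_mx (row_mx d d)) in T d *m T d' = T d' *m T d.
Proof. by rewrite /= !Omega_torus_mul; congr diag_mx; apply/rowP => i; rewrite !mxE mulrC. Qed.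

(** The symplectic block of J is itself a torus matrix, hence commutes with the torus. *)
Lemma Omega_torus1 (C : numClosedFieldType) n :
  'i *: Omega C n = 'i *: (Omega C n *m diag_mx (row_mx (const_mx 1) (const_mx 1))).
Proof. by rewrite row_mx_const diag_const_mx mulmx1. Qed.

Lemma torus_mx1_sqr (C : numClosedFieldType) m : ~~ odd m ->
  torus_mx (const_mx 1) *m torus_mx (const_mx 1) = 1%:M :> 'M[C]_m.
Proof.
move=> om; rewrite torus_mx_mul -diag_const_mx; congr diag_mx; apply/rowP => i; rewrite !mxE.
have -> : tau_so (const_mx 1) i = 1 :> C.
  have lt : (i./2 < m./2)%N by case: i => i im /=; lia.
  rewrite /tau_so (bigD1 (Ordinal lt)) //= mxE eqxx mulr1 big1 ?addr0 // => k.
  by rewrite -(inj_eq val_inj) /= => /negPf->; rewrite mulr0.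
rewrite !mulr1 /sg_so; case: i => i im /=; case: ifP => [_|oi]; first by rewrite mulrNN mulr1.
by rewrite (_ : (i.+1 < m)%N) ?mulr1 //; lia.
Qed.

Section OspRegular.
Variables (C : numClosedFieldType) (m n : nat).
Hypothesis n0 : (0 < n)%N.
Local Notation g := (osp_lie C m n).
Local Notation h := (osp_cartan C m n).
Local Notation val := (@vsval _ _ (osp_space C m n)).
Local Notation coord := (@osp_coord C m n).
Local Notation emb := (@osp_proj C m n).

Lemma osp_form_invariant : invariant_form (@osp_form C m n).
Proof.
have mp a (X : g) : X \in ls_part g a -> val X \in gl_part C m (n +
  n) a by rewrite osp_val_part.
apply: (invariant_supertrace (@osp_val_br C m n) mp); first by rewrite invr_eq0 pnatr_eq0.
move=> X EX; apply: val_inj; rewrite linear0; apply/matrixP => i j.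
have Xinv : osp_inv (val X) = val X by apply/eqP; rewrite -osp_space_inv subvsP.
have : mxstr (val X *m val (osp_proj (delta_mx j i))) = 0 := EX _;
  rewrite osp_projE -scalemxAr linearZ /= mulmxDr linearD /=.
(* Both halves of the projected unit pair equally with X, so the pairing is that of the unit
   itself. *)
rewrite -{2}Xinv osp_inv_str mxstr_delta -mulr2n -(mulr_natl (_ * _)) mulKf ?pnatr_eq0 //.
by move/eqP; rewrite mulf_eq0 signr_eq0 /= => /eqP->; rewrite mxE.
Qed.

Let coordK H : emb (osp_torus (coord H)) = vsval H.
Proof. by apply: val_inj; rewrite [LHS]osp_proj_torus -osp_coordK. Qed.
Let torus_in td : emb (osp_torus td) \in h.
Proof. by apply/osp_cartanP; exists td; rewrite osp_proj_torus. Qed.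
Let coord_torus td : coord (vsproj h (emb (osp_torus td))) = td.
Proof. by apply: osp_coordE; rewrite vsprojK ?torus_in // osp_proj_torus. Qed.
Let emb_br td x : ls_br (emb (osp_torus td)) (emb x) = emb (gl_br (osp_torus td) x).
Proof.
apply: val_inj; rewrite [LHS]osp_val_br [RHS]osp_projE osp_proj_torus osp_projE.
rewrite osp_inv_br ?osp_torus_space ?osp_torus_part //.
by rewrite (linearZr_LR (@gl_br C m (n + n))) (linearDr (@gl_br C m (n + n))).
Qed.
Let emb_inv x : emb (osp_inv x) = emb x.
Proof. by apply: val_inj; rewrite [LHS]osp_projE [RHS]osp_projE osp_invK addrC. Qed.
Let emb_part a x : x \in gl_part C m (n + n) a -> emb x \in ls_part g a.
Proof.
by move=> xa; rewrite osp_val_part osp_projE memvZ // memvD // osp_inv_part.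
Qed.

Lemma osp_regular_cartan : regular_cartan h.
Proof.
have cl := @osp_coord_linear C m n.
apply: regular_cartan_intro => [||z].
- by apply/subvP => X /osp_cartanP[td E]; rewrite osp_val_part E osp_torus_part.
- move=> X Y /osp_cartanP[td E] /osp_cartanP[td' E']; apply: val_inj.
  rewrite [LHS]osp_val_br E E' (gl_brE (osp_torus_part _) (osp_torus_part _)).
  by rewrite /= scale1r osp_torus_comm subrr.
apply: (@root_family_regular _ _ _ z _ (mx_root_vec (osp_emb emb) z)
  (fun p => osp_lam coord p.1 - osp_lam coord p.2)).
- by move=> p; apply: osp_family_in.
- by apply: osp_family_span => // Y _; exists (val Y); apply: esym; apply: osp_projK.
- by move=> p; apply: osp_family0.
by move=> p; apply: osp_family1.
Qed.

Lemma osp_pos0_uniq : uniq (osp_pos0 C m n).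
Proof.
have cl := @osp_coord_linear C m n.
have -> : osp_pos0 C m n = osp_pos (fun i => osp_lam coord (eps_idx n i))
    (fun a => osp_lam coord (delta_idx m a)).
  have -> : (fun i => osp_lam coord (eps_idx n i)) = @osp_eps C m n.
    apply: boolp.funext => i; apply/lfunP => H; rewrite -[LHS]/(wt _ H) osp_lam_eps //.
    by rewrite /osp_eps linfunE // => a H1 H2; rewrite osp_coord_linear !mxE.
  have -> // : (fun a => osp_lam coord (delta_idx m a)) = @osp_delta C m n.
  apply: boolp.funext => i; apply/lfunP => H; rewrite -[LHS]/(wt _ H) osp_lam_delta //.
  by rewrite /osp_delta linfunE // => a H1 H2; rewrite osp_coord_linear !mxE.
apply: uniq_osp_pos => //; [exact: osp_lam_pt|exact: (osp_lam_dual cl coord_torus)].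
Qed.

Lemma osp_omega_cartan (w : g -> g) X : osp_omega w -> X \in h -> w X \in h.
Proof.
move=> [J [s [HJ wE]]] /osp_cartanP[td E]; apply/osp_cartanP.
exists (map_mx Num.conj td.1, map_mx Num.conj td.2); rewrite wE E osp_torus_adjoint.
apply: invmx_conj; case: HJ => [->|[om ->]].
- rewrite mulmx_block !(mul0mx, mulmx0, addr0, add0r) Omega_torus1 Omega_torus_mul.
  rewrite scalar_mx_block -scalar_mxM -expr2 sqrr_sign; congr block_mx.
  rewrite -[in RHS]diag_const_mx; congr diag_mx; apply/rowP => i;
    rewrite !mxE /tau_sp row_mx_const mxE.
  by rewrite mulr1.
- rewrite mulmx_block !(mul0mx, mulmx0, addr0, add0r) torus_mx1_sqr //.
  by rewrite [RHS]scalar_mx_block -scalar_mxM -expr2 sqrr_sign.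
- rewrite /osp_torus !mulmx_block !(mul0mx, mulmx0, addr0, add0r) scalar_mxC.
  by rewrite Omega_torus1 Omega_torusC.
by rewrite /osp_torus !mulmx_block !(mul0mx, mulmx0, addr0, add0r) scalar_mxC torus_mxC.
Qed.

Lemma osp_regular_datum w : d_omega (osp_datum C m n) w -> regular_datum w.
Proof.
move=> wO; split; [exact: osp_form_invariant|exact: osp_regular_cartan|exact: osp_pos0_uniq|].
by move=> X; apply: osp_omega_cartan.
Qed.
End OspRegular.

(** * The exceptional Lie superalgebra F(4) *)

Lemma trilinear_homogeneous (K : fieldType) (g : lieSuperalgebra K) (f : g -> g -> g -> K) :
  (forall X X' Y Z, f (X + X') Y Z = f X Y Z + f X' Y Z) ->
  (forall X Y Y' Z, f X (Y + Y') Z = f X Y Z + f X Y' Z) ->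
  (forall X Y Z Z', f X Y (Z + Z') = f X Y Z + f X Y Z') ->
  (forall a b c X Y Z, X \in ls_part g a -> Y \in ls_part g b -> Z \in ls_part g c ->
    f X Y Z = 0) ->
  forall X Y Z, f X Y Z = 0.
Proof.
move=> f1 f2 f3 f0 X Y Z.
have [X0 [X1 [Xe Xo ->]]] := ls_decomp X; have [Y0 [Y1 [Ye Yo ->]]] := ls_decomp Y.
have [Z0 [Z1 [Ze Zo ->]]] := ls_decomp Z; rewrite !(f1, f2, f3).
have fe a b c U V W := @f0 a b c U V W.
by rewrite !(fe _ _ _ _ _ _ Xe Ye Ze, fe _ _ _ _ _ _ Xe Ye Zo, fe _ _ _ _ _ _ Xe Yo Ze,
  fe _ _ _ _ _ _ Xe Yo Zo, fe _ _ _ _ _ _ Xo Ye Ze, fe _ _ _ _ _ _ Xo Ye Zo,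
  fe _ _ _ _ _ _ Xo Yo Ze, fe _ _ _ _ _ _ Xo Yo Zo) !addr0.
Qed.

(** * Supertrace of endomorphisms and the Killing form *)

Section LieSupertrace.
Variables (C : numClosedFieldType) (g : lieSuperalgebra C).
Implicit Types (f k : g -> g) (X Y Z : g).
Let b := vbasis (fullv : {vspace g}).

Definition lie_trace f : C := \sum_i coord b i (f (tnth b i)).
Definition grading X : g :=
  daddv_pi (ls_part g false) (ls_part g true) X - daddv_pi (ls_part g true) (ls_part g false) X.

Lemma lstr_lie_trace f : lstr f = lie_trace (f \o grading).
Proof. by []. Qed.

Lemma eq_lie_trace f k : f =1 k -> lie_trace f = lie_trace k.
Proof. by move=> fk; apply: eq_bigr => i _; rewrite fk. Qed.

Lemma eq_lstr f k : f =1 k -> lstr f = lstr k.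
Proof. by move=> fk; rewrite !lstr_lie_trace; apply: eq_lie_trace => X /=; rewrite fk. Qed.

Lemma lie_trace_mulC f k : linear f -> linear k -> lie_trace (f \o k) = lie_trace (k \o f).
Proof.
have E (F : g -> g) G : linear F -> lie_trace (F \o G)
    = \sum_i \sum_j coord b j (G (tnth b i)) * coord b i (F (tnth b j)).
  move=> FL; apply: eq_bigr => i _ /=.
  rewrite {1}(coord_vbasis (memvf (G (tnth b i)))) -(linfunE FL) linear_sum linear_sum.
  apply: eq_bigr => j _; rewrite 2!linearZ /= (linfunE FL) -tnth_nth.
  by [].
move=> fL kL; rewrite E // E // exchange_big /=; apply: eq_bigr => i _; apply: eq_bigr => j _.
exact: mulrC.
Qed.

Lemma lie_traceZ c f : lie_trace (fun X => c *: f X) = c * lie_trace f.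
Proof. by rewrite /lie_trace mulr_sumr; apply: eq_bigr => i _; rewrite linearZ. Qed.

Lemma lstrP c f k : lstr (fun X => c *: f X + k X) = c * lstr f + lstr k.
Proof.
by rewrite /lstr mulr_sumr -big_split; apply: eq_bigr => i _; rewrite linearP.
Qed.

Lemma grading_linear : linear grading.
Proof. by move=> c X Y; rewrite /grading !linearP /= scalerBr ?opprD ?scalerN addrACA. Qed.

Lemma gradingE z X : X \in ls_part g z -> grading X = (-1) ^+ z *: X.
Proof.
have d := ls_direct g; have d' : (ls_part g true :&: ls_part g false)%VS = 0%VS by rewrite
  capvC.
have pi0 U V Y : (U :&: V = 0)%VS -> Y \in V -> daddv_pi U V Y = 0 :> g.
  move=> UV YV; have := daddv_pi_add UV (subvP (addvSr U V) _ YV).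
  by rewrite (daddv_pi_id _ YV) 1?capvC // => /(canRL (addrK _)); rewrite subrr.
case: z => Xz; rewrite /grading (daddv_pi_id _ Xz) // (pi0 _ _ _ _ Xz) //.
  by rewrite sub0r scaleN1r. by rewrite subr0 scale1r.
Qed.

Definition has_parity a f := forall z X, X \in ls_part g z -> f X \in ls_part g (z (+) a).

Lemma grading_comm a f : linear f -> has_parity a f ->
  forall X, f (grading X) = (-1) ^+ a *: grading (f X).
Proof.
move=> fL fa X; have [X0 [X1 [Xe Xo ->]]] := ls_decomp X.
have fD Y Z : f (Y + Z) = f Y + f Z by have := fL 1 Y Z; rewrite !scale1r.
have f0 : f 0 = 0 by apply: (addIr (f 0)); rewrite -fD !add0r.
have fZ c Y : f (c *: Y) = c *: f Y by have := fL c Y 0; rewrite !(addr0, f0).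
have gD Y Z : grading (Y + Z) = grading Y + grading Z.
  by have := grading_linear 1 Y Z; rewrite !scale1r.
rewrite gD (fD X0 X1) (fD (grading X0)) gD scalerDr (gradingE Xe) (gradingE Xo) (gradingE (fa _
  _ Xe)) (gradingE (fa _ _ Xo)).
by rewrite !fZ !scalerA; case: a {fa} => /=; rewrite ?(mulrNN, mulr1, mul1r).
Qed.

Lemma comp_linear f k : linear f -> linear k -> linear (f \o k).
Proof. by move=> fL kL c X Y; rewrite /= kL fL. Qed.

(** The grading operator passes k at the cost of (-1)^a; cyclicity of the ordinary trace does the
    rest. *)
Lemma lstr_mulC a f k : linear f -> linear k -> has_parity a k ->
  lstr (f \o k) = (-1) ^+ a * lstr (k \o f).
Proof.
move=> fL kL ka; rewrite !lstr_lie_trace.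
rewrite (@eq_lie_trace _ (fun X => (-1) ^+ a *: (f \o (grading \o k)) X)); last first.
  move=> X /=; rewrite (grading_comm kL ka).
  have f0 : f 0 = 0 by have := fL (-1) 0 0; rewrite scaler0 addr0 scaleN1r addNr.
  by have := fL ((-1) ^+ a) (grading (k X)) 0; rewrite !(addr0, f0).
rewrite lie_traceZ; congr (_ * _).
exact: (lie_trace_mulC (comp_linear fL grading_linear) kL).
Qed.

(** Commuting f with the identity by [lstr_mulC] gives lstr f = - lstr f. *)
Lemma lstr_odd f : linear f -> has_parity true f -> lstr f = 0.
Proof.
move=> fL fo; have idL : linear (@id g) by [].
have /eqP : lstr f = (-1) ^+ true * lstr f := lstr_mulC idL fL fo.
by rewrite mulN1r -subr_eq0 opprK -mulr2n mulrn_eq0 => /eqP.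
Qed.

Definition ad X : g -> g := ls_br X.

Lemma ad_linear X : linear (ad X).
Proof. by move=> c Y Z; rewrite /ad linearPr. Qed.
Lemma ad_parity a X : X \in ls_part g a -> has_parity a (ad X).
Proof. by move=> Xa z Y Yz; rewrite addbC; apply: ls_graded. Qed.
Lemma comp_parity a a' f k : has_parity a f -> has_parity a' k ->
  has_parity (a (+) a') (f \o k).
Proof. by move=> fa ka z X /ka/fa; rewrite -addbA [a' (+) a]addbC. Qed.

Local Notation B := (@F4_form C g).

Lemma F4_formE X Y : B X Y = 6^-1 * lstr (ad X \o ad Y).
Proof. by []. Qed.

Lemma F4_form_linearl Y : linear_for *%R (B^~ Y).
Proof.
move=> c X X'; rewrite !F4_formE mulrCA -mulrDr -lstrP; congr (_ * _).
by apply: eq_lstr => Z /=; rewrite /ad linearPl.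
Qed.
Lemma F4_form_linearr X : linear_for *%R (B X).
Proof.
move=> c Y Y'; rewrite !F4_formE mulrCA -mulrDr -lstrP; congr (_ * _).
by apply: eq_lstr => Z /=; rewrite /ad linearPl linearPr.
Qed.

Lemma F4_form_even a a' X Y : X \in ls_part g a -> Y \in ls_part g a' ->
  a != a' -> B X Y = 0.
Proof.
move=> Xa Ya' ne; rewrite F4_formE lstr_odd ?mulr0 //.
  exact: comp_linear (ad_linear X) (ad_linear Y).
have := comp_parity (ad_parity Xa) (ad_parity Ya').
by case: a a' ne {Xa Ya'} => [] [].
Qed.

Lemma F4_form_sym a X Y : X \in ls_part g a -> Y \in ls_part g a ->
  B Y X = (-1) ^+ a * B X Y.
Proof.
move=> Xa Ya; rewrite !F4_formE mulrCA; congr (_ * _).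
exact: lstr_mulC (ad_linear Y) (ad_linear X) (ad_parity Xa).
Qed.

(** By the Jacobi identity the adjoint action of a bracket is a supercommutator. Once the common
    term ad X ad Y ad Z is removed, the remaining two differ by moving ad Y cyclically, or vanish
    for odd total parity. *)
Lemma F4_form_inv X Y Z : B (ls_br X Y) Z = B X (ls_br Y Z).
Proof.
have BDl X1 X2 Y1 : B (X1 + X2) Y1 = B X1 Y1 + B X2 Y1.
  by have := F4_form_linearl Y1 1 X1 X2; rewrite scale1r mul1r.
have BDr X1 Y1 Y2 : B X1 (Y1 + Y2) = B X1 Y1 + B X1 Y2.
  by have := F4_form_linearr X1 1 Y1 Y2; rewrite scale1r mul1r.
apply/eqP; rewrite -subr_eq0; apply/eqP; move: X Y Z.
apply: trilinear_homogeneous => [X X' Y Z|X Y Y' Z|X Y Z Z'|a c e X Y Z Xa Yc Ze].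
- by rewrite linearDl !BDl opprD addrACA.
- by rewrite linearDr linearDl !(BDl, BDr) opprD addrACA.
- by rewrite linearDr !BDr opprD addrACA.
have adbr U V d d' : U \in ls_part g d -> V \in ls_part g d' -> forall W,
    ad (ls_br U V) W = (- (-1) ^+ (d && d')) *: ad V (ad U W) + ad U (ad V W).
  move=> Ud Vd' W; rewrite /ad (ls_jacobi W Ud Vd') scaleNr addrC addrK //.
rewrite !F4_formE -mulrBr.
have -> : lstr (ad (ls_br X Y) \o ad Z)
   = - (-1) ^+ (a && c) * lstr (ad Y \o (ad X \o ad Z)) + lstr (ad X \o ad Y \o ad Z).
  by rewrite -lstrP; apply: eq_lstr => W /=; rewrite (adbr _ _ _ _ Xa Yc).
have -> : lstr (ad X \o ad (ls_br Y Z))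
   = - (-1) ^+ (c && e) * lstr (ad X \o ad Z \o ad Y) + lstr (ad X \o ad Y \o ad Z).
  rewrite -lstrP; apply: eq_lstr => W /=; rewrite (adbr _ _ _ _ Yc Ze).
  by rewrite ad_linear.
have XZL := comp_linear (ad_linear X) (ad_linear Z).
rewrite (lstr_mulC XZL (ad_linear Y) (ad_parity Yc)) opprD addrACA subrr addr0.
have [E|E] := eqVneq (c (+) (a (+) e)) true.
  rewrite lstr_odd ?mulr0 ?subrr ?mulr0 //; first exact: comp_linear (ad_linear Y) XZL.
  by have := comp_parity (ad_parity Yc) (comp_parity (ad_parity Xa) (ad_parity Ze)); rewrite E.
have <- : (-1) ^+ (c && e) * (-1) ^+ c = (-1) ^+ (a && c) :> C.
  by move: E; case: a c e {Xa Yc Ze} => [] [] [] //= _; rewrite ?(mulr1, mul1r, mulrNN).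
by ring.
Qed.

(** Evenness and invariance make the radical a graded ideal, so simplicity leaves only 0 or the
    whole algebra, and the latter is excluded by a nonzero value. *)
Lemma F4_form_nondeg : simple_lie g -> (exists X Y, B X Y != 0) ->
  forall X, (forall Y, B X Y = 0) -> X = 0.
Proof.
move=> simple [X1 [Y1 nz]].
pose fl X := linfun (B X : g -> C^o).
have flE X Y : fl X Y = B X Y by rewrite /fl linfunE //; exact: F4_form_linearr.
have flL : linear fl.
  by move=> c X X'; apply/lfunP => Y; rewrite add_lfunE scale_lfunE !flE F4_form_linearl.
pose I := lker (linfun fl).
have IP X : reflect (forall Y, B X Y = 0) (X \in I).
  rewrite memv_ker linfunE //; apply: (iffP eqP) => [E Y|E].
    by rewrite -flE E zero_lfunE.
  by apply/lfunP => Y; rewrite flE E zero_lfunE.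
have BDl X X' Y : B (X + X') Y = B X Y + B X' Y.
  by have := F4_form_linearl Y 1 X X'; rewrite scale1r mul1r.
have BDr X Y Y' : B X (Y + Y') = B X Y + B X Y'.
  by have := F4_form_linearr X 1 Y Y'; rewrite scale1r mul1r.
have Ihom X X0 X' : X = X0 + X' -> X0 \in ls_part g false -> X' \in ls_part g true ->
    X \in I -> X0 \in I /\ X' \in I.
  move=> E X0e X'o /IP XI; split; apply/IP => Y; have [Y0 [Y' [Ye Yo ->]]] := ls_decomp Y.
    rewrite BDr (F4_form_even X0e Yo) // addr0.
    by have := XI Y0; rewrite E BDl (F4_form_even X'o Ye) // addr0.
  rewrite BDr (F4_form_even X'o Ye) // add0r.
  by have := XI Y'; rewrite E BDl (F4_form_even X0e Yo) // add0r.
have [||I0|IF] := simple I.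
- apply/subvP => X XI; have [X0 [X' [Xe Xo E]]] := ls_decomp X.
  have [X0I X'I] := Ihom _ _ _ E Xe Xo XI; rewrite E.
  by apply: memv_add; rewrite memv_cap ?X0I ?X'I.
- move=> X Y YI; have [X0 [X' [Xe Xo ->]]] := ls_decomp X.
  have [Y0 [Y' [Ye Yo E]]] := ls_decomp Y; have [Y0I Y'I] := Ihom _ _ _ E Ye Yo YI.
  have brI a c U V : U \in ls_part g a -> V \in ls_part g c -> V \in I -> ls_br U V \in I.
    move=> Ua Vc /IP VI; rewrite (ls_anti Ua Vc) memvN memvZ //; apply/IP => Z.
    by rewrite F4_form_inv.
  rewrite E linearDl !linearDr !memvD //;
  by [exact: brI Xe Ye _|exact: brI Xe Yo _|exact: brI Xo Ye _|exact: brI Xo Yo _].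
- by move=> X XI; apply/eqP; rewrite -memv0 -I0; apply/IP.
by case/eqP: nz; apply/IP; rewrite IF memvf.
Qed.

Lemma F4_form_invariant : simple_lie g -> (exists X Y, B X Y != 0) -> invariant_form B.
Proof.
move=> simple nz; split.
- exact: F4_form_linearl. - exact: F4_form_linearr. - exact: F4_form_even.
- exact: F4_form_sym. - exact: F4_form_inv. - exact: F4_form_nondeg.
Qed.
End LieSupertrace.

(** In a rank factorisation E = L R, idempotency cancels down to R L = 1, so the rank is the trace;
    characteristic zero turns this into an equality of natural numbers. *)
Lemma idempotent_trace1 (C : numClosedFieldType) N (E : 'M[C]_N) :
  E *m E = E -> \tr E = 1 -> exists u : 'cV[C]_N, exists v : 'rV[C]_N, E = u *m v.
Proof.
move=> EE tr1; have := mulmx_base E; have := row_base_free E; have := col_base_full E.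
move: (col_base E) (row_base E) => L R Lf Rf Eb.
have RL : R *m L = 1%:M.
  apply: (row_free_inj Rf); rewrite /= mul1mx; apply: (row_full_inj Lf).
  by rewrite !mulmxA Eb -mulmxA Eb.
have r1 : \rank E = 1%N.
  by apply/eqP; rewrite -(eqr_nat C) -mxtrace1 -RL mxtrace_mulC Eb tr1.
by move: L R Eb {Lf Rf RL}; rewrite r1 => u v <-; exists u, v.
Qed.

Definition sgnb (C : numClosedFieldType) (b : bool) : C := if b then 1 else - 1.

Lemma sgnb_sqr (C : numClosedFieldType) b : sgnb C b * sgnb C b = 1.
Proof. by case: b; rewrite /sgnb ?mulrNN mulr1. Qed.
Lemma sgnb_inj (C : numClosedFieldType) : injective (sgnb C).
Proof.
have ne : (1 : C) == -1 = false by rewrite -subr_eq0 opprK -mulr2n pnatr_eq0.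
by case=> [] [] //= /eqP; rewrite ?ne // eq_sym ne.
Qed.
Lemma sgnbN (C : numClosedFieldType) b : sgnb C (~~ b) = - sgnb C b.
Proof. by case: b; rewrite /sgnb ?opprK. Qed.

(** * Eigenprojectors and the spin representation *)

Section Involution.
Variables (C : numClosedFieldType) (N : nat) (S : 'M[C]_N).
Hypothesis SS : S *m S = 1%:M.

Definition inv_proj b : 'M[C]_N := 2^-1 *: (1%:M + sgnb C b *: S).

Lemma inv_projE b : S *m inv_proj b = sgnb C b *: inv_proj b.
Proof.
rewrite /inv_proj -scalemxAr mulmxDr mulmx1 -scalemxAr SS scalerA mulrC -scalerA.
by congr (_ *: _); rewrite scalerDr scalerA sgnb_sqr scale1r addrC.
Qed.
Lemma inv_projE' b : inv_proj b *m S = sgnb C b *: inv_proj b.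
Proof.
rewrite -inv_projE /inv_proj -scalemxAl -scalemxAr mulmxDl mulmxDr mul1mx mulmx1.
by rewrite -scalemxAl -scalemxAr.
Qed.
Lemma inv_proj_sum : inv_proj true + inv_proj false = 1%:M.
Proof.
rewrite /inv_proj -scalerDr /sgnb scale1r scaleN1r addrACA subrr addr0 -mulr2n.
by rewrite -(scaler_nat 2 1%:M) scalerA mulVf ?scale1r ?pnatr_eq0.
Qed.
Lemma inv_proj_idem b : inv_proj b *m inv_proj b = inv_proj b.
Proof.
rewrite {1}/inv_proj -scalemxAl mulmxDl mul1mx -scalemxAl inv_projE scalerA sgnb_sqr scale1r.
by rewrite -mulr2n -scaler_nat scalerA mulVf ?scale1r ?pnatr_eq0.
Qed.
Lemma inv_proj_comm M b : M *m S = S *m M -> M *m inv_proj b = inv_proj b *m M.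
Proof.
move=> MS; rewrite /inv_proj -scalemxAl -scalemxAr mulmxDl mulmxDr mul1mx mulmx1.
by rewrite -scalemxAl -scalemxAr MS.
Qed.

(** Conjugation by G shows that S M has trace equal to its own negative, so only the summand with
    the identity survives. *)
Lemma inv_proj_trace (G M : 'M[C]_N) b : G *m G = 1%:M -> G *m S = - (S *m G) ->
  G *m M = M *m G -> \tr (inv_proj b *m M) = 2^-1 * \tr M.
Proof.
move=> GG GS GM; have trS : \tr (S *m M) = 0.
  have E : \tr (S *m M) = - \tr (S *m M).
    rewrite -{1}[S *m M]mulmx1 -{1}GG mulmxA mxtrace_mulC !mulmxA GS !mulNmx.
    by rewrite -(mulmxA S) GM -!mulmxA GG mulmx1 raddfN.
  by apply/eqP; have /eqP := E; rewrite -subr_eq0 opprK -mulr2n mulrn_eq0.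
rewrite /inv_proj -scalemxAl mulmxDl mul1mx -scalemxAl linearZ linearD linearZ /=.
by rewrite trS mulr0 addr0.
Qed.
End Involution.

Section SpinProjectors.
Variables (C : numClosedFieldType) (gam : 'I_7 -> 'M[C]_8).
Hypothesis gamC : clifford gam.

Definition even_idx (k : 'I_3) : 'I_7 := inord k.*2.
Definition odd_idx (k : 'I_3) : 'I_7 := inord k.*2.+1.

Lemma gam_sqr i : gam i *m gam i = 1%:M.
Proof.
have := gamC i i; rewrite eqxx mulr1 -mulr2n -scaler_nat -[_%:M]mulr1 => /(congr1 (fun X =>
  2^-1 *: X)).
rewrite scalerA mulVf ?pnatr_eq0 // scale1r => ->.
by rewrite mulr1 scale_scalar_mx mulVf ?pnatr_eq0.
Qed.

Lemma gam_anti i j : i != j -> gam i *m gam j = - (gam j *m gam i).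
Proof.
move=> /negPf ij; have := gamC i j; rewrite ij mulr0 raddf0 => /eqP.
by rewrite addr_eq0 => /eqP.
Qed.

(** The product of two distinct gamma matrices squares to -1; the factor ['i] makes it an
    involution. *)
Definition spin_inv k : 'M[C]_8 := 'i *: (gam (even_idx k) *m gam (odd_idx k)).
Local Notation S := spin_inv.

Lemma even_idxE k : even_idx k = k.*2 :> nat.
Proof. by rewrite inordK //; have := ltn_ord k; lia. Qed.
Lemma odd_idxE k : odd_idx k = k.*2.+1 :> nat.
Proof. by rewrite inordK //; have := ltn_ord k; lia. Qed.

Lemma even_odd_idx k l : even_idx k != odd_idx l.
Proof. by apply/eqP => /(congr1 (fun i : 'I_7 => i : nat)); rewrite even_idxE odd_idxE;
  lia. Qed.

Lemma spin_invK k : S k *m S k = 1%:M.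
Proof.
rewrite /S -scalemxAl -scalemxAr scalerA -expr2 sqrCi scaleN1r.
rewrite mulmxA -(mulmxA (gam (even_idx k))) (gam_anti (i := odd_idx k))
  1?eq_sym ?even_odd_idx //.
by rewrite mulmxN mulNmx opprK mulmxA gam_sqr mul1mx gam_sqr.
Qed.

Lemma gam_spin_comm i l : i != even_idx l -> i != odd_idx l -> gam i *m S l = S l *m gam i.
Proof.
move=> ie io; rewrite /S -scalemxAl -scalemxAr; congr (_ *: _).
rewrite mulmxA (gam_anti ie) mulNmx -(mulmxA (gam (even_idx l)) (gam i))
  (gam_anti io) mulmxN opprK.
by rewrite mulmxA.
Qed.

Lemma gam_spin_anti k : gam (even_idx k) *m S k = - (S k *m gam (even_idx k)).
Proof.
rewrite /S -scalemxAl -scalemxAr -scalerN; congr (_ *: _).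
by rewrite -mulmxA (gam_anti (i := odd_idx k)) 1?eq_sym ?even_odd_idx // mulmxN opprK.
Qed.

Lemma spin_inv_comm k l : S k *m S l = S l *m S k.
Proof.
have [-> //|kl] := eqVneq k l.
have ne (i j : 'I_7) : i <> j :> nat -> i != j by move=> ij; apply: contra_notN ij => /eqP->.
have kl' : k <> l :> nat by move=> E; case/eqP: kl; apply: val_inj.
rewrite {1}/S -scalemxAl -mulmxA (gam_spin_comm (i := odd_idx k)); last 2 first.
- by apply: ne; rewrite even_idxE odd_idxE; lia.
- by apply: ne; rewrite !odd_idxE; lia.
rewrite mulmxA gam_spin_comm; last 2 first.
- by apply: ne; rewrite !even_idxE; lia.
- by apply: ne; rewrite even_idxE odd_idxE; lia.
by rewrite -mulmxA scalemxAr.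
Qed.

(** Each pair of coordinates occurs in both orders with opposite signs, and the gamma matrices
    anticommute, so the 1/4 of [spin] doubles to 1/2. *)
Lemma spin_torus (t : 'rV[C]_(7./2)) :
  spin gam (torus_mx t) = \sum_k (2^-1 * t 0 k) *: S k.
Proof.
have tE i j : torus_mx t i j = \sum_k 'i * t 0 k * (((i == even_idx k) && (j == odd_idx k))%:R
    - ((i == odd_idx k) && (j == even_idx k))%:R).
  rewrite mxE; apply: eq_bigr => k _; rewrite -!(inj_eq val_inj) /= !even_idxE !odd_idxE //.
rewrite /spin; under eq_bigr => i _.
  under eq_bigr => j _ do rewrite tE mulr_sumr scaler_suml.
  over.
under eq_bigr => i _ do rewrite exchange_big.
rewrite exchange_big /=; apply: eq_bigr => k _.
have D (p q : 'I_7) : \sum_i \sum_j ((i == p) && (j == q))%:R *: (gam i *m gam j) = gam p *m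
  gam q.
  rewrite (bigD1 p) //= (bigD1 q) //= !eqxx scale1r !big1 ?addr0 // => [i|j] /negPf ne.
    by rewrite big1 // => j _; rewrite ne scale0r.
  by rewrite ne andbF scale0r.
transitivity ((4^-1 * ('i * t 0 k)) *: (\sum_i \sum_j ((i == even_idx k) && (j == odd_idx
  k))%:R *: (gam i *m gam j)
   - \sum_i \sum_j ((i == odd_idx k) && (j == even_idx k))%:R *: (gam i *m gam j))).
  rewrite -sumrB scaler_sumr; apply: eq_bigr => i _; rewrite -sumrB scaler_sumr.
  by apply: eq_bigr => j _; rewrite -scalerBl scalerA mulrA.
rewrite !D (gam_anti (i := odd_idx k)) 1?eq_sym ?even_odd_idx //
  opprK -mulr2n -scaler_nat /S !scalerA.
congr (_ *: _).
have -> : 4^-1 = 2^-1 * 2^-1 :> C by rewrite -invfM -natrM.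
transitivity ((2^-1 * 2) * (2^-1 * t 0 k * 'i) : C); first by ring.
by rewrite mulVf ?pnatr_eq0 // mul1r.
Qed.

Local Notation e k b := (inv_proj (S k) b).
Definition ord3 (k : nat) : 'I_3 := inord k.
Definition spin_sel (s : bool * bool * bool) (k : 'I_3) : bool :=
  nth true [:: s.1.1; s.1.2; s.2] k.
Definition spin_proj (s : bool * bool * bool) : 'M[C]_8 :=
  e (ord3 0) s.1.1 *m (e (ord3 1) s.1.2 *m e (ord3 2) s.2).

Lemma spin_projE k s : S k *m spin_proj s = sgnb C (spin_sel s k) *: spin_proj s.
Proof.
have cS i j b : S i *m e j b = e j b *m S i by apply: inv_proj_comm; apply: spin_inv_comm.
have : [\/ k = ord3 0, k = ord3 1 | k = ord3 2].
  by case: k => [[|[|[|//]]] lt]; [apply: Or31|apply: Or32|apply: Or33];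
    apply: val_inj; rewrite /= inordK.
case=> ->; rewrite /spin_sel inordK //= /spin_proj.
- by rewrite mulmxA inv_projE ?spin_invK // scalemxAl.
- by rewrite mulmxA cS -mulmxA (mulmxA (S _)) inv_projE ?spin_invK // -scalemxAl -scalemxAr.
rewrite mulmxA cS -mulmxA (mulmxA (S _)) cS -(mulmxA (e _ _) (S _)) inv_projE ?spin_invK //.
by rewrite -!scalemxAr.
Qed.

Lemma spin_proj_idem s : spin_proj s *m spin_proj s = spin_proj s.
Proof.
have cS i j b c : e i b *m e j c = e j c *m e i b.
  by apply: inv_proj_comm; apply/esym/inv_proj_comm; apply: spin_inv_comm.
have idem (A B : 'M[C]_8) : A *m A = A -> B *m B = B -> A *m B = B *m A ->
    A *m B *m (A *m B) = A *m B.
  by move=> AA BB AB; rewrite {2}AB -mulmxA (mulmxA B B) BB -AB mulmxA AA.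
have ee i b : e i b *m e i b = e i b by rewrite inv_proj_idem ?spin_invK.
apply: (idem) => //; first exact: (idem).
by rewrite mulmxA cS -mulmxA (cS (ord3 0)) mulmxA.
Qed.

(** The gamma matrix at [even_idx k] anticommutes with the involution k and commutes with the other
    two, so each projector halves the trace: 8 falls to 1. *)
Lemma spin_proj_trace s : \tr (spin_proj s) = 1.
Proof.
have ord3E k : (k < 3)%N -> ord3 k = k :> nat by move=> k3; rewrite inordK.
have ne (i j : 'I_7) : i <> j :> nat -> i != j by move=> ij; apply: contra_notN ij => /eqP->.
have cg k l b : (k < 3)%N -> (l < 3)%N -> k <> l ->
    gam (even_idx (ord3 k)) *m e (ord3 l) b = e (ord3 l) b *m gam (even_idx (ord3 k)).
  move=> k3 l3 kl; apply: inv_proj_comm; apply: gam_spin_comm; apply: ne;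
  by rewrite !(even_idxE, odd_idxE) !ord3E //; lia.
have tr k b M : gam (even_idx (ord3 k)) *m M = M *m gam (even_idx (ord3 k)) ->
    \tr (e (ord3 k) b *m M) = 2^-1 * \tr M.
  by apply: inv_proj_trace; [exact: gam_sqr|exact: gam_spin_anti].
rewrite /spin_proj tr; last by rewrite mulmxA cg // -mulmxA cg // mulmxA.
rewrite tr ?cg // -[e _ _]mulmx1 tr ?mul1mx ?mulmx1 // mxtrace1.
rewrite (_ : 8%:R = 2 * (2 * 2) :> C) -?natrM //.
by rewrite natrM natrM !(mulKf, mulVf) ?pnatr_eq0.
Qed.

Lemma spin_proj_rank1 s : exists u : 'cV[C]_8, exists v : 'rV[C]_8,
  spin_proj s = u *m v.
Proof. exact: idempotent_trace1 (spin_proj_idem s) (spin_proj_trace s). Qed.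

Lemma spin_proj_neq0 s : spin_proj s != 0.
Proof.
apply: contraTneq (oner_neq0 C) => E; rewrite -(spin_proj_trace s) E mxtrace0.
by rewrite eqxx.
Qed.
End SpinProjectors.

(** K is ['i] Omega_1, which identifies the torus of sl(2) with that of sp(2). *)
Lemma torus_mx2 (C : numClosedFieldType) (d : 'rV[C]_1) :
  torus_mx (m := 2) d = 'i *: (Omega C 1 *m diag_mx (row_mx d d)).
Proof.
rewrite Omega_torusE; apply/matrixP => i j; rewrite [LHS]mxE [RHS]mxE big_ord_recl big_ord0
  addr0 /tau_sp.
case: (@split_ordP 1 1 i) => a ->; case: (@split_ordP 1 1 j) => b ->;
rewrite !spE !(row_mxEl, row_mxEr) (ord1 a) (ord1 b) (_ : ord0 = 0) //;
rewrite -!(inj_eq val_inj) /=; by ring.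
Qed.

Lemma trace_sl2 (C : numClosedFieldType) (D : 'M[C]_(1 + 1)) :
  D = Omega C 1 *m D^T *m Omega C 1 <-> \tr D = 0.
Proof.
split=> [E|tr0].
  have : \tr D = - \tr D.
    rewrite {1}E mxtrace_mulC mulmxA Omega_sqr mulNmx mul1mx raddfN /= mxtrace_tr.
    by [].
  by move=> /eqP; rewrite -subr_eq0 opprK -mulr2n mulrn_eq0 => /eqP.
rewrite -[D]submxK in tr0 *; rewrite mxtrace_block in tr0.
rewrite tr_block_mx !mulmx_block !(mul0mx, mulmx0, mul1mx, mulmx1, mulNmx, mulmxN, addr0,
  add0r, opprK).
move: (ulsubmx D) (ursubmx D) (dlsubmx D) (drsubmx D) tr0 => A B E F.
rewrite /mxtrace !big_ord_recl !big_ord0 !addr0 => /eqP; rewrite addr_eq0 => /eqP AF.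
by congr block_mx; apply/matrixP => i j; rewrite !ord1 !mxE // AF ?opprK.
Qed.

(** * The even part of F(4) *)

Section F4Even.
Variables (C : numClosedFieldType) (g : lieSuperalgebra C).
Variable phi : {linear ('M[C]_7 * 'M[C]_2)%type -> g}.
Hypothesis hF : is_F4 phi.
Local Notation h := (F4_cartan phi).
Local Notation M := 'M[C]_(7 + (1 + 1)).

Definition osp_sym (x : M) : M := 2^-1 *: (x + osp_inv x).
(* so(7) + sl(2) is the even part of osp(7|2), so its even root vectors serve for F(4). *)
Definition F4_emb (x : M) : g := phi (ulsubmx (osp_sym x), drsubmx (osp_sym x)).

Lemma osp_sym_linear : linear osp_sym.
Proof.
move=> c x y; rewrite /osp_sym linearP /= addrACA -scalerDr [LHS]scalerDr !scalerA.
by rewrite [c * _]mulrC.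
Qed.

Lemma osp_sym_in x : osp_sym x \in osp_space C 7 1.
Proof. by rewrite osp_space_inv /osp_sym linearZ linearD /= osp_invK addrC. Qed.

Lemma osp_sym_id x : x \in osp_space C 7 1 -> osp_sym x = x.
Proof.
rewrite osp_space_inv /osp_sym => /eqP->.
by rewrite -mulr2n -scaler_nat scalerA mulVf ?scale1r ?pnatr_eq0.
Qed.

Lemma osp_sym_inv x : osp_sym (osp_inv x) = osp_sym x.
Proof. by rewrite /osp_sym osp_invK addrC. Qed.

Lemma F4_emb_linear : linear F4_emb.
Proof.
move=> c x y; rewrite /F4_emb osp_sym_linear -[RHS](linearP phi); congr (phi (_, _));
by apply/matrixP => i j; rewrite !mxE.
Qed.
HB.instance Definition _ := GRing.isLinear.Build C M g *:%R F4_emb F4_emb_linear.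

Lemma so7_sl2_osp x : x \in osp_space C 7 1 -> so7_sl2 (ulsubmx x, drsubmx x).
Proof.
rewrite -{1}[x]submxK => /osp_spaceP[HA HD _]; split=> /=; last exact/trace_sl2.
by rewrite {2}HA opprK.
Qed.

Lemma osp_so7_sl2 AB : so7_sl2 AB -> block_mx AB.1 0 0 AB.2 \in osp_space C 7 1.
Proof.
move=> [tA tD]; apply/osp_spaceP; split; first by rewrite tA opprK.
  exact/trace_sl2.
by rewrite trmx0 mulmx0 oppr0.
Qed.

Lemma F4_emb_sl2 AB : so7_sl2 AB -> F4_emb (block_mx AB.1 0 0 AB.2) = phi AB.
Proof.
move=> sAB; rewrite /F4_emb osp_sym_id ?osp_so7_sl2 // block_mxKul block_mxKdr.
by case: AB {sAB}.
Qed.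

Lemma F4_torus_so7 (td : 'rV[C]_(7./2) * 'rV[C]_(2./2)) :
  so7_sl2 (torus_mx td.1 : 'M_7, torus_mx td.2 : 'M_2).
Proof.
have := so7_sl2_osp (@osp_torus_space C 7 1 td); rewrite block_mxKul block_mxKdr -torus_mx2.
by [].
Qed.

Lemma F4_torusE td : F4_torus phi td = F4_emb (osp_torus td).
Proof.
by rewrite /F4_torus -(F4_emb_sl2 (F4_torus_so7 td)) /osp_torus -torus_mx2.
Qed.

Lemma phi_part AB : so7_sl2 AB -> phi AB \in ls_part g false.
Proof. by case: hF => _ _ _ ev _ sAB; apply/ev; exists AB. Qed.

Lemma phi_inj AB AB' : so7_sl2 AB -> so7_sl2 AB' -> phi AB = phi AB' -> AB = AB'.
Proof.
case: hF => _ _ inj _ _ [tA tD] [tA' tD'] E; apply/eqP; rewrite -subr_eq0; apply/eqP/inj.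
  split=> /=; first by rewrite raddfB /= tA tA' opprB opprK addrC.
  by rewrite raddfB /= tD tD' subrr.
by rewrite linearB /= E subrr.
Qed.

Lemma F4_torus_linear : linear (F4_torus phi).
Proof. by move=> c td td'; rewrite !F4_torusE osp_torus_linear linearP. Qed.

Lemma F4_torus_inj : injective (F4_torus phi).
Proof.
move=> td td' /(phi_inj (F4_torus_so7 td) (F4_torus_so7 td')) [E1 E2].
by apply: (@osp_torus_inj C 7 1); rewrite /osp_torus -!torus_mx2 E1 E2.
Qed.

Lemma F4_cartanP X : reflect (exists td, X = F4_torus phi td) (X \in h).
Proof.
apply: (iffP memv_imgP) => -[td]; first by move=> _ ->; exists td; rewrite linfunE //;
  exact: F4_torus_linear.
by move=> ->; exists td; rewrite ?memvf // linfunE //; exact: F4_torus_linear.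
Qed.

Local Notation coord := (@F4_coord C g phi).

Lemma F4_coordE td (H : subvs_of h) : vsval H = F4_torus phi td -> coord H = td.
Proof.
move=> E; rewrite /F4_coord E -(linfunE F4_torus_linear) lker0_lfunK //.
by apply/lker0P => td1 td2; rewrite !(linfunE F4_torus_linear); apply: F4_torus_inj.
Qed.

Lemma F4_coordK (H : subvs_of h) : F4_torus phi (coord H) = vsval H.
Proof. by have [td E] := F4_cartanP _ (subvsP H); rewrite (F4_coordE E). Qed.

Lemma F4_coord_linear : linear coord.
Proof. by move=> c H1 H2; apply: F4_coordE; rewrite F4_torus_linear !F4_coordK. Qed.

Lemma F4_torus_in td : F4_torus phi td \in h.
Proof. by apply/F4_cartanP; exists td. Qed.

Lemma F4_coord_torus td : coord (vsproj h (F4_torus phi td)) = td.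
Proof. by apply: F4_coordE; rewrite vsprojK ?F4_torus_in. Qed.

Lemma F4_emb_br td x :
  ls_br (F4_emb (osp_torus td)) (F4_emb x) = F4_emb (gl_br (osp_torus td) x).
Proof.
case: hF => _ br _ _ _; rewrite -F4_torusE /F4_emb -br; last 2 first.
- exact: F4_torus_so7. - exact/so7_sl2_osp/osp_sym_in.
have -> : osp_sym (gl_br (osp_torus td) x) = gl_br (osp_torus td) (osp_sym x).
  rewrite /osp_sym osp_inv_br ?osp_torus_space ?osp_torus_part //.
  by rewrite (linearZr_LR (@gl_br C 7 2)) (linearDr (@gl_br C 7 2)).
rewrite -[osp_sym x in RHS]submxK /osp_torus gl_br_block block_mxKul block_mxKdr.
by rewrite !mul0mx !mulmx0 !addr0 -torus_mx2.
Qed.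

Lemma F4_emb_part a x : x \in gl_part C 7 2 a -> F4_emb x \in ls_part g a.
Proof.
case: a => [xo|_]; last exact/phi_part/so7_sl2_osp/osp_sym_in.
have : osp_sym x \in gl_part C 7 2 true by rewrite memvZ // memvD // osp_inv_part.
rewrite /F4_emb => /mxpart_id <-; rewrite /= block_mxKul block_mxKdr.
by rewrite [phi _](_ : _ = phi 0) // linear0 mem0v.
Qed.

Lemma F4_emb_onto Y : Y \in ls_part g false -> exists x, Y = F4_emb x.
Proof.
case: hF => _ _ _ ev _ /ev[AB sAB ->].
by exists (block_mx AB.1 0 0 AB.2); rewrite F4_emb_sl2.
Qed.
End F4Even.

Lemma torus_mx_tr (C : numClosedFieldType) m (t : 'rV[C]_(m./2)) :
  (torus_mx t)^T = - torus_mx t :> 'M[C]_m.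
Proof.
apply/matrixP => i j; rewrite !mxE -sumrN; apply: eq_bigr => k _.
rewrite [(nat_of_ord j == k.*2) && _]andbC [(nat_of_ord j == k.*2.+1) && _]andbC.
by ring.
Qed.

(** * The odd part of F(4) *)

Section F4Odd.
Variables (C : numClosedFieldType) (g : lieSuperalgebra C).
Variable phi : {linear ('M[C]_7 * 'M[C]_2)%type -> g}.
Hypothesis hF : is_F4 phi.
Local Notation h := (F4_cartan phi).
Local Notation coord := (@F4_coord C g phi).
Variables (gam : 'I_7 -> 'M[C]_8) (psi : 'Hom('M[C]_(8, 2), g)).
Hypothesis gamC : clifford gam.
Hypothesis psi_inj : lker psi = 0%VS.
Hypothesis psi_onto : limg psi = ls_part g true.
Hypothesis psi_br : forall AB P, so7_sl2 AB ->
  ls_br (phi AB) (psi P) = psi (spin gam AB.1 *m P + P *m AB.2^T).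

Let K : 'M[C]_2 := torus_mx (m := 2) (const_mx 1).
Let KK : K *m K = 1%:M. Proof. exact: torus_mx1_sqr. Qed.
Local Notation F b := (inv_proj K b).
Local Notation E s := (spin_proj gam s).

Lemma torus_mx2_scale (d : 'rV[C]_1) : torus_mx (m := 2) d = d 0 0 *: K.
Proof.
apply/matrixP => i j; rewrite !mxE !big_ord_recl !big_ord0 !addr0 mxE.
by rewrite (_ : ord0 = 0) //; ring.
Qed.

(** Half of eps_1, eps_2, eps_3 and delta combined with arbitrary signs; delta is twice the second
    coordinate. The minus sign arises because sl(2) acts through the transpose, which negates the
    torus. *)
Definition F4_chi (s : bool * bool * bool) (b : bool) : weight h :=
  linfun (fun H : subvs_of h => \sum_k (2^-1 * (coord H).1 0 k) * sgnb C (spin_sel s k)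
    - sgnb C b * (coord H).2 0 0 : C^o).

Lemma F4_chiE s b H : wt (F4_chi s b) H
  = \sum_k (2^-1 * (coord H).1 0 k) * sgnb C (spin_sel s k) - sgnb C b * (coord H).2 0 0.
Proof.
rewrite /wt /F4_chi linfunE // => c H1 H2; rewrite (F4_coord_linear hF).
rewrite -[RHS]/(c * _ + _) !mxE.
have -> : \sum_k 2^-1 * (c *: coord H1 + coord H2).1 0 k * sgnb C (spin_sel s k)
  = c * (\sum_k 2^-1 * (coord H1).1 0 k * sgnb C (spin_sel s k))
    + \sum_k 2^-1 * (coord H2).1 0 k * sgnb C (spin_sel s k).
  by rewrite mulr_sumr -big_split; apply: eq_bigr => k _; rewrite !mxE /=; ring.
by ring.
Qed.

Lemma F4_odd_br s b Q (H : subvs_of h) :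
  ls_br (vsval H) (psi (E s *m Q *m F b)) = wt (F4_chi s b) H *: psi (E s *m Q *m F b).
Proof.
rewrite -(F4_coordK hF) psi_br; last exact: F4_torus_so7.
rewrite -linearZ /= spin_torus // F4_chiE; congr (psi _).
have := inv_projE' KK b; move: (F b) => f fK.
have : forall k, spin_inv gam k *m E s = sgnb C (spin_sel s k) *: E s.
  by move=> k; apply: spin_projE.
move: (E s) (spin_inv gam) => e S Se.
rewrite torus_mx_tr torus_mx2_scale mulmxN -scalemxAr -(mulmxA (e *m Q)) fK.
rewrite scalerBl !mulmxA; congr (_ + _); last first.
  by rewrite -!scalemxAr scalerA mulrC.
rewrite -mulmxA !mulmx_suml scaler_suml; apply: eq_bigr => k _.
by rewrite -scalemxAl mulmxA Se -!scalemxAl scalerA.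
Qed.

Lemma F4_chi_inj s b s' b' : F4_chi s b = F4_chi s' b' -> (s, b) = (s', b').
Proof.
move=> Echi; have ev (td : 'rV[C]_(7./2) * 'rV[C]_(2./2))
  : \sum_k (2^-1 * td.1 0 k) * sgnb C (spin_sel s k) - sgnb C b * td.2 0 0
    = \sum_k (2^-1 * td.1 0 k) * sgnb C (spin_sel s' k) - sgnb C b' * td.2 0 0.
  have := congr1 (fun al : weight h => wt al (vsproj h (F4_torus phi td))) Echi.
  by rewrite !F4_chiE !(F4_coord_torus hF).
have Es k : spin_sel s k = spin_sel s' k.
  have := ev (delta_mx 0 k, 0); rewrite /= mxE !mulr0 !subr0.
  rewrite (bigD1 k) //= [X in _ = X](bigD1 k) //= !mxE !eqxx /= !mulr1 !big1 ?addr0 =>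
    [|j /negPf jk|j /negPf jk];
    try by rewrite mxE jk andbF mulr0 mul0r.
  by move=> /(mulfI _)-/(_ _)/sgnb_inj ->; rewrite ?invr_eq0 ?pnatr_eq0.
have Eb : b = b'.
  have := ev (0, const_mx 1); rewrite /= mxE !mulr1 !big1 => [|j _|j _];
    try by rewrite mxE mulr0 mul0r.
  by rewrite !sub0r => /oppr_inj/sgnb_inj.
rewrite Eb; congr (_, _); have := Es (ord3 0); have := Es (ord3 1); have := Es (ord3 2).
rewrite /spin_sel /ord3 !inordK //=.
by case: s {Echi ev Es} => [[? ?] ?]; case: s' => [[? ?] ?] /= -> -> ->.
Qed.

Lemma F4_chiN s b : exists s', F4_chi s' (~~ b) = - F4_chi s b.
Proof.
exists (~~ s.1.1, ~~ s.1.2, ~~ s.2); apply/lfunP => H; rewrite opp_lfunE -!/(wt _ _) !F4_chiE.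
rewrite opprB sgnbN mulNr opprK addrC; congr (_ + _); rewrite -sumrN; apply: eq_bigr => k _.
rewrite -mulrN -sgnbN; congr (_ * sgnb C _); rewrite /spin_sel.
by case: k => [[|[|[|//]]] lt].
Qed.

(** A zero weight would equal its negative, which has the opposite sign b, against [F4_chi_inj]. *)
Lemma F4_chi_neq0 s b : F4_chi s b != 0.
Proof.
apply/eqP => E0; have [s' Es'] := F4_chiN s b; rewrite E0 oppr0 -E0 in Es'.
by have [_] := F4_chi_inj Es'; case: b {E0 Es'}.
Qed.

(** Sixteen weights times sixteen matrix units: redundant, but spanning without a choice of vectors
    in the images of the projectors. *)
Definition F4_odd_index := ((bool * bool * bool * bool) * ('I_8 * 'I_2))%type.
Definition F4_odd_vec (p : F4_odd_index) : g :=
  psi (E p.1.1 *m delta_mx p.2.1 p.2.2 *m F p.1.2).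

Lemma F4_odd_in p : F4_odd_vec p \in root_space true (F4_chi p.1.1 p.1.2).
Proof.
apply/root_spaceP; split=> [|H]; last exact: F4_odd_br.
by rewrite -psi_onto memv_img ?memvf.
Qed.

(** The identity is split successively by the eigenprojectors of K and of the three spin
    involutions. *)
Lemma F4_odd_span : (ls_part g true <= \sum_p <[F4_odd_vec p]>)%VS.
Proof.
set W := (\sum_p _)%VS; rewrite -psi_onto; apply/subvP => _ /memv_imgP[P _ ->].
have W4 s b Q : psi (E s *m Q *m F b) \in W.
  rewrite {1}[Q]matrix_sum_delta pair_big mulmx_sumr mulmx_suml linear_sum.
  apply: memv_suml => p _; rewrite -(scalemxAr _ (E s)) -(scalemxAl _ (E s *m _))
    linearZ memvZ //.
  by apply: subvP (sumv_sup (s, b, p) isT (subvv _)) _ (memv_line _).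
have W3 s Q : psi (E s *m Q) \in W.
  by rewrite -[_ *m Q]mulmx1 -(inv_proj_sum K) mulmxDr linearD memvD ?W4.
have W2 a b Q : psi (inv_proj (spin_inv gam (ord3 0)) a *m (inv_proj (spin_inv gam (ord3 1))
  b *m Q)) \in W.
  rewrite -[Q]mul1mx -(inv_proj_sum (spin_inv gam (ord3 2))) mulmxDl !mulmxDr linearD memvD //=.
    by have := W3 (a, b, true) Q; rewrite /spin_proj -!mulmxA.
  by have := W3 (a, b, false) Q; rewrite /spin_proj -!mulmxA.
have W1 a Q : psi (inv_proj (spin_inv gam (ord3 0)) a *m Q) \in W.
  by rewrite -[Q]mul1mx -(inv_proj_sum (spin_inv gam (ord3 1)))
    mulmxDl !mulmxDr linearD memvD ?W2.
by rewrite -[P]mul1mx -(inv_proj_sum (spin_inv gam (ord3 0))) mulmxDl linearD memvD ?W1.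
Qed.

Let trF b : \tr (F b) = 1.
Proof.
rewrite /inv_proj linearZ linearD linearZ /= mxtrace1.
have -> : \tr K = 0.
  rewrite /K /mxtrace big1 // => i _; rewrite mxE big1 // => k _.
  by rewrite [(_ == k.*2.+1) && _]andbC subrr mulr0.
by rewrite mulr0 addr0 mulVf ?pnatr_eq0.
Qed.

(** Both projectors have rank one, say u v and u' v', so E Q F is the scalar v Q u' times u v'. *)
Lemma F4_odd_line s b : exists Y, forall Q, psi (E s *m Q *m F b) \in <[Y]>%VS.
Proof.
have [u [v Euv]] := spin_proj_rank1 gamC s.
have [u' [v' Fuv]] := idempotent_trace1 (inv_proj_idem KK b) (trF b).
exists (psi (u *m v')) => Q; rewrite Euv Fuv.
have -> : u *m v *m Q *m (u' *m v') = (v *m Q *m u') 0 0 *: (u *m v').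
  rewrite !mulmxA -(mulmxA u) -(mulmxA u) [v *m Q *m u']mx11_scalar mul_mx_scalar.
  by rewrite -scalemxAl [in RHS]mxE eqxx mulr1n.
by rewrite linearZ memvZ ?memv_line.
Qed.

Lemma F4_chi_root s b : is_root true (F4_chi s b).
Proof.
rewrite /is_root F4_chi_neq0 /=; apply/eqP => E0.
have /matrix0Pn[i [j Eij]] := spin_proj_neq0 gamC s.
have /matrix0Pn[k [l Fkl]] : F b != 0.
  by apply/eqP => F0; have := trF b; rewrite F0 mxtrace0 => /eqP; rewrite eq_sym oner_eq0.
have := F4_odd_in (s, b, (j, k)); rewrite E0 memv0 /F4_odd_vec /= => /eqP.
rewrite -[0](linear0 psi) => /(lker0P _).
rewrite psi_inj => /(_ (eqxx _)).
move: (E s) (F b) Eij Fkl => e f Eij Fkl /matrixP/(_ i l);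
  rewrite mxE (bigD1 k) //= big1 => [|k' /negPf nk].
  rewrite mxE (bigD1 j) //= big1 => [|j' /negPf nj]; last by rewrite mxE nj mulr0.
  by rewrite !mxE !eqxx mulr1 !addr0 => /eqP; rewrite mulf_eq0 (negPf Eij) (negPf Fkl).
by rewrite mxE big1 ?mul0r // => j' _; rewrite mxE nk andbF mulr0.
Qed.

Local Notation emb := (@F4_emb C g phi).
Local Notation D := (F4_datum phi).

Lemma F4_regular_cartan : regular_cartan h.
Proof.
have cl := F4_coord_linear hF.
have cK H : emb (osp_torus (coord H)) = vsval H by rewrite -F4_torusE F4_coordK.
have tin td : emb (osp_torus td) \in h by rewrite -F4_torusE; apply: F4_torus_in.
have ct td : coord (vsproj h (emb (osp_torus td))) = td by rewrite -F4_torusE F4_coord_torus.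
have br := F4_emb_br hF; have pa := F4_emb_part hF.
have inv x : emb (osp_inv x) = emb x by rewrite /F4_emb osp_sym_inv.
apply: regular_cartan_intro => [||[]].
- by apply/subvP => X /F4_cartanP[td ->]; apply: (phi_part hF); apply: F4_torus_so7.
- move=> X Y /F4_cartanP[td ->] /F4_cartanP[td' ->].
  rewrite !F4_torusE br (gl_brE (osp_torus_part _) (osp_torus_part _)).
  by rewrite /= scale1r osp_torus_comm subrr linear0.
- apply: (@root_family_regular _ _ _ true _ F4_odd_vec (fun p => F4_chi p.1.1 p.1.2)).
  + exact: F4_odd_in. + exact: F4_odd_span.
  + by move=> p /eqP; rewrite (negPf (F4_chi_neq0 _ _)).
  move=> p _; have [Y YE] := F4_odd_line p.1.1 p.1.2; exists Y => q /F4_chi_inj[Es Eb].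
  by rewrite /F4_odd_vec Es Eb; apply: YE.
apply: (@root_family_regular _ _ _ false _ (mx_root_vec (osp_emb emb) false)
  (fun p => osp_lam coord p.1 - osp_lam coord p.2)).
- by move=> p; apply: osp_family_in.
- by apply: osp_family_span => // Y; apply: F4_emb_onto.
- by move=> p; apply: osp_family0.
by move=> p; apply: osp_family1.
Qed.

(** An odd root and its negative are both among the [F4_chi], and the regular element is positive on
    one of them. *)
Lemma F4_odd_pos (P1 : seq (weight h)) : @positive_system C D P1 -> P1 != [::].
Proof.
move=> [_ [H Hpos]]; pose s := (true, true, true).
have [s' Es'] := F4_chiN s true.
have in_P1 t b : 0 < wt (F4_chi t b) H -> P1 != [::].
  by move=> gt0; have := (Hpos true (F4_chi t b)).2; rewrite F4_chi_root gt0 /=; case: (P1).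
have [/(_ (F4_chi_root s true))[gt0|lt0] _] := Hpos true (F4_chi s true).
  exact: (in_P1 s true gt0).
by apply: (in_P1 s' (~~ true)); rewrite Es' wtN oppr_gt0.
Qed.

(** The list is a rearrangement of the positive even roots of osp(7|2), whose 2 delta_1 is the delta
    of F(4). *)
Lemma F4_pos0_uniq : uniq (F4_pos0 phi).
Proof.
have cl := F4_coord_linear hF.
have ct td : coord (vsproj h (emb (osp_torus td))) = td by rewrite -F4_torusE F4_coord_torus.
have := @uniq_osp_pos C 7 1 g h (osp_lam coord) (osp_lam_pt cl) (osp_lam_dual cl ct) isT.
have -> : (fun i => osp_lam coord (eps_idx 1 i)) = @F4_eps C g phi.
  apply: boolp.funext => i; apply/lfunP => H; rewrite -[LHS]/(wt _ H) osp_lam_eps //.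
  by rewrite /F4_eps linfunE // => a H1 H2; rewrite cl !mxE.
have dE : 2 *: osp_lam coord (delta_idx 7 (0 : 'I_1)) = @F4_delta C g phi.
  apply/lfunP => H; rewrite scale_lfunE -[osp_lam _ _ H]/(wt _ H) osp_lam_delta //.
  rewrite /F4_delta linfunE // => a H1 H2; rewrite cl !mxE /GRing.scale /=; ring.
have lt1 : ltpairs 1 = [::].
  rewrite /ltpairs (eq_filter (a2 := pred0)) ?filter_pred0 // => -[i j] /=.
  by rewrite (ord1 i) (ord1 j).
rewrite /osp_pos lt1 enum_ordSl (size0nil (size_enum_ord 0)) /= -dE => /andP[nin un].
apply/andP; split; last by rewrite uniq_catC -catA.
by move: nin; rewrite !mem_cat !negb_or => /and3P[-> -> ->].
Qed.

Lemma F4_omega_cartan w X : F4_omega phi w -> X \in h -> w X \in h.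
Proof.
move=> wE /F4_cartanP[td ->]; apply/F4_cartanP.
exists (map_mx Num.conj td.1, map_mx Num.conj td.2).
case: wE => [wE|[k wE]]; rewrite /F4_torus wE /=; try exact: F4_torus_so7.
  (* Torus matrices are antisymmetric, so on the sl(2) component minus the conjugate is the
     adjoint. *)
  rewrite torus_mx_adjoint; congr (phi (_, _)).
  by rewrite -[RHS]torus_mx_adjoint /adjoint_mx torus_mx_tr map_mxN.
(* The signs of [sig25_mx k] agree on the two coordinates of each block, so conjugation by it fixes
   torus matrices. *)
rewrite !torus_mx_adjoint; congr (phi (_, _)); apply/matrixP => i j.
rewrite mul_mx_diag mxE mul_diag_mx !mxE mulrAC.
rewrite mulr_sumr; apply: eq_bigr => l _.
have [Ei|Ei] := eqVneq (nat_of_ord i)./2 l; last first.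
  have -> : (nat_of_ord i == l.*2) = false by apply/eqP => Eil; case/eqP: Ei;
    rewrite Eil doubleK.
  have -> : (nat_of_ord i == l.*2.+1) = false.
    by apply/eqP => Eil; case/eqP: Ei; rewrite Eil /= uphalf_double.
  by rewrite subrr !mulr0.
have [Ej|Ej] := eqVneq (nat_of_ord j)./2 l; last first.
  have -> : (nat_of_ord j == l.*2) = false by apply/eqP => Ejl; case/eqP: Ej;
    rewrite Ejl doubleK.
  have -> : (nat_of_ord j == l.*2.+1) = false.
    by apply/eqP => Ejl; case/eqP: Ej; rewrite Ejl /= uphalf_double.
  by rewrite !andbF subrr !mulr0.
by rewrite Ei Ej; case: ifP => _; rewrite ?mulrNN !mul1r.
Qed.
End F4Odd.

(** Odd positive roots exist, so [n1_plus] is nonzero and the dual bases are not empty; their first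
    vectors pair to 1, which is the nonzero value required for nondegeneracy. *)
Lemma F4_regular_datum (C : numClosedFieldType) (g : lieSuperalgebra C)
  (phi : {linear ('M[C]_7 * 'M[C]_2)%type -> g})
  (w : F4_datum phi -> F4_datum phi) (P1 : seq (weight (d_cartan (F4_datum phi)))) (eps : C) :
  is_F4 phi -> d_omega (F4_datum phi) w -> positive_system P1 -> adapted P1 w eps ->
  regular_datum w.
Proof.
move=> hF wO HP1 [_ [n [d [x [bd bx dx _]]]]].
have [simple _ _ _ [gam [psi [gamC psi0 psi1 psi_br]]]] := hF.
split; [|exact: (F4_regular_cartan hF gamC psi1 psi_br)|exact: (F4_pos0_uniq hF)|].
  apply: F4_form_invariant simple _.
  have := F4_odd_pos hF gamC psi0 psi1 psi_br HP1.
  case: P1 HP1 bd bx => [//|al P1'] HP1 bd bx _.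
  case: n d x bd bx dx => [|n] d x bd bx dx; last first.
    by exists (tnth d ord0), (tnth x ord0); have := dx ord0 ord0; rewrite eqxx /= => ->;
      apply: oner_neq0.
  have /andP[nz nz1] : is_root true al.
    by case: HP1 => _ [H /(_ true al)[_]]; rewrite mem_head => /esym/andP[].
  case/negP: nz1; rewrite -subv0.
  have : n1_plus (al :: P1') = 0%VS by apply/eqP; rewrite -dimv_eq0 (size_basis bd).
  by rewrite /n1_plus big_cons => <-; apply: addvSl.
by move=> X; apply: (F4_omega_cartan wO).
Qed.

Lemma listed_regular_datum (C : numClosedFieldType) (D : datum C) : listed D ->
  forall (w : D -> D) (P1 : seq (weight (d_cartan D))) (eps : C),
  d_omega D w -> positive_system P1 -> adapted P1 w eps -> regular_datum w.
Proof.
case=> [m n m0 n0 mn|n n0|m n m0 n0|g phi hF] w P1 eps wO HP1 wP1.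
- exact: sl_regular_datum.
- exact: gl_regular_datum.
- exact: osp_regular_datum.
exact: F4_regular_datum hF wO HP1 wP1.
Qed.

Theorem corollary38 (R : realType) (D : datum R[i]) (hD : listed D)
  (w : D -> D) (hw : anti_involution w) (hwD : d_omega D w)
  (P1 : seq (weight (d_cartan D))) (hP1 : positive_system P1)
  (eps : R[i]) (hadapted : adapted P1 w eps)
  (M : superrep D) (hM : unitary M w)
  (La : weight (d_cartan D)) (hLa : highest_weight M P1 La)
  (mult : weight (d_cartan D) -> nat)
  (N : forall mu : weight (d_cartan D), 'I_(mult mu) -> M -> Prop)
  (hN : g0_decomposition N)
  (mu : weight (d_cartan D)) (hmu : mult mu <> 0%N) :
  let casimir_gap : R[i] :=
    - dual_form (d_form D) (La + 2 *: rho P1) La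
    + dual_form (d_form D) (mu + 2 *: rho P1) mu in
  0 <= - eps * casimir_gap /\ (mu <> La -> 0 < - eps * casimir_gap).
Proof.
have HD := listed_regular_datum hD hwD hP1 hadapted.
case: hN => L0N _ _; have mu_gt0 : (0 < mult mu)%N by rewrite lt0n; apply/eqP.
have [_ [v [nzv _ vmu kv]] _] := L0N mu (Ordinal mu_gt0).
exact: (casimir_gap_ge0 HD hw hP1 hadapted hM hLa nzv vmu kv).
Qed.
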